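(* Let $\mathcal{A}\subset B(\mathfrak{H})$ be a unital operator algebra. Then $\mathcal{A}$ is finite-dimensional if and only if there is another unital operator algebra $\mathcal{F}$ that is completely isometrically isomorphic to $\mathcal{A}$ and that is similar to an operator algebra whose $C^*$-envelope is finite-dimensional.
   Context: A unital operator algebra is a norm closed subalgebra of $B(\mathfrak{H})$ containing the identity, $\mathfrak{H}$ a complex Hilbert space. Two operator algebras $\mathcal{F},\mathcal{G}\subset B(\mathfrak{K})$ are similar if there is an invertible $Z\in B(\mathfrak{K})$ with $\mathcal{F}=Z^{-1}\mathcal{G}Z$. Completely isometrically isomorphic means there is an algebra isomorphism all of whose entrywise matrix ampliations are isometric. The $C^*$-envelope $C^*_e(\mathcal{B})$ of a unital operator algebra $\mathcal{B}$ is the (essentially unique) $C^*$-algebra $C^*(\varepsilon(\mathcal{B}))$, where $\varepsilon$ is a unital completely isometric linear map on $\mathcal{B}$ such that for every unital completely isometric linear map $\phi:\mathcal{B}\to B(\mathfrak{H}_\phi)$ there is a $*$-homomorphism $\pi:C^*(\phi(\mathcal{B}))\to C^*_e(\mathcal{B})$ with $\pi\circ\phi=\varepsilon$ on $\mathcal{B}$. *)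

(* Defs.v *)
From HB Require Import structures.
From mathcomp Require Import all_boot all_order all_algebra.
From mathcomp Require Import complex.
From mathcomp Require Import mathcomp_extra boolp classical_sets functions.
From mathcomp Require Import reals topology normedtype.

Set Implicit Arguments.
Unset Strict Implicit.
Unset Printing Implicit Defensive.

Import Order.TTheory GRing.Theory Num.Theory.
Import numFieldNormedType.Exports.

Local Open Scope classical_set_scope.
Local Open Scope ring_scope.
Local Open Scope complex_scope.

(* The form is linear in its first argument and conjugate-linear in its second;
   it induces the norm of the complete normed module.  The norm of a normed
   module over R[i] is itself R[i]-valued (see hnorm below). *)
HB.mixin Record isHilbert (R : realType) H of CompleteNormedModule R[i] H := {
  inner : {dot H for @Num.conj R[i]} ;
  inner_normE : forall x : H, inner x x = `|x| ^+ 2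
}.

#[short(type="hilbertType")]
HB.structure Definition Hilbert (R : realType) :=
  {H of isHilbert R H & CompleteNormedModule R[i] H}.

Section FiniteDimension.
Context {R : realType} {V : lmodType R[i]}.

(* Meant for linear subspaces S of V. *)
Definition finite_dimensional (S : set V) : Prop :=
  exists (n : nat) (v : 'I_n -> V),
    (forall i, S (v i)) /\
    (forall x, S x -> exists c : 'I_n -> R[i], x = \sum_(i < n) c i *: v i).

End FiniteDimension.

(* Operators are bare functions, with the pointwise linear structure on H -> K;
   B(H) is the set [bounded_operator] of the functions H -> H that are linear
   and bounded. *)
Section Operators.
Context {R : realType}.

Definition hnorm {H : hilbertType R} (x : H) : R := complex.Re `|x|.

Definition bounded_operator {H K : hilbertType R} : set (H -> K) :=
  [set T | linear T /\ exists M : R, forall x, hnorm (T x) <= M * hnorm x].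

Definition opnorm {H K : hilbertType R} (T : H -> K) : R :=
  sup [set hnorm (T x) | x in [set x : H | hnorm x <= 1]].

Definition hnorm_tuple {H : hilbertType R} {n : nat} (x : 'I_n -> H) : R :=
  Num.sqrt (\sum_(i < n) hnorm (x i) ^+ 2).

(* Norm of the operator on the n-fold Hilbert space direct sum of H with
   operator matrix T. *)
Definition mxopnorm {H : hilbertType R} {n : nat} (T : 'M[H -> H]_n) : R :=
  sup [set hnorm_tuple (fun i => \sum_(j < n) T i j (x j)) |
        x in [set x : 'I_n -> H | hnorm_tuple x <= 1]].

Definition adjoint_of {H : hilbertType R} (T S : H -> H) : Prop :=
  forall x y : H, inner (T x) y = inner x (S y).

End Operators.

Section OperatorAlgebras.
Context {R : realType}.
Implicit Types H K L : hilbertType R.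

Definition norm_closed {H} (A : set (H -> H)) : Prop :=
  forall T, bounded_operator T ->
    (forall e : R, 0 < e -> exists2 S, A S & opnorm (T - S) < e) -> A T.

Definition operator_algebra {H} (A : set (H -> H)) : Prop :=
  [/\ A `<=` bounded_operator,
      A 0,
      forall (a : R[i]) S T, A S -> A T -> A (a *: S + T),
      forall S T, A S -> A T -> A (S \o T)
    & norm_closed A].

Definition unital_operator_algebra {H} (A : set (H -> H)) : Prop :=
  operator_algebra A /\ A id.

Definition cstar_algebra {H} (A : set (H -> H)) : Prop :=
  operator_algebra A /\
  forall T S, A T -> bounded_operator S -> adjoint_of T S -> A S.

(* C*(S) *)
Definition cstar_generated {H} (S : set (H -> H)) : set (H -> H) :=
  smallest cstar_algebra S.

(* Maps defined on a set A of operators on H are total functions on H -> H,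
   constrained on A only. *)
Definition linear_on {H K} (A : set (H -> H)) (phi : (H -> H) -> (K -> K)) :=
  forall (a : R[i]) S T, A S -> A T -> phi (a *: S + T) = a *: phi S + phi T.

Definition multiplicative_on {H K} (A : set (H -> H))
    (phi : (H -> H) -> (K -> K)) :=
  forall S T, A S -> A T -> phi (S \o T) = phi S \o phi T.

Definition completely_isometric_on {H K} (A : set (H -> H))
    (phi : (H -> H) -> (K -> K)) :=
  forall (n : nat) (T : 'M[H -> H]_n), (forall i j, A (T i j)) ->
    mxopnorm (map_mx phi T) = mxopnorm T.

Definition star_homomorphism {H K} (A : set (H -> H)) (B : set (K -> K))
    (pi : (H -> H) -> (K -> K)) : Prop :=
  [/\ forall T, A T -> B (pi T),
      linear_on A pi,
      multiplicative_on A pi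
    & forall T S, A T -> A S -> adjoint_of T S -> adjoint_of (pi T) (pi S)].

Definition unital_complete_isometry {H K} (A : set (H -> H))
    (phi : (H -> H) -> (K -> K)) : Prop :=
  [/\ forall T, A T -> bounded_operator (phi T),
      linear_on A phi,
      phi id = id
    & completely_isometric_on A phi].

Definition completely_isometrically_isomorphic {H K} (A : set (H -> H))
    (F : set (K -> K)) : Prop :=
  exists theta : (H -> H) -> (K -> K),
    [/\ set_bij A F theta,
        linear_on A theta,
        multiplicative_on A theta
      & completely_isometric_on A theta].

Definition similar_algebras {K} (F G : set (K -> K)) : Prop :=
  exists Z Zinv : K -> K,
    [/\ bounded_operator Z,
        bounded_operator Zinv,
        Zinv \o Z = id,
        Z \o Zinv = id
      & F = [set Zinv \o T \o Z | T in G]].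

(* C*(eps(B)) is the C*-envelope of B. *)
Definition cstar_envelope {H} (B : set (H -> H)) {K}
    (eps : (H -> H) -> (K -> K)) : Prop :=
  unital_complete_isometry B eps /\
  forall L (phi : (H -> H) -> (L -> L)), unital_complete_isometry B phi ->
    exists pi : (L -> L) -> (K -> K),
      star_homomorphism (cstar_generated (phi @` B))
                        (cstar_generated (eps @` B)) pi /\
      forall T, B T -> pi (phi T) = eps T.

(* The C*-envelope exists and is unique up to *-isomorphism, so any witness
   eps may be used. *)
Definition finite_dimensional_cstar_envelope {H} (B : set (H -> H)) : Prop :=
  exists K (eps : (H -> H) -> (K -> K)),
    cstar_envelope B eps /\ finite_dimensional (cstar_generated (eps @` B)).

End OperatorAlgebras.

(* Main.v *)
(** The interesting direction starts from a finite-dimensional A.  Left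
multiplication on A, for the inner product <T, U> = sum_s <T h_s, U h_s> given
by separating vectors h_s, is a completely contractive representation lam of A
on C^d, and some invertible S makes S T S^-1 completely dominated by lam T: if
the a_i form an orthonormal basis of A and P = sum_i a_i a_i^*, take
S = P^(-1/2).  Then F = {T (+) lam T} is completely isometrically isomorphic to
A and similar to G = {S T S^-1 (+) lam T}, for which the second summand alone is
completely isometric.

It remains to see that a finite-dimensional unital algebra G with a unital
complete isometry into the operators on C^k has a finite-dimensional
C*-envelope.  Choose one, eps, with k minimal.  By minimality, completely
positive maps which almost fix eps(G) cannot almost annihilate the projection
onto a unit vector, since one could otherwise compress to its orthogonal
complement.  Iterating such maps, this forces them to be almost multiplicative
on eps(G).  Hence, for another unital complete isometry phi of G, the almost
isometries C^k -> L^m produced by an approximate form of Arveson's extension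
theorem almost intertwine eps(T) with phi(T) and eps(T)^* with phi(T)^*, and in
the limit they implement the *-homomorphism C*(phi(G)) -> C*(eps(G)). *)

Require Import Defs.
From HB Require Import structures.
From mathcomp Require Import all_boot all_order all_algebra.
From mathcomp Require Import complex.
From mathcomp Require Import mathcomp_extra boolp classical_sets functions.
From mathcomp Require Import reals topology normedtype.
From mathcomp Require Import ring lra.
Set Implicit Arguments.
Unset Strict Implicit.
Unset Printing Implicit Defensive.

Import Order.TTheory GRing.Theory Num.Theory.
Import numFieldNormedType.Exports.

Local Open Scope classical_set_scope.
Local Open Scope ring_scope.
Local Open Scope complex_scope.

(** * Complex numbers and Hilbert spaces *)

(** C*(phi(G)) may be infinite-dimensional and act on an arbitrary space L, so its homomorphism into
    the envelope cannot be read off from a basis. Weak limits of completely positive maps are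
    avoided as well: such a map into k by k matrices is represented by finitely many vectors v_p in
    a finite power of L, through the moments <T v_p, v_q>, which match the wanted values only up to
    a tolerance. The only compactness used is that of bounded sets in finite dimension. A complete
    isometry is known through its matrix norms alone. Hence the relation [mxdom] between tuples of
    operators: a complete isometry is domination both ways, and both the compression to a smaller
    C^k and the comparison of two embeddings are handled as dominations. Neither summand of G would
    do alone: T |-> S T S^-1 need not keep the matrix norms of A, and lam is only contractive on A.
    In T (+) lam T the first summand carries the norm; after conjugation by S (+) 1 the second one
    does. Conversely, a finite-dimensional envelope contains a completely isometric copy of G, and
    finite dimension passes back through the similarity and the isomorphism. *)

Lemma invSn_small (R : realType) (e : R) :
  0 < e -> exists N, forall n, (N <= n)%N -> n.+1%:R^-1 < e.
Proof.
move=> e0; exists (Num.truncn e^-1).+1 => n hn.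
rewrite invf_plt ?posrE ?ltr0n// (lt_le_trans (truncnS_gt _))//.
by rewrite ler_nat (leq_trans hn).
Qed.

Section ComplexModulus.
Context {R : realType}.
Local Notation C := R[i].
Implicit Types (z w : C) (a b : R).

(** The norm of R[i] takes its values in R[i]; this real-valued copy keeps all estimates in the
    ordered field R. *)
Definition cmod z : R := complex.Re `|z|.

Lemma normr_cmod z : `|z| = (cmod z)%:C.
Proof. by rewrite /cmod normc_def. Qed.

Lemma cmod_sqr z : cmod z ^+ 2 = complex.Re z ^+ 2 + complex.Im z ^+ 2.
Proof. by apply: complexI; rewrite rmorphXn /= -normr_cmod -add_Re2_Im2. Qed.

Lemma cmod_ge0 z : 0 <= cmod z.
Proof. by rewrite -lecR -normr_cmod normr_ge0. Qed.

Lemma cmodM z w : cmod (z * w) = cmod z * cmod w.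
Proof. by apply: complexI; rewrite rmorphM /= -!normr_cmod normrM. Qed.

Lemma cmodD z w : cmod (z + w) <= cmod z + cmod w.
Proof. by rewrite -lecR rmorphD /= -!normr_cmod ler_normD. Qed.

Lemma cmodN z : cmod (- z) = cmod z.
Proof. by rewrite /cmod normrN. Qed.

Lemma cmod_conj z : cmod z^*%C = cmod z.
Proof. by rewrite /cmod normcJ. Qed.

Lemma cmod_real a : cmod a%:C = `|a|.
Proof. by rewrite /cmod normc_def /= expr0n /= addr0 sqrtr_sqr. Qed.

Lemma cmod0 : cmod 0 = 0.
Proof. by rewrite /cmod normr0. Qed.

Lemma cmod_eq0 z : cmod z = 0 -> z = 0.
Proof. by move=> h; apply/eqP; rewrite -normr_eq0 normr_cmod h. Qed.

Lemma cmod_Re z : `|complex.Re z| <= cmod z.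
Proof. by rewrite -lecR -normr_cmod normc_ge_Re. Qed.

Lemma cmod_Im z : `|complex.Im z| <= cmod z.
Proof.
by rewrite -ler_sqr ?nnegrE ?cmod_ge0// cmod_sqr real_normK ?num_real// lerDr sqr_ge0.
Qed.

Lemma cmod_le z : cmod z <= `|complex.Re z| + `|complex.Im z|.
Proof.
rewrite -ler_sqr ?nnegrE ?cmod_ge0 ?addr_ge0// cmod_sqr sqrrD.
rewrite !real_normK ?num_real// addrAC lerDl mulrn_wge0//.
by rewrite mulr_ge0.
Qed.

Lemma ReD z w : complex.Re (z + w) = complex.Re z + complex.Re w.
Proof. by case: z; case: w. Qed.

Lemma ReN z : complex.Re (- z) = - complex.Re z.
Proof. by case: z. Qed.

Lemma ReB z w : complex.Re (z - w) = complex.Re z - complex.Re w.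
Proof. by rewrite ReD ReN. Qed.

Lemma ImB z w : complex.Im (z - w) = complex.Im z - complex.Im w.
Proof. by case: z; case: w. Qed.

Lemma Re_sum (I : Type) (r : seq I) (P : pred I) (F : I -> C) :
  complex.Re (\sum_(i <- r | P i) F i) = \sum_(i <- r | P i) complex.Re (F i).
Proof. exact: (big_morph _ ReD erefl). Qed.

Lemma Re_realM a z : complex.Re (a%:C * z) = a * complex.Re z.
Proof. by case: z => x y /=; rewrite mul0r subr0. Qed.

Lemma Re_conj z : complex.Re z^*%C = complex.Re z.
Proof. by case: z. Qed.

Lemma Re_mulJ z : complex.Re (z^*%C * z) = cmod z ^+ 2.
Proof. by rewrite cmod_sqr; case: z => a b /=; rewrite mulNr opprK !expr2. Qed.

Lemma conjCM z w : (z * w)^*%C = z^*%C * w^*%C.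
Proof. exact: rmorphM. Qed.

Lemma mulJ_cmod z : z^*%C * z = (cmod z ^+ 2)%:C.
Proof. by rewrite mulrC -sqr_normc normr_cmod rmorphXn. Qed.

Lemma cmod_sum (I : Type) (r : seq I) (P : pred I) (F : I -> C) :
  cmod (\sum_(i <- r | P i) F i) <= \sum_(i <- r | P i) cmod (F i).
Proof.
elim/big_ind2: _ => [|z x w y hz hw|//]; first by rewrite cmod0.
exact: le_trans (cmodD _ _) (lerD hz hw).
Qed.

End ComplexModulus.

Section HilbertBasics.
Context {R : realType} {H : hilbertType R}.
Local Notation C := R[i].
Implicit Types (x y z : H) (a b : C).

Definition rinner x y : R := complex.Re (inner x y).

Lemma innerDl x y z : inner (x + y) z = inner x z + inner y z.
Proof. by rewrite linearDl. Qed.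
Lemma innerDr x y z : inner x (y + z) = inner x y + inner x z.
Proof. by rewrite linearDr. Qed.
Lemma innerZl a x y : inner (a *: x) y = a * inner x y.
Proof. by rewrite linearZl_LR. Qed.
Lemma innerZr a x y : inner x (a *: y) = a^*%C * inner x y.
Proof. by rewrite linearZr_LR. Qed.
Lemma innerC x y : inner x y = (inner y x)^*%C.
Proof. by rewrite hermC expr0 mul1r. Qed.
Lemma innerNl x y : inner (- x) y = - inner x y.
Proof. by rewrite linearNl. Qed.
Lemma innerNr x y : inner x (- y) = - inner x y.
Proof. by rewrite linearNr. Qed.
Lemma inner0l x : inner (0 : H) x = 0.
Proof. by rewrite linear0l. Qed.
Lemma inner0r x : inner x (0 : H) = 0.
Proof. by rewrite linear0r. Qed.
Lemma innerBl x y z : inner (x - y) z = inner x z - inner y z.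
Proof. by rewrite innerDl innerNl. Qed.
Lemma innerBr x y z : inner x (y - z) = inner x y - inner x z.
Proof. by rewrite innerDr innerNr. Qed.
Lemma inner_suml (I : Type) (r : seq I) (P : pred I) (F : I -> H) y :
  inner (\sum_(i <- r | P i) F i) y = \sum_(i <- r | P i) inner (F i) y.
Proof. by rewrite (big_morph (fun x => inner x y) (fun u v => innerDl u v y) (inner0l y)). Qed.
Lemma inner_sumr (I : Type) (r : seq I) (P : pred I) (F : I -> H) y :
  inner y (\sum_(i <- r | P i) F i) = \sum_(i <- r | P i) inner y (F i).
Proof. by rewrite (big_morph (fun x => inner y x) (fun u v => innerDr y u v) (inner0r y)). Qed.

Lemma norm_hnorm x : `|x| = (hnorm x)%:C.
Proof. by rewrite /hnorm RRe_real // normr_real. Qed.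

Lemma hnorm_ge0 x : 0 <= hnorm x.
Proof. by rewrite -lecR -norm_hnorm normr_ge0. Qed.

Lemma inner_hnorm x : inner x x = (hnorm x ^+ 2)%:C.
Proof. by rewrite inner_normE norm_hnorm rmorphXn. Qed.

Lemma rinner_hnorm x : rinner x x = hnorm x ^+ 2.
Proof. by rewrite /rinner inner_hnorm. Qed.

Lemma hnorm0 : hnorm (0 : H) = 0.
Proof. by rewrite /hnorm normr0. Qed.

Lemma hnorm_eq0 x : hnorm x = 0 -> x = 0.
Proof. by move=> h; apply/eqP; rewrite -normr_eq0 norm_hnorm h. Qed.

Lemma hnormD x y : hnorm (x + y) <= hnorm x + hnorm y.
Proof. by rewrite -lecR rmorphD /= -!norm_hnorm ler_normD. Qed.

Lemma hnormN x : hnorm (- x) = hnorm x.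
Proof. by rewrite /hnorm normrN. Qed.

Lemma hnormZ a x : hnorm (a *: x) = cmod a * hnorm x.
Proof. by apply: complexI; rewrite rmorphM /= -norm_hnorm normrZ normr_cmod norm_hnorm. Qed.

Lemma hnormB x y : hnorm (x - y) <= hnorm x + hnorm y.
Proof. by rewrite -(hnormN y) hnormD. Qed.

Lemma hnormBC x y : hnorm (x - y) = hnorm (y - x).
Proof. by rewrite -hnormN opprB. Qed.

Lemma hnorm_triB x y z : hnorm (x - z) <= hnorm (x - y) + hnorm (y - z).
Proof. by rewrite -[x - z](_ : (x - y) + (y - z) = _) ?hnormD// addrA subrK. Qed.

Lemma hnorm_sum (I : Type) (r : seq I) (P : pred I) (F : I -> H) :
  hnorm (\sum_(i <- r | P i) F i) <= \sum_(i <- r | P i) hnorm (F i).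
Proof.
elim/big_ind2: _ => [|z x w y hz hw|//]; first by rewrite hnorm0.
exact: le_trans (hnormD _ _) (lerD hz hw).
Qed.

Lemma rinnerDl x y z : rinner (x + y) z = rinner x z + rinner y z.
Proof. by rewrite /rinner innerDl ReD. Qed.
Lemma rinnerDr x y z : rinner x (y + z) = rinner x y + rinner x z.
Proof. by rewrite /rinner innerDr ReD. Qed.
Lemma rinnerNl x y : rinner (- x) y = - rinner x y.
Proof. by rewrite /rinner innerNl ReN. Qed.
Lemma rinnerNr x y : rinner x (- y) = - rinner x y.
Proof. by rewrite /rinner innerNr ReN. Qed.
Lemma rinnerC x y : rinner x y = rinner y x.
Proof. by rewrite /rinner innerC Re_conj. Qed.
Lemma rinnerZl (t : R) x y : rinner (t%:C *: x) y = t * rinner x y.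
Proof. by rewrite /rinner innerZl Re_realM. Qed.
Lemma rinnerZr (t : R) x y : rinner x (t%:C *: y) = t * rinner x y.
Proof. by rewrite rinnerC rinnerZl rinnerC. Qed.
Lemma rinner0l x : rinner (0 : H) x = 0.
Proof. by rewrite /rinner inner0l. Qed.
Lemma rinner_suml (I : Type) (r : seq I) (P : pred I) (F : I -> H) y :
  rinner (\sum_(i <- r | P i) F i) y = \sum_(i <- r | P i) rinner (F i) y.
Proof. by rewrite /rinner inner_suml Re_sum. Qed.

Lemma hnorm_sqrD x y : hnorm (x + y) ^+ 2 = hnorm x ^+ 2 + 2 * rinner x y + hnorm y ^+ 2.
Proof.
rewrite -!rinner_hnorm rinnerDl !rinnerDr (rinnerC y x).
by ring.
Qed.

Lemma hnorm_sqrB x y : hnorm (x - y) ^+ 2 = hnorm x ^+ 2 - 2 * rinner x y + hnorm y ^+ 2.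
Proof. by rewrite hnorm_sqrD rinnerNr hnormN mulrN. Qed.

Lemma rinner_CS x y : rinner x y <= hnorm x * hnorm y.
Proof.
have [x0|xn0] := eqVneq (hnorm x) 0.
  by rewrite (hnorm_eq0 x0) rinner0l hnorm0 mul0r.
have [y0|yn0] := eqVneq (hnorm y) 0.
  by rewrite rinnerC (hnorm_eq0 y0) rinner0l hnorm0 mulr0.
have hx : 0 < hnorm x by rewrite lt_def xn0 hnorm_ge0.
have hy : 0 < hnorm y by rewrite lt_def yn0 hnorm_ge0.
have := sqr_ge0 (hnorm ((hnorm y)%:C *: x - (hnorm x)%:C *: y)).
rewrite hnorm_sqrB !hnormZ !cmod_real !ger0_norm ?hnorm_ge0// rinnerZl rinnerZr.
have -> : (hnorm y * hnorm x) ^+ 2 - 2 * (hnorm y * (hnorm x * rinner x y)) +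
   (hnorm x * hnorm y) ^+ 2 = 2 * (hnorm x * hnorm y) * (hnorm x * hnorm y - rinner x y) by ring.
by rewrite pmulr_rge0 ?subr_ge0// !mulr_gt0.
Qed.

Lemma inner_CS x y : cmod (inner x y) <= hnorm x * hnorm y.
Proof.
set w := inner x y.
have [/cmod_eq0 ->|wn0] := eqVneq (cmod w) 0.
  by rewrite cmod0 mulr_ge0 ?hnorm_ge0.
have hw : 0 < cmod w by rewrite lt_def wn0 cmod_ge0.
(* Multiplying x by the conjugate of w makes the inner product real and equal to |w|^2, so the real
   inequality suffices. *)
have := rinner_CS (w^*%C *: x) y.
rewrite hnormZ /rinner innerZl cmod_conj -/w Re_mulJ expr2 -mulrA.
by rewrite ler_pM2l.
Qed.

Lemma rinner_CSN x y : `|rinner x y| <= hnorm x * hnorm y.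
Proof. exact: le_trans (cmod_Re _) (inner_CS x y). Qed.

Lemma inner_eq x y : (forall z, inner x z = inner y z) -> x = y.
Proof.
move=> h; apply/eqP; rewrite -subr_eq0; apply/eqP/hnorm_eq0/eqP.
by rewrite -sqrf_eq0 -rinner_hnorm /rinner innerBl h subrr.
Qed.

Definition cvg_seq (u : nat -> H) (l : H) :=
  forall e : R, 0 < e -> exists N, forall n, (N <= n)%N -> hnorm (u n - l) < e.

Definition cauchy_seq (u : nat -> H) :=
  forall e : R, 0 < e -> exists N, forall n m, (N <= n)%N -> (N <= m)%N -> hnorm (u n - u m) < e.

Lemma hilbert_complete (u : nat -> H) : cauchy_seq u -> exists l, cvg_seq u l.
Proof.
move=> hu.
have hc : cauchy (u @ \oo).
  apply: cauchy_exP => e; rewrite ltcE => /andP[/eqP /= eI e0].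
  have [N hN] := hu _ e0; exists (u N).
  exists N => // n /= hn.
  rewrite -ball_normE /= norm_hnorm ltcE /= eI eqxx /=.
  exact: hN.
have cu := @cauchy_cvg H (u @ \oo) _ hc.
have [l hl] : exists l : H, u @ \oo --> l by eexists; exact: cu.
exists l => e e0.
have e0' : 0 < e%:C by rewrite ltcR.
have [N _ hN] : \forall n \near \oo, `|l - u n| < e%:C by move/cvgrPdist_lt : hl; exact.
exists N => n /hN /=.
by rewrite norm_hnorm ltcR hnormBC.
Qed.

End HilbertBasics.

Section Coisometry.
Context {R : realType} {H K : hilbertType R}.
Variables (V : K -> H) (W : H -> K).
Hypothesis VW : forall (x : K) (y : H), inner (V x) y = inner x (W y).
Hypothesis WK : cancel V W.

Lemma hnorm_isometry x : hnorm (V x) = hnorm x.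
Proof. by apply/eqP; rewrite -(@eqrXn2 _ 2) ?hnorm_ge0// -!rinner_hnorm /rinner VW WK. Qed.

Lemma hnorm_coisometry x : hnorm (W x) <= hnorm x.
Proof.
have [w0|wn0] := eqVneq (hnorm (W x)) 0; first by rewrite w0 hnorm_ge0.
have w1 : 0 < hnorm (W x) by rewrite lt_def wn0 hnorm_ge0.
rewrite -(ler_pM2l w1) -expr2 -rinner_hnorm /rinner -VW.
by apply: le_trans (rinner_CS _ _) _; rewrite hnorm_isometry.
Qed.

End Coisometry.

(** An interface for building Hilbert spaces: each example supplies an inner product and
    completeness for sequences, and the norm, the filter completeness and the bundled form are
    derived once for all. *)
Record preHilbert (R : realType) := PreHilbert {
  ph_sort : lmodType R[i];
  ph_inner : ph_sort -> ph_sort -> R[i];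
  ph_innerP : forall a x y z, ph_inner (a *: x + y) z = a * ph_inner x z + ph_inner y z;
  ph_innerC : forall x y, ph_inner x y = (ph_inner y x)^*%C;
  ph_inner_ge0 : forall x, 0 <= complex.Re (ph_inner x x);
  ph_inner_eq0 : forall x, complex.Re (ph_inner x x) = 0 -> x = 0;
  ph_complete : forall u : nat -> ph_sort,
    (forall e : R, 0 < e -> exists N, forall n m, (N <= n)%N -> (N <= m)%N ->
       complex.Re (ph_inner (u n - u m) (u n - u m)) < e) ->
    exists l, forall e : R, 0 < e -> exists N, forall n, (N <= n)%N ->
       complex.Re (ph_inner (u n - l) (u n - l)) < e }.

Section PreHilbert.
Context {R : realType} (P : preHilbert R).
Local Notation C := R[i].
Local Notation ip := (@ph_inner R P).

Definition ph_type : Type := ph_sort P.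
HB.instance Definition _ := GRing.Lmodule.on ph_type.
Implicit Types (x y z : ph_type) (a : C).

Definition ph_norm x : R := Num.sqrt (complex.Re (ip x x)).

Let ipD x y z : ip (x + y) z = ip x z + ip y z.
Proof. by rewrite -[x]scale1r ph_innerP !scale1r mul1r. Qed.
Let ip0 z : ip 0 z = 0.
Proof. by apply: (addrI (ip 0 z)); rewrite -ipD !addr0. Qed.
Let ipZ a x z : ip (a *: x) z = a * ip x z.
Proof. by rewrite -[a *: x]addr0 ph_innerP ip0 addr0. Qed.
Let ipDr x y z : ip z (x + y) = ip z x + ip z y.
Proof. by rewrite ph_innerC ipD rmorphD /= -!ph_innerC. Qed.
Let ipZr a x z : ip z (a *: x) = a^*%C * ip z x.
Proof. by rewrite ph_innerC ipZ rmorphM /= -ph_innerC. Qed.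
Let ipxx x : ip x x = (ph_norm x ^+ 2)%:C.
Proof.
rewrite sqr_sqrtr ?ph_inner_ge0// RRe_real//.
have /(congr1 (@complex.Im R)) := ph_innerC x x.
by case: (ip x x) => a b /= h; rewrite complex_real; apply/eqP; lra.
Qed.
Let nge0 x : 0 <= ph_norm x. Proof. exact: sqrtr_ge0. Qed.

Let norm_eq0 x : ph_norm x = 0 -> x = 0.
Proof.
by move=> h; apply: ph_inner_eq0; rewrite ipxx h expr0n.
Qed.

Let normZ a x : ph_norm (a *: x) = cmod a * ph_norm x.
Proof.
rewrite /ph_norm ipZ ipZr mulrA (mulrC a) mulJ_cmod Re_realM sqrtrM ?sqr_ge0//.
by rewrite sqrtr_sqr ger0_norm ?cmod_ge0.
Qed.

Let norm_sqr x : complex.Re (ip x x) = ph_norm x ^+ 2.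
Proof. by rewrite ipxx. Qed.

Let norm_sqrD x y :
  ph_norm (x + y) ^+ 2 = ph_norm x ^+ 2 + 2 * complex.Re (ip x y) + ph_norm y ^+ 2.
Proof.
rewrite -!norm_sqr ipD !ipDr !ReD (ph_innerC y x) Re_conj.
by ring.
Qed.

Let CS x y : complex.Re (ip x y) <= ph_norm x * ph_norm y.
Proof.
have [x0|xn0] := eqVneq (ph_norm x) 0.
  by rewrite (norm_eq0 x0) ip0 mulr_ge0.
have [y0|yn0] := eqVneq (ph_norm y) 0.
  by rewrite ph_innerC Re_conj (norm_eq0 y0) ip0 mulr_ge0.
have hx : 0 < ph_norm x by rewrite lt_def xn0 nge0.
have hy : 0 < ph_norm y by rewrite lt_def yn0 nge0.
have := sqr_ge0 (ph_norm ((ph_norm y)%:C *: x + (- ph_norm x)%:C *: y)).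
rewrite norm_sqrD !normZ !cmod_real normrN !ger0_norm ?nge0//.
rewrite ipZ Re_realM ipZr conjc_real Re_realM.
set t := complex.Re _.
have -> : (ph_norm y * ph_norm x) ^+ 2 + 2 * (ph_norm y * (- ph_norm x * t)) +
   (ph_norm x * ph_norm y) ^+ 2 = 2 * (ph_norm x * ph_norm y) * (ph_norm x * ph_norm y - t) by ring.
by rewrite pmulr_rge0 ?subr_ge0// !mulr_gt0.
Qed.

Let ler_normD x y : (ph_norm (x + y))%:C <= (ph_norm x)%:C + (ph_norm y)%:C.
Proof.
rewrite -rmorphD lecR -ler_sqr ?nnegrE ?addr_ge0// norm_sqrD sqrrD.
by rewrite lerD2r lerD2l mulr_natl lerMn2r /= CS.
Qed.

Let normrZ a x : (ph_norm (a *: x))%:C = `|a| * (ph_norm x)%:C.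
Proof. by rewrite normZ rmorphM normr_cmod. Qed.

Let normr0_eq0 x : (ph_norm x)%:C = 0 -> x = 0.
Proof. by move=> /complexI; exact: norm_eq0. Qed.

HB.instance Definition _ := Lmodule_isNormed.Build C ph_type ler_normD normrZ normr0_eq0.

Let complete (F : set_system ph_type) : ProperFilter F -> cauchy F -> cvg F.
Proof.
move=> FF /cauchyP Fc.
(* The filter is replaced by a sequence of centres of balls of radius 1/(n+1) that belong to it. Two
   such balls always meet because F is proper, so the sequence is Cauchy. *)
have /choice [u hu] : forall n, exists x, F (ball x ((n.+1)%:R^-1)%:C).
  by move=> n; apply: Fc; rewrite ltcR invr_gt0 ltr0n.
have hu2 n m : ph_norm (u n - u m) < n.+1%:R^-1 + m.+1%:R^-1.
  have /filter_ex [z []] : F (ball (u n) ((n.+1)%:R^-1)%:C `&` ball (u m) ((m.+1)%:R^-1)%:C).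
    by apply: filterI; exact: hu.
  rewrite -!ball_normE /= => h1 h2.
  rewrite -ltcR.
  have -> : u n - u m = (u n - z) + (z - u m) by rewrite addrA subrK.
  apply: (le_lt_trans (ler_normD _ _)); rewrite [X in _ < X]rmorphD/=.
  by apply: ltrD => //; rewrite -opprB -scaleN1r normrZ normrN1 mul1r.
have [l hl] : exists l, forall e : R, 0 < e -> exists N, forall n, (N <= n)%N ->
       complex.Re (ip (u n - l) (u n - l)) < e.
  apply: ph_complete => e e0.
  have e1 : 0 < Num.sqrt e / 2 by rewrite divr_gt0 ?sqrtr_gt0.
  have [N hN] := invSn_small e1; exists N => n m hn hm.
  rewrite norm_sqr -(sqr_sqrtr (ltW e0)) ltr_sqr ?nnegrE ?sqrtr_ge0//.
  by apply: (lt_trans (hu2 _ _)); rewrite [ltRHS]splitr ltrD// hN.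
apply: (cvgP l); apply/cvg_ballP => e; rewrite ltcE => /andP[/eqP /= eI e0].
have e1 : 0 < complex.Re e / 2 by rewrite divr_gt0.
have [N1 hN1] := invSn_small e1; have [N2 hN2] := hl _ (exprn_gt0 2 e1).
pose n := maxn N1 N2.
move: (hu n); apply: filterS => z; rewrite -!ball_normE /= => h1.
have -> : e = (complex.Re e)%:C by case: (e) eI => a b /= ->.
have -> : l - z = (l - u n) + (u n - z) by rewrite addrA subrK.
apply: (le_lt_trans (ler_normD _ _)); rewrite [complex.Re e]splitr rmorphD/=.
apply: ltrD.
  rewrite -opprB -scaleN1r normrZ normrN1 mul1r ltcR.
  rewrite -ltr_sqr ?nnegrE ?nge0 ?(ltW e1)// -norm_sqr.
  by apply: hN2; rewrite leq_maxr.
by apply: (lt_trans h1); rewrite ltcR; apply: hN1; rewrite leq_maxl.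
Qed.

HB.instance Definition _ := Uniform_isComplete.Build ph_type complete.

Definition ph_dot : ph_type -> ph_type -> C := ip.

Let ph_dotDl z : zmod_morphism (ph_dot^~ z).
Proof. by move=> x y; rewrite /ph_dot -scaleN1r ipD ipZ mulN1r. Qed.
Let ph_dotDr z : zmod_morphism (ph_dot z).
Proof. by move=> x y; rewrite /ph_dot -scaleN1r ipDr ipZr rmorphN1 mulN1r. Qed.
Let ph_dotZl z : scalable_for *%R (ph_dot^~ z).
Proof. by move=> a x; exact: ipZ. Qed.
Let ph_dotZr z : scalable_for (@Num.conj C \; *%R) (ph_dot z).
Proof. by move=> a x; exact: ipZr. Qed.
HB.instance Definition _ := isBilinear.Build C ph_type ph_type C *%R
  (@Num.conj C \; *%R) ph_dot ph_dotDl ph_dotDr ph_dotZl ph_dotZr.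

Let ph_dotC x y : ph_dot x y = (-1) ^+ false * Num.conj (ph_dot y x).
Proof. by rewrite expr0 mul1r; exact: ph_innerC. Qed.
HB.instance Definition _ :=
  isHermitianSesquilinear.Build C ph_type false (@Num.conj C) ph_dot ph_dotC.

Let ph_dot_gt0 x : x != 0 -> 0 < ph_dot x x.
Proof.
move=> x0; rewrite /ph_dot ipxx ltcR exprn_gt0// lt_def nge0 andbT.
by apply: contra_neq x0; exact: norm_eq0.
Qed.
HB.instance Definition _ := isDotProduct.Build C ph_type ph_dot ph_dot_gt0.

Let ph_dot_norm x : ph_dot x x = `|x| ^+ 2.
Proof. by rewrite /ph_dot ipxx rmorphXn. Qed.
HB.instance Definition _ := @isHilbert.Build R ph_type ph_dot ph_dot_norm.

End PreHilbert.

Lemma eventually_fin (I : finType) (Q : I -> nat -> Prop) :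
  (forall i, exists N, forall n, (N <= n)%N -> Q i n) ->
  exists N, forall n, (N <= n)%N -> forall i, Q i n.
Proof.
move=> /choice [f hf]; exists (\max_i f i)%N => n hn i.
by apply: hf; apply: leq_trans hn; exact: leq_bigmax.
Qed.

Lemma real_cauchy_cvg (R : realType) (u : nat -> R) :
  (forall e : R, 0 < e -> exists N, forall n m, (N <= n)%N -> (N <= m)%N ->
     `|u n - u m| < e) ->
  exists l, forall e : R, 0 < e -> exists N, forall n, (N <= n)%N -> `|u n - l| < e.
Proof.
move=> hu.
have hc : cauchy (u @ \oo).
  apply: cauchy_exP => e e0.
  have [N hN] := hu _ e0; exists (u N).
  by exists N => // n /= hn; rewrite -ball_normE /=; exact: hN.
have cu := @cauchy_cvg R (u @ \oo) _ hc.
have [l hl] : exists l : R, u @ \oo --> l by eexists; exact: cu.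
exists l => e e0.
have [N _ hN] : \forall n \near \oo, `|l - u n| < e by move/cvgrPdist_lt : hl; exact.
by exists N => n /hN /=; rewrite distrC.
Qed.

(** * Scalars, finite powers and two-fold sums as Hilbert spaces *)

Section ScalarHilbert.
Context {R : realType}.
Local Notation C := R[i].

Let ip (z w : C^o) : C := z * (w : C)^*%C.
Let ipxx z : complex.Re (ip z z) = cmod z ^+ 2.
Proof. by rewrite /ip mulrC Re_mulJ. Qed.
Let ipP a x y z : ip (a *: x + y) z = a * ip x z + ip y z.
Proof. by rewrite /ip mulrDl -mulrA. Qed.
Let ipC x y : ip x y = (ip y x)^*%C.
Proof. by rewrite /ip conjCM conjcK mulrC. Qed.
Let ip_ge0 x : 0 <= complex.Re (ip x x).
Proof. by rewrite ipxx sqr_ge0. Qed.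
Let ip_eq0 x : complex.Re (ip x x) = 0 -> x = 0.
Proof. by rewrite ipxx => /eqP; rewrite sqrf_eq0 => /eqP /cmod_eq0. Qed.
Let ip_complete (u : nat -> C^o) :
  (forall e : R, 0 < e -> exists N, forall n m, (N <= n)%N -> (N <= m)%N ->
     complex.Re (ip (u n - u m) (u n - u m)) < e) ->
  exists l, forall e : R, 0 < e -> exists N, forall n, (N <= n)%N ->
     complex.Re (ip (u n - l) (u n - l)) < e.
Proof.
move=> hu.
have hu' e : 0 < e -> exists N, forall n m, (N <= n)%N -> (N <= m)%N -> cmod (u n - u m) < e.
  move=> e0; have [N hN] := hu _ (exprn_gt0 2 e0); exists N => n m hn hm.
  have := hN n m hn hm; rewrite ipxx ltr_sqr ?nnegrE ?cmod_ge0//; exact: ltW.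
have [a ha] : exists l, forall e : R, 0 < e -> exists N, forall n, (N <= n)%N ->
    `|complex.Re (u n) - l| < e.
  apply: real_cauchy_cvg => e /hu' [N hN]; exists N => n m hn hm.
  by rewrite -ReB; apply: le_lt_trans (hN n m hn hm); exact: cmod_Re.
have [b hb] : exists l, forall e : R, 0 < e -> exists N, forall n, (N <= n)%N ->
    `|complex.Im (u n) - l| < e.
  apply: real_cauchy_cvg => e /hu' [N hN]; exists N => n m hn hm.
  by rewrite -ImB; apply: le_lt_trans (hN n m hn hm); exact: cmod_Im.
exists (a +i* b) => e e0.
have e1 : 0 < Num.sqrt e / 2 by rewrite divr_gt0 ?sqrtr_gt0.
have [N1 hN1] := ha _ e1; have [N2 hN2] := hb _ e1.
exists (maxn N1 N2) => n; rewrite geq_max => /andP[h1 h2].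
rewrite ipxx -(sqr_sqrtr (ltW e0)) ltr_sqr ?nnegrE ?cmod_ge0 ?sqrtr_ge0//.
apply: (le_lt_trans (cmod_le _)); rewrite [ltRHS]splitr ReB ImB.
by apply: ltrD; [exact: hN1|exact: hN2].
Qed.

Definition ph_scalar := @PreHilbert R C^o ip ipP ipC ip_ge0 ip_eq0 ip_complete.
Definition hscalar : hilbertType R := ph_type ph_scalar.

Lemma inner_hscalar (z w : hscalar) : inner z w = (z : C) * (w : C)^*%C.
Proof. by []. Qed.

Lemma hnorm_hscalar (z : hscalar) : hnorm z = cmod (z : C).
Proof.
apply/eqP; rewrite -(@eqrXn2 _ 2) ?hnorm_ge0 ?cmod_ge0//.
by rewrite -rinner_hnorm /rinner inner_hscalar mulrC Re_mulJ.
Qed.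

End ScalarHilbert.
Arguments hscalar : clear implicits.

Section PowerHilbert.
Context {R : realType} (I : finType) (L : hilbertType R).
Local Notation C := R[i].
Local Notation V := (I -> L).

Let ip (x y : V) : C := \sum_i inner (x i) (y i).
Let ipxx x : complex.Re (ip x x) = \sum_i hnorm (x i) ^+ 2.
Proof. by rewrite /ip Re_sum; apply: eq_bigr => i _; rewrite -rinner_hnorm. Qed.
Let ipP a x y z : ip (a *: x + y) z = a * ip x z + ip y z.
Proof.
rewrite /ip mulr_sumr -big_split; apply: eq_bigr => i _ /=.
by rewrite innerDl innerZl.
Qed.
Let ipC x y : ip x y = (ip y x)^*%C.
Proof. by rewrite /ip rmorph_sum; apply: eq_bigr => i _; rewrite /= -innerC. Qed.
Let ip_ge0 x : 0 <= complex.Re (ip x x).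
Proof. by rewrite ipxx sumr_ge0// => i _; rewrite sqr_ge0. Qed.
Let ip_eq0 x : complex.Re (ip x x) = 0 -> x = 0.
Proof.
rewrite ipxx => /eqP; rewrite psumr_eq0 => [|i _]; last by rewrite sqr_ge0.
move=> /allP h; apply/funext => i.
have := h i; rewrite mem_index_enum /= sqrf_eq0 => /(_ isT) /eqP; exact: hnorm_eq0.
Qed.
Let ip_complete (u : nat -> V) :
  (forall e : R, 0 < e -> exists N, forall n m, (N <= n)%N -> (N <= m)%N ->
     complex.Re (ip (u n - u m) (u n - u m)) < e) ->
  exists l, forall e : R, 0 < e -> exists N, forall n, (N <= n)%N ->
     complex.Re (ip (u n - l) (u n - l)) < e.
Proof.
move=> hu.
have /choice [l hl] : forall i, exists l, cvg_seq (fun n => u n i) l.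
  move=> i; apply: hilbert_complete => e e0.
  have [N hN] := hu _ (exprn_gt0 2 e0); exists N => n m hn hm.
  have := hN n m hn hm; rewrite ipxx (bigD1 i)//= => h.
  rewrite -ltr_sqr ?nnegrE ?hnorm_ge0 ?(ltW e0)//.
  apply: le_lt_trans h; rewrite lerDl sumr_ge0// => j _; exact: sqr_ge0.
exists l => e e0.
pose c := (#|I|%:R + 1 : R).
have c0 : 0 < c by rewrite ltr_wpDl.
have e1 : 0 < Num.sqrt (e / c) by rewrite sqrtr_gt0 divr_gt0.
have [N hN] := @eventually_fin I _ (fun i => hl i _ e1).
exists N => n hn; rewrite ipxx.
apply: (@le_lt_trans _ _ (\sum_(i : I) (e / c))).
  apply: ler_sum => i _; rewrite -[leRHS]sqr_sqrtr; last exact/ltW/divr_gt0.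
  by rewrite ler_sqr ?nnegrE ?hnorm_ge0 ?(ltW e1)// ltW//; exact: (hN n hn i).
rewrite sumr_const cardT -cardE -mulr_natr -mulrA gtr_pMr// mulrC ltr_pdivrMr// mul1r.
by rewrite ltrDl.
Qed.

Definition ph_power := @PreHilbert R V ip ipP ipC ip_ge0 ip_eq0 ip_complete.
Definition hpower : hilbertType R := ph_type ph_power.

Lemma inner_hpower (x y : hpower) : inner x y = \sum_i inner (x i) (y i).
Proof. by []. Qed.

Lemma hnorm_hpower (x : hpower) : hnorm x ^+ 2 = \sum_i hnorm (x i) ^+ 2.
Proof. by rewrite -rinner_hnorm; exact: ipxx. Qed.

Lemma hpower_sumE (J : Type) (r : seq J) (P : pred J) (F : J -> hpower) i :
  (\sum_(j <- r | P j) F j) i = \sum_(j <- r | P j) F j i.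
Proof. by elim/big_rec2: _ => // j x y _ <-. Qed.

End PowerHilbert.

Section SumHilbert.
Context {R : realType} (L1 L2 : hilbertType R).
Local Notation C := R[i].
Local Notation V := (L1 * L2)%type.

Let ip (x y : V) : C := inner x.1 y.1 + inner x.2 y.2.
Let ipxx x : complex.Re (ip x x) = hnorm x.1 ^+ 2 + hnorm x.2 ^+ 2.
Proof. by rewrite /ip ReD -!rinner_hnorm. Qed.
Let ipP a x y z : ip (a *: x + y) z = a * ip x z + ip y z.
Proof. by rewrite /ip /= !innerDl !innerZl mulrDr addrACA. Qed.
Let ipC x y : ip x y = (ip y x)^*%C.
Proof. by rewrite /ip rmorphD /= -!innerC. Qed.
Let ip_ge0 x : 0 <= complex.Re (ip x x).
Proof. by rewrite ipxx addr_ge0 ?sqr_ge0. Qed.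
Let ip_eq0 x : complex.Re (ip x x) = 0 -> x = 0.
Proof.
rewrite ipxx => /eqP; rewrite paddr_eq0 ?sqr_ge0// !sqrf_eq0.
by case: x => a b /= /andP[/eqP/hnorm_eq0 -> /eqP/hnorm_eq0 ->].
Qed.
Let ip_complete (u : nat -> V) :
  (forall e : R, 0 < e -> exists N, forall n m, (N <= n)%N -> (N <= m)%N ->
     complex.Re (ip (u n - u m) (u n - u m)) < e) ->
  exists l, forall e : R, 0 < e -> exists N, forall n, (N <= n)%N ->
     complex.Re (ip (u n - l) (u n - l)) < e.
Proof.
move=> hu.
have [l1 hl1] : exists l, cvg_seq (fun n => (u n).1) l.
  apply: hilbert_complete => e e0.
  have [N hN] := hu _ (exprn_gt0 2 e0); exists N => n m hn hm.
  have := hN n m hn hm; rewrite ipxx => h.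
  rewrite -ltr_sqr ?nnegrE ?hnorm_ge0 ?(ltW e0)//.
  by apply: le_lt_trans h; rewrite lerDl sqr_ge0.
have [l2 hl2] : exists l, cvg_seq (fun n => (u n).2) l.
  apply: hilbert_complete => e e0.
  have [N hN] := hu _ (exprn_gt0 2 e0); exists N => n m hn hm.
  have := hN n m hn hm; rewrite ipxx => h.
  rewrite -ltr_sqr ?nnegrE ?hnorm_ge0 ?(ltW e0)//.
  by apply: le_lt_trans h; rewrite lerDr sqr_ge0.
exists (l1, l2) => e e0.
have e1 : 0 < Num.sqrt (e / 2) by rewrite sqrtr_gt0 divr_gt0.
have [N1 hN1] := hl1 _ e1; have [N2 hN2] := hl2 _ e1.
exists (maxn N1 N2) => n; rewrite geq_max => /andP[h1 h2].
rewrite ipxx [ltRHS]splitr -[e / 2]sqr_sqrtr ?divr_ge0 ?(ltW e0)//.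
by apply: ltrD; rewrite ltr_sqr ?nnegrE ?hnorm_ge0 ?sqrtr_ge0//; [exact: hN1|exact: hN2].
Qed.

Definition ph_sum := @PreHilbert R V ip ipP ipC ip_ge0 ip_eq0 ip_complete.
Definition hsum : hilbertType R := ph_type ph_sum.

Lemma hnorm_hsum (x : hsum) : hnorm x ^+ 2 = hnorm x.1 ^+ 2 + hnorm x.2 ^+ 2.
Proof. by rewrite -rinner_hnorm; exact: ipxx. Qed.

End SumHilbert.

(** * Bounded operators *)

Section LinearMaps.
Context {R : realType} {H K : hilbertType R}.
Local Notation C := R[i].
Implicit Types (S T : H -> K).

Lemma linearfD T : linear T -> forall x y, T (x + y) = T x + T y.
Proof. by move=> h x y; rewrite -[x]scale1r h !scale1r. Qed.

Lemma linearf0 T : linear T -> T 0 = 0.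
Proof. by move=> h; apply: (addrI (T 0)); rewrite -linearfD// !addr0. Qed.

Lemma linearfZ T : linear T -> forall a x, T (a *: x) = a *: T x.
Proof. by move=> h a x; rewrite -[a *: x]addr0 h linearf0// addr0. Qed.

Lemma linearfN T : linear T -> forall x, T (- x) = - T x.
Proof. by move=> h x; rewrite -scaleN1r linearfZ// scaleN1r. Qed.

Lemma linearfB T : linear T -> forall x y, T (x - y) = T x - T y.
Proof. by move=> h x y; rewrite linearfD// linearfN. Qed.

Lemma linearf_sum T : linear T -> forall (I : Type) (r : seq I) (P : pred I) (F : I -> H),
  T (\sum_(i <- r | P i) F i) = \sum_(i <- r | P i) T (F i).
Proof. by move=> h I r P F; rewrite (big_morph T (linearfD h) (linearf0 h)). Qed.

Definition opbound T (M : R) := forall x, hnorm (T x) <= M * hnorm x.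

Lemma bounded_opbound T : bounded_operator T -> exists2 M, 0 <= M & opbound T M.
Proof.
move=> [_ [M hM]]; exists `|M| => // x; apply: le_trans (hM x) _.
by rewrite ler_wpM2r ?hnorm_ge0// ler_norm.
Qed.

Lemma opnorm_bound T : bounded_operator T -> opbound T (opnorm T).
Proof.
move=> bT x; have [lT _] := bT; have [M M0 hM] := bounded_opbound bT.
have [x0|xn0] := eqVneq (hnorm x) 0.
  by rewrite (hnorm_eq0 x0) linearf0// !hnorm0 mulr0.
have hx : 0 < hnorm x by rewrite lt_def xn0 hnorm_ge0.
pose y := ((hnorm x)^-1)%:C *: x.
have hy : hnorm y = 1 by rewrite hnormZ cmod_real ger0_norm ?invr_ge0 ?hnorm_ge0// mulVf.
suff : hnorm (T y) <= opnorm T.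
  rewrite linearfZ// hnormZ cmod_real ger0_norm ?invr_ge0 ?hnorm_ge0//.
  by rewrite ler_pdivrMl// mulrC.
apply: ub_le_sup; last by exists y => //=; rewrite hy.
exists M => _ [z /= hz <-]; apply: le_trans (hM z) _.
by rewrite -[leRHS]mulr1 ler_wpM2l.
Qed.

Lemma opnorm_le T (M : R) : 0 <= M -> opbound T M -> opnorm T <= M.
Proof.
move=> M0 hM; apply: ge_sup.
  by exists (hnorm (T 0)); exists 0 => //=; rewrite hnorm0.
move=> _ [z /= hz <-]; apply: le_trans (hM z) _.
by rewrite -[leRHS]mulr1 ler_wpM2l.
Qed.

Lemma opnorm_ge0 T : bounded_operator T -> 0 <= opnorm T.
Proof.
move=> bT; have [M M0 hM] := bounded_opbound bT.
apply: (le_trans (hnorm_ge0 (T 0))); apply: ub_le_sup; last by exists 0 => //=; rewrite hnorm0.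
exists M => _ [z /= hz <-]; apply: le_trans (hM z) _.
by rewrite -[leRHS]mulr1 ler_wpM2l.
Qed.

Lemma bounded_operatorP (a : C) S T :
  bounded_operator S -> bounded_operator T -> bounded_operator (a *: S + T).
Proof.
move=> bS bT; have [lS _] := bS; have [lT _] := bT.
have [M _ hM] := bounded_opbound bS; have [N _ hN] := bounded_opbound bT.
split.
  move=> b x y; rewrite !fctE lS lT !scalerDr addrACA !scalerA (mulrC a).
  by [].
exists (cmod a * M + N) => x; apply: (le_trans (hnormD (a *: S x) (T x))).
rewrite hnormZ mulrDl lerD// -mulrA ler_wpM2l ?cmod_ge0//.
Qed.

Lemma bounded0 : bounded_operator (0 : H -> K).
Proof.
split; first by move=> a x y; change (0 = a *: (0 : K) + 0); rewrite scaler0 addr0.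
by exists 0 => x; rewrite mul0r; change (hnorm (0 : K) <= 0); rewrite hnorm0.
Qed.

Lemma boundedZ (a : C) S : bounded_operator S -> bounded_operator (a *: S).
Proof. by move=> bS; rewrite -[_ *: _]addr0; apply: bounded_operatorP => //; exact: bounded0. Qed.

Lemma boundedD S T : bounded_operator S -> bounded_operator T -> bounded_operator (S + T).
Proof. by move=> bS bT; rewrite -[S]scale1r; exact: bounded_operatorP. Qed.

Lemma boundedB S T : bounded_operator S -> bounded_operator T -> bounded_operator (T - S).
Proof. by move=> bS bT; rewrite addrC -scaleN1r; exact: bounded_operatorP. Qed.

Lemma bounded_sum (I : Type) (r : seq I) (P : pred I) (F : I -> H -> K) :
  (forall i, P i -> bounded_operator (F i)) ->
  bounded_operator (\sum_(i <- r | P i) F i).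
Proof.
move=> h; elim/big_ind: _ => [|S T|i Pi]; [exact: bounded0|exact: boundedD|exact: h].
Qed.

Lemma fct_sumx (I : Type) (r : seq I) (P : pred I) (F : I -> H -> K) x :
  (\sum_(i <- r | P i) F i) x = \sum_(i <- r | P i) F i x.
Proof. by elim/big_rec2: _ => // i y g _ <-. Qed.

End LinearMaps.

Section BoundedAlgebra.
Context {R : realType}.
Implicit Types (H K L : hilbertType R).

Lemma bounded_comp H K L (S : K -> L) (T : H -> K) :
  bounded_operator S -> bounded_operator T -> bounded_operator (S \o T).
Proof.
move=> bS bT; have [lS _] := bS; have [lT _] := bT.
have [M M0 hM] := bounded_opbound bS; have [N _ hN] := bounded_opbound bT.
split; first by move=> a x y /=; rewrite lT lS.
exists (M * N) => x /=; apply: le_trans (hM _) _.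
by rewrite -mulrA ler_wpM2l.
Qed.

Lemma bounded_id H : bounded_operator (@id H).
Proof. by split=> //; exists 1 => x; rewrite mul1r. Qed.

End BoundedAlgebra.

(** * Riesz representation and adjoints *)

Section Riesz.
Context {R : realType} {H : hilbertType R}.
Local Notation C := R[i].

Lemma hnorm_le_hpower (I : finType) (x : hpower I H) i : hnorm (x i) <= hnorm x.
Proof.
rewrite -ler_sqr ?nnegrE ?hnorm_ge0// hnorm_hpower (bigD1 i)//= lerDl.
by rewrite sumr_ge0// => j _; rewrite sqr_ge0.
Qed.

Lemma hnorm_hpower_le (I : finType) (x : hpower I H) : hnorm x <= \sum_i hnorm (x i).
Proof.
rewrite -ler_sqr ?nnegrE ?hnorm_ge0 ?sumr_ge0//; last by move=> i _; exact: hnorm_ge0.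
rewrite hnorm_hpower expr2 mulr_suml; apply: ler_sum => i _.
rewrite expr2 ler_wpM2l ?hnorm_ge0// (bigD1 i)//= lerDl sumr_ge0// => j _; exact: hnorm_ge0.
Qed.

(** The representing vector is the minimiser of g(x) = |x|^2 - 2 Re f(x): minimising sequences are
    Cauchy by the parallelogram law, and the vanishing first variation at the limit is the required
    identity. No orthogonal complement of the kernel is needed. *)
Lemma Riesz (f : H -> C) (M : R) :
  (forall a x y, f (a *: x + y) = a * f x + f y) ->
  (forall x, cmod (f x) <= M * hnorm x) ->
  exists z, forall x, f x = inner x z.
Proof.
move=> flin fM.
have fD x y : f (x + y) = f x + f y by rewrite -[x]scale1r flin !scale1r mul1r.
have f0 : f 0 = 0 by apply: (addrI (f 0)); rewrite -fD !addr0.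
have fZ a x : f (a *: x) = a * f x by rewrite -[_ *: _]addr0 flin f0 addr0.
pose g x := hnorm x ^+ 2 - 2 * complex.Re (f x).
pose E := [set g x | x in [set: H]].
have Einf : has_inf E.
  split; first by exists (g 0); exists 0.
  exists (- M ^+ 2) => _ [x _ <-]; rewrite /g.
  have h1 : complex.Re (f x) <= M * hnorm x.
    exact: le_trans (le_trans (ler_norm _) (cmod_Re _)) (fM x).
  have h2 : 0 <= (hnorm x - M) ^+ 2 by exact: sqr_ge0.
  set p := complex.Re _ in h1 *; set n := hnorm x in h1 h2 *.
  nra.
pose m := inf E.
have gm x : m <= g x by apply: inf_lbound; [case: Einf|exists x].
have /choice [u hu] : forall n : nat, exists x, g x < m + n.+1%:R^-1.
  move=> n; have /(_ n.+1%:R^-1) [|_ [x _ <-] hx] := inf_adherent _ Einf.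
    by rewrite invr_gt0.
  by exists x.
(* Parallelogram law, with m <= g at the midpoint of x and y. *)
have par x y : hnorm (x - y) ^+ 2 <= 2 * (g x - m) + 2 * (g y - m).
  have := gm ((2^-1 : R)%:C *: (x + y)).
  rewrite /g hnormZ fZ Re_realM fD ReD cmod_real ger0_norm ?invr_ge0// exprMn.
  rewrite hnorm_sqrB hnorm_sqrD.
  set p := complex.Re _; set q := complex.Re _; set s := rinner _ _.
  move=> h; lra.
have [z hz] : exists z, cvg_seq u z.
  apply: hilbert_complete => e e0.
  have e4 : 0 < e ^+ 2 / 4 by rewrite divr_gt0 ?exprn_gt0.
  have [N hN] := invSn_small e4.
  exists N => n k hn hk.
  rewrite -ltr_sqr ?nnegrE ?hnorm_ge0 ?(ltW e0)//.
  apply: le_lt_trans (par _ _) _.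
  have h1 := hN n hn; have h2 := hN k hk; have h3 := hu n; have h4 := hu k.
  move: h1 h2 h3 h4 e4; clear; clearbody m g.
  set a := n.+1%:R^-1; set b := k.+1%:R^-1; set p := g _; set q := g _. move=> *; lra.
exists z.
have key w : rinner z w = complex.Re (f w).
  pose d := rinner z w - complex.Re (f w).
  (* The expression is g(z + t w) - g(z). The inequality is obtained along the minimising sequence
     u, so no continuity of g is used. *)
  have hd (t : R) : 0 <= 2 * t * d + t ^+ 2 * hnorm w ^+ 2.
    rewrite leNgt; apply/negP => hneg.
    pose e := - (2 * t * d + t ^+ 2 * hnorm w ^+ 2).
    have e0 : 0 < e by rewrite /e; lra.
    have D0 : 0 < `|2 * t| * hnorm w + 1 by rewrite ltr_wpDl ?mulr_ge0 ?hnorm_ge0.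
    have e2 : 0 < e / 2 by rewrite divr_gt0.
    have [N1 hN1] := invSn_small e2.
    have [N2 hN2] := hz _ (divr_gt0 e2 D0).
    pose n := maxn N1 N2.
    have h1 := hN1 n (leq_maxl _ _); have h2 := hN2 n (leq_maxr _ _).
    have := gm (u n + t%:C *: w); have := hu n.
    rewrite /g hnorm_sqrD rinnerZr hnormZ fD ReD fZ Re_realM cmod_real exprMn.
    rewrite real_normK ?num_real//.
    have -> : rinner (u n) w = rinner z w + rinner (u n - z) w.
      by rewrite -rinnerDl addrC subrK.
    have h3 : 2 * t * rinner (u n - z) w <= e / 2.
      apply: (le_trans (ler_norm _)); rewrite normrM.
      apply: (@le_trans _ _ (`|2 * t| * (hnorm (u n - z) * hnorm w))).
        by rewrite ler_wpM2l// rinner_CSN.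
      move: h2; rewrite ltr_pdivlMr// => h2; apply: (le_trans _ (ltW h2)).
      by rewrite mulrCA ler_wpM2l ?hnorm_ge0// lerDl.
    rewrite /e /d in h1 h3 *; move=> h4 h5.
    move: h1 h3 h4 h5; clear; clearbody m; set q := n.+1%:R^-1 => *; lra.
  suff : d = 0 by move=> /eqP; rewrite subr_eq0 => /eqP.
  have [W0|Wn0] := eqVneq (hnorm w ^+ 2) 0.
    have := hd (- d); rewrite W0 mulr0 addr0; clear; clearbody d => h; nra.
  have W0 : 0 < hnorm w ^+ 2 by rewrite lt_def Wn0 sqr_ge0.
  (* The minimiser in t of the quadratic 2 t d + t^2 |w|^2, where its value is - d^2 / |w|^2. *)
  have := hd (- d / hnorm w ^+ 2).
  have -> : 2 * (- d / hnorm w ^+ 2) * d + (- d / hnorm w ^+ 2) ^+ 2 * hnorm w ^+ 2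
    = - (d ^+ 2 / hnorm w ^+ 2).
    by move: Wn0; clear; rewrite sqrf_eq0; clearbody d; set q := hnorm w => Wn0; field.
  rewrite oppr_ge0 pmulr_lle0 ?invr_gt0// => h.
  by apply/eqP; rewrite -sqrf_eq0 eq_le h sqr_ge0.
(* From real parts to the full identity: rescaling x by the conjugate of the difference v turns its
   real part into |v|^2. *)
move=> x; apply/eqP; rewrite -subr_eq0; apply/eqP/cmod_eq0/eqP.
set v := _ - _; rewrite -sqrf_eq0 -Re_mulJ /v mulrBr ReB.
set a := _^*%C; rewrite -fZ -innerZl -key rinnerC.
by rewrite /rinner subrr.
Qed.

Lemma adjoint_exists (T : H -> H) : bounded_operator T ->
  exists2 S, bounded_operator S & adjoint_of T S.
Proof.
move=> bT; have [lT _] := bT; have [M M0 hM] := bounded_opbound bT.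
have /choice [S hS] : forall y, exists z, forall x, inner (T x) y = inner x z.
  move=> y; apply: (@Riesz _ (M * hnorm y)).
    by move=> a u v; rewrite lT innerDl innerZl.
  move=> x; apply: (le_trans (inner_CS _ _)).
  by rewrite mulrAC ler_wpM2r ?hnorm_ge0.
exists S; last by move=> x y; exact: hS.
split.
  move=> a x y; apply: inner_eq => z.
  rewrite innerC -hS innerDl innerZl.
  rewrite innerDr innerZr rmorphD rmorphM /= conjcK.
  by rewrite (innerC (S x)) (innerC (S y)) -!hS.
exists M => y.
have [S0|Sn0] := eqVneq (hnorm (S y)) 0.
  by rewrite S0 mulr_ge0 ?hnorm_ge0.
have Sp : 0 < hnorm (S y) by rewrite lt_def Sn0 hnorm_ge0.
rewrite -(ler_pM2l Sp) -expr2 -rinner_hnorm /rinner -hS.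
apply: (le_trans (rinner_CS _ _)); rewrite mulrA ler_wpM2r ?hnorm_ge0//.
by rewrite mulrC.
Qed.

End Riesz.

(** * Norm limits of operators *)

Section OperatorLimits.
Context {R : realType}.
Local Notation C := R[i].

Lemma eq_hnorm_small (H : hilbertType R) (x y : H) (c : R) :
  0 <= c -> (forall e, 0 < e -> hnorm (x - y) <= e * c) -> x = y.
Proof.
move=> c0 h; apply/eqP; rewrite -subr_eq0; apply/eqP/hnorm_eq0/eqP.
rewrite eq_le hnorm_ge0 andbT; apply/ler_addgt0Pr => e e0; rewrite add0r.
have c1 : 0 < c + 1 by rewrite ltr_wpDl.
apply: le_trans (h _ (divr_gt0 e0 c1)) _.
by rewrite mulrAC ler_pdivrMr// ler_wpM2l ?(ltW e0)// lerDl.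
Qed.

(** Operator norm convergence, stated on vectors so that it makes sense before the limit is known to
    be linear or bounded. *)
Definition opcvg (H K : hilbertType R) (Y : nat -> H -> K) (Z : H -> K) :=
  forall e : R, 0 < e -> exists N, forall n, (N <= n)%N ->
    forall x, hnorm (Y n x - Z x) <= e * hnorm x.

Lemma opcvg_exists (H K : hilbertType R) (Y : nat -> H -> K) :
  (forall n, bounded_operator (Y n)) ->
  (forall e : R, 0 < e -> exists N, forall n m, (N <= n)%N -> (N <= m)%N ->
     forall x, hnorm (Y n x - Y m x) <= e * hnorm x) ->
  exists2 Z, bounded_operator Z & opcvg Y Z.
Proof.
move=> bY cY.
have /choice [Z hZ] : forall x, exists l, cvg_seq (fun n => Y n x) l.
  move=> x; apply: hilbert_complete => e e0.
  have x1 : 0 < hnorm x + 1 by rewrite ltr_wpDl ?hnorm_ge0.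
  have [N hN] := cY _ (divr_gt0 e0 x1); exists N => n m hn hm.
  apply: le_lt_trans (hN n m hn hm x) _.
  by rewrite mulrAC ltr_pdivrMr// ltr_pM2l// ltrDl.
have cZ : opcvg Y Z.
  move=> e e0; have [N hN] := cY _ e0; exists N => n hn x.
  apply/ler_addgt0Pr => d d0.
  have [N2 hN2] := hZ x _ d0.
  pose m := maxn N N2.
  apply: le_trans (hnorm_triB _ (Y m x) _) _; apply: lerD.
    exact: hN (leq_maxl _ _) _.
  by apply: ltW; apply: hN2; exact: leq_maxr.
exists Z => //; have lY n := (bY n).1.
split.
  move=> a x y; pose c := hnorm (a *: x + y) + (cmod a * hnorm x + hnorm y).
  have c0 : 0 <= c by rewrite /c !addr_ge0 ?mulr_ge0 ?hnorm_ge0 ?cmod_ge0.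
  apply: (@eq_hnorm_small _ _ _ _ c0) => e e0.
  have [N hN] := cZ _ e0; have {}hN := hN N (leqnn _).
  apply: le_trans (hnorm_triB _ (Y N (a *: x + y)) _) _; rewrite /c mulrDr; apply: lerD.
    by rewrite hnormBC.
  rewrite (lY N) opprD addrACA -scalerBr; apply: le_trans (hnormD _ _) _.
  rewrite mulrDr hnormZ; apply: lerD => //.
  by rewrite mulrCA ler_wpM2l ?cmod_ge0.
have [N hN] := cZ _ ltr01; have [M M0 hM] := bounded_opbound (bY N).
exists (1 + M) => x; rewrite -[Z x](subrK (Y N x)); apply: le_trans (hnormD _ _) _.
by rewrite hnormBC mulrDl lerD//; exact: hN.
Qed.

(** Bernoulli's inequality with the division cleared; it gives the decay of r^n at rate 1/n. *)
Lemma expr_bernoulli (r : R) n : 0 <= r <= 1 -> r ^+ n * (1 + n%:R * (1 - r)) <= 1.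
Proof.
move=> /andP[r0 r1]; elim: n => [|n IH]; first by rewrite expr0 mul0r addr0 mulr1.
have h : r ^+ n.+1 <= 1 by rewrite exprn_ile1.
rewrite -natr1 mulrDl mul1r addrA mulrDr exprS -mulrA.
rewrite exprS in h.
have h2 := ler_wpM2l r0 IH.
have h3 : r * r ^+ n * (1 - r) <= 1 * (1 - r) by rewrite ler_wpM2r// subr_ge0.
move: h2 h3; set a := r * _; set b := _ * (1 - r) => h2 h3; lra.
Qed.

Lemma expr_small (r c e : R) : 0 <= r < 1 -> 0 < e -> 0 <= c ->
  exists N, forall n, (N <= n)%N -> c * r ^+ n <= e.
Proof.
move=> /andP[r0 r1] e0 c0.
have d0 : 0 < 1 - r by rewrite subr_gt0.
have c1 : 0 < c + 1 by rewrite ltr_wpDl.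
(* Beyond this threshold c + 1 <= e n (1 - r), and Bernoulli bounds n (1 - r) r^n by 1. *)
have q0 : 0 < e * (1 - r) / (c + 1) by rewrite divr_gt0// mulr_gt0.
have [N hN] := invSn_small q0; exists N.+1 => -[//|n] hn.
have := hN n hn; rewrite ltr_pdivlMr// mulrC ltr_pdivrMr ?ltr0Sn// => h1.
have := @expr_bernoulli r n.+1; rewrite r0 ltW// => /(_ isT) h2.
have h3 : 0 <= r ^+ n.+1 by rewrite exprn_ge0.
move: h1 h2 h3; rewrite -mulrA [(1 - r) * _]mulrC.
set x := r ^+ _; set y := _.+1%:R * _ => h1 h2 h3.
have y0 : 0 <= y by rewrite mulr_ge0// ltW.
have h4 : (c + 1) * x <= e * y * x by rewrite ler_wpM2r// ltW.
nra.
Qed.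

Lemma geometric_opcvg (H K : hilbertType R) (Y : nat -> H -> K) (c r : R) :
  0 <= r < 1 -> 0 <= c -> (forall n, bounded_operator (Y n)) ->
  (forall n x, hnorm (Y n.+1 x - Y n x) <= c * r ^+ n * hnorm x) ->
  exists2 Z, bounded_operator Z & opcvg Y Z.
Proof.
move=> r01 c0 bY hY; have /andP[r0 r1] := r01.
have d0 : 0 < 1 - r by rewrite subr_gt0.
(* The closed form of the partial geometric sum is what the induction on k preserves. *)
have hk n k x : hnorm (Y (n + k)%N x - Y n x) <= c * r ^+ n * (1 - r ^+ k) / (1 - r) * hnorm x.
  elim: k => [|k IH]; first by rewrite addn0 subrr hnorm0 expr0 subrr mulr0 !mul0r.
  rewrite addnS; apply: le_trans (hnorm_triB _ (Y (n + k)%N x) _) _.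
  apply: le_trans (lerD (hY _ _) IH) _; rewrite -mulrDl ler_wpM2r ?hnorm_ge0//.
  rewrite exprD exprS le_eqVlt; apply/orP; left; apply/eqP.
  by have : 1 - r != 0 by [rewrite gt_eqF]; clear => h; field.
apply: opcvg_exists => // e e0.
have [N hN] := @expr_small r (c / (1 - r)) (e / 2) r01 (divr_gt0 e0 (ltr0Sn R 1)) (divr_ge0 c0 (ltW d0)).
exists N => n m hn hm x.
have hN2 k : (N <= k)%N -> hnorm (Y k x - Y N x) <= e / 2 * hnorm x.
  move=> hk'; rewrite -(subnKC hk'); apply: le_trans (hk _ _ _) _.
  rewrite ler_wpM2r ?hnorm_ge0//; apply: le_trans (hN N (leqnn _)).
  rewrite [leRHS]mulrAC ler_pM2r ?invr_gt0//.
  by rewrite ler_piMr ?mulr_ge0 ?exprn_ge0// lerBlDr lerDl exprn_ge0.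
apply: le_trans (hnorm_triB _ (Y N x) _) _.
by rewrite [e]splitr mulrDl lerD ?hN2// hnormBC hN2.
Qed.

End OperatorLimits.

(** * Square roots of positive operators and their inverses *)

Section SquareRoot.
Context {R : realType} {H : hilbertType R}.
Local Notation C := R[i].
Implicit Types (X Y P : H -> H).

Lemma opcvg_opbound (Y : nat -> H -> H) Z (a : R) :
  opcvg Y Z -> (forall n, opbound (Y n) a) -> opbound Z a.
Proof.
move=> hY ha x; apply/ler_addgt0Pr => e e0.
have x1 : 0 < hnorm x + 1 by rewrite ltr_wpDl ?hnorm_ge0.
have [N hN] := hY _ (divr_gt0 e0 x1).
rewrite -[Z x](subrK (Y N x)) [leRHS]addrC; apply: le_trans (hnormD _ _) _.
apply: lerD => //; last exact: ha.
rewrite hnormBC; apply: le_trans (hN _ (leqnn _) _) _.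
by rewrite mulrAC ler_pdivrMr// ler_pM2l// lerDl.
Qed.

Lemma opcvg_selfadjoint (Y : nat -> H -> H) Z :
  opcvg Y Z -> (forall n, adjoint_of (Y n) (Y n)) -> adjoint_of Z Z.
Proof.
move=> hY ha x y; apply/eqP; rewrite -subr_eq0; apply/eqP/cmod_eq0/eqP.
rewrite eq_le cmod_ge0 andbT; apply/ler_addgt0Pr => e e0; rewrite add0r.
have c0 : 0 < 2 * (hnorm x * hnorm y) + 1 by rewrite ltr_wpDl// !mulr_ge0 ?hnorm_ge0.
have [N hN] := hY _ (divr_gt0 e0 c0); have {}hN := hN N (leqnn _).
have -> : inner (Z x) y - inner x (Z y) = inner (Z x - Y N x) y + inner x (Y N y - Z y).
  have haN := ha N x y; rewrite innerBl innerBr haN.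
  by ring.
apply: le_trans (cmodD _ _) _.
apply: le_trans (lerD (inner_CS _ _) (inner_CS _ _)) _.
apply: (@le_trans _ _ (e / (2 * (hnorm x * hnorm y) + 1) * (2 * (hnorm x * hnorm y)))).
  set k := e / _ in hN *; rewrite mulr_natl mulr2n mulrDr; apply: lerD.
    by rewrite mulrA ler_wpM2r ?hnorm_ge0// hnormBC; exact: hN.
  by rewrite mulrCA ler_wpM2l ?hnorm_ge0//; exact: hN.
by rewrite mulrAC ler_pdivrMr// ler_pM2l// lerDl.
Qed.

(** Positivity of X at the vector r x - X x, combined with the upper bound at x and at X x, gives r
    |X x|^2 <= r^3 |x|^2. *)
Lemma positive_opbound X (r : R) : bounded_operator X -> adjoint_of X X -> 0 < r ->
  (forall x, 0 <= rinner (X x) x) -> (forall x, rinner (X x) x <= r * hnorm x ^+ 2) ->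
  opbound X r.
Proof.
move=> bX sX r0 X0 Xr x; have lX := bX.1.
rewrite -ler_sqr ?nnegrE ?mulr_ge0 ?hnorm_ge0 ?(ltW r0)//.
have := X0 (r%:C *: x - X x).
rewrite linearfB// linearfZ// !rinnerDl !rinnerDr !rinnerNl !rinnerNr !rinnerZl !rinnerZr.
have -> : rinner (X (X x)) x = hnorm (X x) ^+ 2 by rewrite -rinner_hnorm /rinner sX.
rewrite rinner_hnorm exprMn.
have h1 := Xr x; have h2 := Xr (X x).
move: h1 h2; set a := rinner (X x) x; set b := rinner _ _; set n := hnorm x ^+ 2.
set q := hnorm (X x) ^+ 2 => h1 h2 h3.
have h4 : r * r * a <= r * r * (r * n) by rewrite ler_wpM2l// mulr_ge0// ltW.
have h5 : r * q <= r * (r ^+ 2 * n) by lra.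
by move: h5; rewrite ler_pM2l.
Qed.

(** N is the Neumann series of Y; the two equations say that it is a right and a left inverse of 1 -
    Y. *)
Lemma neumann Y (r : R) : bounded_operator Y -> 0 <= r < 1 -> opbound Y r ->
  exists N, [/\ bounded_operator N, (forall x, N x = x + Y (N x)) & forall x, N x = x + N (Y x)].
Proof.
move=> bY r01 hY; have lY := bY.1; have /andP[r0 r1] := r01.
pose S := fix S n : H -> H := if n is m.+1 then fun x => x + Y (S m x) else 0.
have bS n : bounded_operator (S n).
  elim: n => [|n IH]; first exact: bounded0.
  exact: (boundedD (@bounded_id _ _) (bounded_comp bY IH)).
have S0 x : S 0%N x = 0 by [].
have SS n x : S n.+1 x = x + Y (S n x) by [].
have SY n x : S n (Y x) = Y (S n x).
  elim: n x => [|n IH] x; first by rewrite !S0 linearf0.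
  by rewrite !SS linearfD// IH.
have dS n x : hnorm (S n.+1 x - S n x) <= 1 * r ^+ n * hnorm x.
  elim: n => [|n IH]; first by rewrite SS S0 linearf0// subr0 addr0 expr0 !mul1r.
  have -> : S n.+2 x - S n.+1 x = Y (S n.+1 x - S n x).
    by rewrite linearfB// !SS opprD addrACA subrr add0r.
  apply: le_trans (hY _) _; rewrite exprS !mul1r -mulrA ler_wpM2l//.
  by move: IH; rewrite mul1r.
have [N bN cN] := geometric_opcvg r01 ler01 bS dS.
exists N; split=> // x.
  apply: (@eq_hnorm_small _ _ _ _ (hnorm x + r * hnorm x)).
    by rewrite addr_ge0 ?mulr_ge0 ?hnorm_ge0.
  move=> e e0; have [k hk] := cN _ e0.
  apply: le_trans (hnorm_triB _ (S k.+1 x) _) _; rewrite mulrDr; apply: lerD.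
    by rewrite hnormBC; apply: hk.
  rewrite SS opprD addrACA subrr add0r -linearfB//; apply: le_trans (hY _) _.
  by rewrite mulrCA ler_wpM2l//; apply: hk.
apply: (@eq_hnorm_small _ _ _ _ (hnorm x + hnorm (Y x))).
  by rewrite addr_ge0 ?hnorm_ge0.
move=> e e0; have [k hk] := cN _ e0.
apply: le_trans (hnorm_triB _ (S k.+1 x) _) _; rewrite mulrDr; apply: lerD.
  by rewrite hnormBC; apply: hk.
by rewrite SS opprD addrACA subrr add0r -SY; apply: hk.
Qed.

(* [1 - Y] is the square root of [1 - X]; Y is the limit of the iteration
   y |-> (X + y^2) / 2 started at 0. *)
Lemma sqrt_one_sub X (r : R) : bounded_operator X -> adjoint_of X X -> 0 <= r < 1 ->
  opbound X r -> exists Y, [/\ bounded_operator Y, adjoint_of Y Y, opbound Y r &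
    forall x, Y x *+ 2 = X x + Y (Y x)].
Proof.
move=> bX sX r01 hX; have lX := bX.1; have /andP[r0 r1] := r01.
pose h := (2^-1 : R)%:C.
have hh (x : H) : h *: x + h *: x = x.
  by rewrite -scalerDl /h -rmorphD (_ : 2^-1 + 2^-1 = 1 :> R) ?scale1r//; lra.
have ch : cmod h = 2^-1 by rewrite cmod_real ger0_norm ?invr_ge0.
pose S := fix S n : H -> H := if n is m.+1 then fun x => h *: (X x + S m (S m x)) else 0.
have bS n : bounded_operator (S n).
  elim: n => [|n IH]; first exact: bounded0.
  exact: (boundedZ h (boundedD bX (bounded_comp IH IH))).
have S0 x : S 0%N x = 0 by [].
have SS n x : S n.+1 x = h *: (X x + S n (S n x)) by [].
have sS n : adjoint_of (S n) (S n).
  elim: n => [|n IH] x y; first by rewrite !S0 inner0l inner0r.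
  by rewrite !SS innerZl innerZr /h conjc_real innerDl innerDr sX !IH.
have hS n : opbound (S n) r.
  elim: n => [|n IH] x; first by rewrite S0 hnorm0 mulr_ge0 ?hnorm_ge0.
  rewrite SS hnormZ ch ler_pdivrMl//; apply: le_trans (hnormD _ _) _.
  rewrite mulr_natl mulr2n; apply: lerD => //; apply: le_trans (IH _) _.
  by rewrite ler_wpM2l//; apply: le_trans (IH _) _; rewrite ler_piMl ?hnorm_ge0// ltW.
have dS n x : hnorm (S n.+1 x - S n x) <= r * r ^+ n * hnorm x.
  elim: n x => [|n IH] x; first by rewrite S0 subr0 expr0 mulr1; exact: hS.
  (* The difference of squares a^2 - b^2 = a (a - b) + (a - b) b needs no commutation. Since the
     iterates stay in the ball of radius r, the increments shrink by the factor r. *)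
  have -> : S n.+2 x - S n.+1 x =
      h *: (S n.+1 (S n.+1 x - S n x) + (S n.+1 (S n x) - S n (S n x))).
    rewrite (SS n.+1 x) [X in _ - X = _]SS -scalerBr opprD addrACA subrr add0r; congr (_ *: _).
    by rewrite (linearfB (bS n.+1).1) [RHS]addrA subrK.
  rewrite hnormZ ch ler_pdivrMl//; apply: le_trans (hnormD _ _) _.
  rewrite mulr_natl mulr2n; apply: lerD.
    by apply: le_trans (hS _ _) _; rewrite -mulrA ler_wpM2l// exprS; exact: IH.
  apply: le_trans (IH _) _; rewrite exprS [leRHS](_ : _ = r * r ^+ n * (r * hnorm x)); last by ring.
  by rewrite ler_wpM2l ?mulr_ge0 ?exprn_ge0//; exact: hS.
have [Y bY cY] := geometric_opcvg r01 r0 bS dS.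
have hY := opcvg_opbound cY hS.
exists Y; split=> //; first exact: opcvg_selfadjoint cY sS.
move=> x.
apply: (@eq_hnorm_small _ _ _ _ (hnorm x *+ 2 + (r * hnorm x + hnorm (Y x)))).
  by rewrite !addr_ge0 ?mulr_ge0 ?mulrn_wge0 ?hnorm_ge0.
move=> e e0; have [k hk] := cY _ e0.
apply: le_trans (hnorm_triB _ (S k.+1 x *+ 2) _) _; rewrite mulrDr; apply: lerD.
  rewrite -mulrnBl mulr2n; apply: le_trans (hnormD _ _) _; rewrite mulr2n mulrDr.
  by apply: lerD; rewrite hnormBC; apply: hk.
rewrite SS mulr2n hh opprD addrACA subrr add0r.
apply: le_trans (hnorm_triB _ (S k (Y x)) _) _; rewrite mulrDr; apply: lerD.
  rewrite -(linearfB (bS k).1); apply: le_trans (hS _ _) _.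
  by rewrite mulrCA ler_wpM2l//; apply: hk.
by apply: hk.
Qed.

(** With M bounding P, write P = M (1 - X) and let 1 - Y be the root of 1 - X. Then T = sqrt(M) (1 -
    Y) is P^(1/2), and S = P^(-1/2) comes from the Neumann series of Y. *)
Lemma inverse_sqrt P (c : R) : bounded_operator P -> adjoint_of P P -> 0 < c ->
  (forall x, c * hnorm x ^+ 2 <= rinner (P x) x) ->
  exists S T, [/\ bounded_operator S, bounded_operator T, adjoint_of S S &
    [/\ S \o T = id, T \o S = id & forall x, T (T x) = P x]].
Proof.
move=> bP sP c0 Pc; have [M0 M00 hM0] := bounded_opbound bP.
have lP := bP.1.
pose M := M0 + c; have Mp : 0 < M by rewrite ltr_wpDl.
pose X : H -> H := id - (M^-1)%:C *: P.
have XE x : X x = x - (M^-1)%:C *: P x by [].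
(* The lower bound on P gives X <= 1 - c / M; half of that gain is given up so that r stays positive
   even when M = c. *)
pose r := 1 - c / (2 * M).
have q0 : 0 < c / (2 * M) by rewrite divr_gt0 ?mulr_gt0.
have q1 : c / (2 * M) < 1.
  by rewrite ltr_pdivrMr ?mulr_gt0// mul1r /M; lra.
have r0 : 0 < r by rewrite /r; lra.
have r1 : r < 1 by rewrite /r; lra.
have r01 : 0 <= r < 1 by rewrite (ltW r0).
have bX : bounded_operator X by apply: boundedB (boundedZ _ bP) (@bounded_id _ _).
have sX : adjoint_of X X.
  by move=> x y; rewrite !XE innerBl innerBr innerZl innerZr conjc_real sP.
have hX : opbound X r.
  have XX x : rinner (X x) x = hnorm x ^+ 2 - M^-1 * rinner (P x) x.
    by rewrite XE rinnerDl rinnerNl rinnerZl rinner_hnorm.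
  apply: positive_opbound => // x; rewrite XX.
    rewrite subr_ge0 ler_pdivrMl//; apply: le_trans (rinner_CS _ _) _.
    rewrite expr2 mulrA ler_wpM2r ?hnorm_ge0//; apply: le_trans (hM0 _) _.
    by rewrite ler_wpM2r ?hnorm_ge0// /M lerDl ltW.
  rewrite /r mulrBl mul1r lerD2l lerN2.
  apply: (@le_trans _ _ (M^-1 * (c * hnorm x ^+ 2))); last by rewrite ler_pM2l ?invr_gt0//; exact: Pc.
  set n := hnorm x ^+ 2.
  have n0 : 0 <= M^-1 * (c * n) by apply: mulr_ge0; [rewrite invr_ge0 ltW|apply: mulr_ge0; [exact: ltW|exact: sqr_ge0]].
  have -> : c / (2 * M) * n = (M^-1 * (c * n)) / 2.
    by have := lt0r_neq0 Mp; clearbody M n; clear => h; field.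
  by move: n0; set k := M^-1 * _ => *; lra.
have [Y [bY sY hY Y2]] := sqrt_one_sub bX sX r01 hX.
have [N [bN N1 N2]] := neumann bY r01 hY.
have lY := bY.1; have lN := bN.1.
pose m := Num.sqrt M; have m0 : 0 < m by rewrite sqrtr_gt0.
pose T : H -> H := m%:C *: (id - Y); pose S : H -> H := (m^-1)%:C *: N.
have TE x : T x = m%:C *: (x - Y x) by [].
have SE x : S x = (m^-1)%:C *: N x by [].
have mm (x : H) : m%:C *: ((m^-1)%:C *: x) = x.
  by rewrite scalerA -rmorphM mulfV ?gt_eqF// scale1r.
have mm' (x : H) : (m^-1)%:C *: (m%:C *: x) = x.
  by rewrite scalerA -rmorphM mulVf ?gt_eqF// scale1r.
have bT : bounded_operator T := boundedZ _ (boundedB bY (@bounded_id _ _)).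
have bS : bounded_operator S := boundedZ _ bN.
have sT : adjoint_of T T.
  by move=> x y; rewrite !TE innerZl innerZr conjc_real innerBl innerBr sY.
have ST x : S (T x) = x.
  by rewrite SE TE linearfZ// mm' linearfB// {1}(N2 x) addrK.
have TS x : T (S x) = x.
  by rewrite TE SE (linearfZ lY) -scalerBr mm {1}(N1 x) addrK.
exists S, T; split=> //.
  move=> x y; rewrite -{1}(TS y) -sT TS; by [].
split; [exact/funext|exact/funext|].
move=> x; rewrite !TE (linearfZ lY) -scalerBr scalerA -rmorphM -expr2 sqr_sqrtr ?(ltW Mp)//.
have -> : x - Y x - Y (x - Y x) = x - (Y x *+ 2 - Y (Y x)).
  by rewrite linearfB// mulr2n !opprD !opprK !addrA.
rewrite Y2 addrK XE opprB addrC subrK scalerA -rmorphM mulfV ?gt_eqF//.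
by rewrite scale1r.
Qed.

End SquareRoot.

(** * Operator matrices and approximate completely positive extensions *)

Section ConeApproximation.
Context {R : realType} {Q : hilbertType R}.

(* Near-minimizers of the distance to a cone nearly satisfy the variational
   inequalities of a nearest point, so no compactness is needed. *)
Lemma cone_approx (X : Type) (mu : X -> Q) (w : X -> R) (B : R) (K : set Q) (m0 : Q) (w0 : R) :
  K 0 ->
  (forall z (t : R) x, K z -> 0 <= t -> K (z + t%:C *: mu x)) ->
  (forall z (t : R), K z -> 0 <= t -> K (t%:C *: z)) ->
  0 <= B -> (forall x, 0 <= w x) -> 0 <= w0 -> (forall x, hnorm (mu x) <= B * w x) ->
  (forall D (g : R), 0 <= g -> (forall x, 0 <= rinner (mu x) D + g * w x) ->
     0 <= rinner m0 D + g * w0) ->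
  forall e : R, 0 < e -> exists2 z, K z & hnorm (z - m0) < e.
Proof.
move=> K0 Kadd Kscale B0 w_ge0 w0_ge0 muB dual.
pose E := [set hnorm (z - m0) ^+ 2 | z in K].
have Einf : has_inf E.
  split; first by exists (hnorm (0 - m0) ^+ 2); exists 0.
  by exists 0 => _ [z _ <-]; rewrite sqr_ge0.
pose d := inf E.
have dE z : K z -> d <= hnorm (z - m0) ^+ 2.
  by move=> Kz; apply: inf_lbound; [case: Einf|exists z].
have d0 : 0 <= d.
  by apply: lb_le_inf; [case: Einf|move=> _ [z _ <-]; rewrite sqr_ge0].
pose B1 := B + 1; have B1p : 0 < B1 by rewrite ltr_wpDl.
(* Collects the two errors below: the variation along z, with |z| <= |m0| + 2 + d, and the slack B1
   w0 at m0. *)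
pose c := (1 + (hnorm m0 + (2 + d)) ^+ 2) / 2 + B1 * w0.
(* Take z whose squared distance is within n^2 of the infimum and put D = z - m0. Moving z along the
   generators makes D almost nonnegative on the cone, hence on m0 by duality; shrinking z makes <z,
   D> almost nonpositive. As |D|^2 = <z, D> - <m0, D>, the distance is O(n). *)
have key (n : R) : 0 < n -> n <= 1 -> d <= n * c.
  move=> n0 n1.
  have [_ [z Kz <-] hz] := inf_adherent (exprn_gt0 2 n0) Einf.
  rewrite -/d in hz.
  pose D := z - m0.
  have h1 x : 0 <= rinner (mu x) D + n * B1 * w x.
    have [wx0|wxn0] := eqVneq (w x) 0.
      have : hnorm (mu x) = 0.
        by apply/eqP; rewrite eq_le hnorm_ge0 andbT; have := muB x; rewrite wx0 mulr0.
      by move=> /hnorm_eq0 ->; rewrite rinner0l wx0 mulr0 addr0.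
    have wx : 0 < w x by rewrite lt_def wxn0 w_ge0.
    (* A step whose displacement t |mu x| is at most n, so that its quadratic cost matches the n^2
       by which z misses the infimum. *)
    pose t := n / (B1 * w x).
    have p0 : 0 < B1 * w x by rewrite mulr_gt0.
    have t0 : 0 < t by rewrite divr_gt0.
    have := dE _ (Kadd z t x Kz (ltW t0)).
    rewrite addrAC -/D hnorm_sqrD rinnerZr hnormZ cmod_real gtr0_norm// exprMn rinnerC.
    have h2 : t * (B1 * w x) = n by rewrite mulfVK ?gt_eqF.
    have h3 : hnorm (mu x) ^+ 2 <= (B1 * w x) ^+ 2.
      rewrite ler_sqr ?nnegrE ?hnorm_ge0 ?(ltW p0)//; apply: le_trans (muB x) _.
      by rewrite ler_pM2r// lerDl.
    have h4 : t ^+ 2 * hnorm (mu x) ^+ 2 <= n ^+ 2.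
      have -> : n ^+ 2 = t ^+ 2 * (B1 * w x) ^+ 2 by rewrite -exprMn h2.
      by rewrite ler_wpM2l// sqr_ge0.
    move: hz h4; rewrite -/D -mulrA; move: (hnorm D ^+ 2) (t ^+ 2 * _) => a b h5 h6 h7.
    rewrite -(pmulr_rge0 _ t0) mulrDr (mulrCA t) h2.
    move: h5 h6 h7; set r := rinner _ _; move: (t * r) => q; clear; move=> *; nra.
  have h2 := dual D (n * B1) (mulr_ge0 (ltW n0) (ltW B1p)) h1.
  (* Variation by shrinking z to (1 - n) z, which stays in the cone because n <= 1. *)
  have h3 : 0 <= n ^+ 2 - 2 * n * rinner z D + n ^+ 2 * hnorm z ^+ 2.
    have n1' : 0 <= 1 - n by rewrite subr_ge0.
    have := dE _ (Kscale z (1 - n) Kz n1').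
    have -> : (1 - n)%:C *: z - m0 = D - n%:C *: z.
      by rewrite rmorphB /= scalerBl scale1r addrAC.
    rewrite hnorm_sqrB rinnerZr hnormZ cmod_real gtr0_norm// exprMn rinnerC.
    move: hz; rewrite -/D; move: (hnorm D ^+ 2) (n ^+ 2 * _) => a b; clear => *; nra.
  have h4 : 2 * rinner z D <= n * (1 + hnorm z ^+ 2).
    rewrite -(ler_pM2l n0); move: h3; clear; move: (rinner z D) (hnorm z ^+ 2) => a b *; nra.
  have hD : hnorm D ^+ 2 = rinner z D - rinner m0 D.
    by rewrite -rinner_hnorm {1}/D rinnerDl rinnerNl.
  have hD2 : hnorm D <= 2 + d.
    have hD3 : hnorm D ^+ 2 < d + n ^+ 2 by exact: hz.
    have hD4 := hnorm_ge0 D.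
    have n2 : n ^+ 2 <= 1 by rewrite expr_le1// ltW.
    move: hD3 hD4 n2 d0; clear; clearbody d; move: (hnorm D) => a h1 h2 h3 h4.
    rewrite leNgt; apply/negP => h5.
    have h6 : (2 + d) ^+ 2 <= a ^+ 2 by rewrite ler_sqr ?nnegrE ?addr_ge0// ltW.
    move: h1 h3 h4 h6; clear; nra.
  have hz2 : hnorm z <= hnorm m0 + (2 + d).
    have -> : z = m0 + D by rewrite addrC subrK.
    by apply: le_trans (hnormD _ _) _; rewrite lerD2l.
  have hz3 : hnorm z ^+ 2 <= (hnorm m0 + (2 + d)) ^+ 2.
    by rewrite ler_sqr ?nnegrE ?addr_ge0 ?hnorm_ge0.
  have h5 : n * (1 + hnorm z ^+ 2) <= n * (1 + (hnorm m0 + (2 + d)) ^+ 2).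
    by rewrite ler_pM2l// lerD2l.
  apply: le_trans (dE _ Kz) _; rewrite -/D hD /c.
  move: h2 h4 h5; clear; move: (rinner z D) (rinner m0 D) (_ ^+ 2) (_ ^+ 2) => *; lra.
have d00 : d = 0.
  apply/eqP; rewrite eq_le d0 andbT; apply/ler_addgt0Pr => e e0; rewrite add0r.
  have c0 : 0 < c by rewrite /c ltr_wpDr ?mulr_ge0 ?(ltW B1p)// divr_gt0// ltr_wpDr ?sqr_ge0.
  have [h|h] := lerP (e / c) 1.
    by apply: le_trans (key _ (divr_gt0 e0 c0) h) _; rewrite mulfVK ?gt_eqF.
  apply: le_trans (key 1 ltr01 (lexx _)) _; rewrite mul1r.
  by move: h; rewrite ltr_pdivlMr// mul1r => /ltW.
move=> e e0; have [_ [z Kz <-] hz] := inf_adherent (exprn_gt0 2 e0) Einf.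
exists z => //; move: hz; rewrite -/d d00 add0r.
by rewrite ltr_sqr ?nnegrE ?hnorm_ge0 ?(ltW e0).
Qed.

End ConeApproximation.

(** * Operator matrices *)

Section OperatorMatrices.
Context {R : realType} {H : hilbertType R}.
Local Notation C := R[i].

Lemma hnorm_tupleE n (x : 'I_n -> H) : hnorm_tuple x = hnorm (x : hpower 'I_n H).
Proof. by rewrite /hnorm_tuple -hnorm_hpower sqrtr_sqr ger0_norm ?hnorm_ge0. Qed.

Definition mxop n (T : 'M[H -> H]_n) : hpower 'I_n H -> hpower 'I_n H :=
  fun x i => \sum_(j < n) T i j (x j).

Lemma mxopnormE n (T : 'M[H -> H]_n) : mxopnorm T = opnorm (mxop T).
Proof.
rewrite /mxopnorm /opnorm; congr (sup _); rewrite seteqP; split=> _ [x /= hx <-];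
  by exists x; rewrite /= ?hnorm_tupleE// -hnorm_tupleE.
Qed.

Lemma bounded_mxop n (T : 'M[H -> H]_n) :
  (forall i j, bounded_operator (T i j)) -> bounded_operator (mxop T).
Proof.
move=> bT; split.
  move=> a x y; apply/funext => i; rewrite /mxop.
  change (\sum_(j < n) T i j (a *: x j + y j) =
    a *: (\sum_(j < n) T i j (x j)) + \sum_(j < n) T i j (y j)).
  rewrite scaler_sumr -big_split; apply: eq_bigr => j _.
  by rewrite (bT i j).1.
have /choice [M hM] : forall p : 'I_n * 'I_n, exists M, 0 <= M /\ opbound (T p.1 p.2) M.
  by move=> p; have [M M0 hM] := bounded_opbound (bT p.1 p.2); exists M.
exists (\sum_i \sum_j M (i, j)) => x.
apply: le_trans (hnorm_hpower_le _) _; rewrite mulr_suml; apply: ler_sum => i _.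
apply: le_trans (hnorm_sum _ _ _) _; rewrite mulr_suml; apply: ler_sum => j _.
have [M0 hij] := hM (i, j); apply: le_trans (hij _) _.
by rewrite ler_wpM2l// hnorm_le_hpower.
Qed.

(** The sum of the c_i (x) S_i. Every matrix over the span of the S_i has this form, so matrix norms
    on a finite-dimensional space of operators are norms of such combinations. *)
Definition mxcomb d n (c : 'I_d -> 'M[C]_n) (S : 'I_d -> H -> H) : 'M[H -> H]_n :=
  \matrix_(a, b) \sum_i c i a b *: S i.

Lemma bounded_mxcomb d n (c : 'I_d -> 'M[C]_n) (S : 'I_d -> H -> H) :
  (forall i, bounded_operator (S i)) -> bounded_operator (mxop (mxcomb c S)).
Proof.
move=> bS; apply: bounded_mxop => a b; rewrite mxE.
by apply: bounded_sum => i _; exact: boundedZ.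
Qed.

Lemma mxop_comb d n (c : 'I_d -> 'M[C]_n) (S : 'I_d -> H -> H) x a :
  mxop (mxcomb c S) x a = \sum_b \sum_i c i a b *: S i (x b).
Proof. by apply: eq_bigr => b _; rewrite mxE fct_sumx. Qed.

Lemma inner_mxcomb d n (c : 'I_d -> 'M[C]_n) (S : 'I_d -> H -> H) (x y : hpower 'I_n H) :
  inner (mxop (mxcomb c S) x) y = \sum_a \sum_b \sum_i c i a b * inner (S i (x b)) (y a).
Proof.
rewrite inner_hpower; apply: eq_bigr => a _; rewrite mxop_comb inner_suml.
apply: eq_bigr => b _; rewrite inner_suml; apply: eq_bigr => i _.
by rewrite innerZl.
Qed.

End OperatorMatrices.

Section Domination.
Context {R : realType}.
Local Notation C := R[i].
Implicit Types (H K : hilbertType R).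

(** The assignment S_i |-> T_i extends to a completely contractive linear map of the spans. Speaking
    of tuples avoids choosing that map, and M = 0 covers its being well defined. *)
Definition mxdom d H K (S : 'I_d -> H -> H) (T : 'I_d -> K -> K) :=
  forall n (c : 'I_d -> 'M[C]_n) (M : R), 0 <= M ->
    opbound (mxop (mxcomb c S)) M -> opbound (mxop (mxcomb c T)) M.

(** With the identity among the S_i, adding scalars to a combination only changes its coefficients;
    this brings 1 - t X and X + g within reach of [mxdom]. *)
Lemma mxcomb_shift d H n (c : 'I_d -> 'M[C]_n) (S : 'I_d -> H -> H) (i0 : 'I_d) (s t : C) x :
  S i0 = id ->
  mxop (mxcomb (fun i => (s * (i == i0)%:R)%:M + t *: c i) S) x
  = s *: x + t *: mxop (mxcomb c S) x.
Proof.
move=> S0; apply/funext => a.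
change (mxop (mxcomb (fun i => (s * (i == i0)%:R)%:M + t *: c i) S) x a
  = s *: x a + t *: mxop (mxcomb c S) x a).
rewrite !mxop_comb scaler_sumr.
have -> : s *: x a = \sum_b \sum_i (s * (i == i0)%:R)%:M a b *: S i (x b).
  rewrite (bigD1 a)//= [X in _ + X]big1 => [|b ba]; last first.
    by rewrite big1// => i _; rewrite mxE [a == b]eq_sym (negPf ba) mulr0n scale0r.
  rewrite addr0 (bigD1 i0)//= big1 => [|i /negPf hi]; last first.
    by rewrite mxE hi mulr0 mul0rn scale0r.
  by rewrite mxE !eqxx mulr1 mulr1n S0 addr0.
rewrite -big_split; apply: eq_bigr => b _ /=.
rewrite scaler_sumr -big_split; apply: eq_bigr => i _ /=.
by rewrite !mxE scalerDl scalerA.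
Qed.

(* An operator X has positive real part iff |1 - t X|^2 <= 1 + O(t^2), which
   is a condition on norms only. *)
Lemma mxdom_accretive d H K (S : 'I_d -> H -> H) (T : 'I_d -> K -> K) (i0 : 'I_d) :
  (forall i, bounded_operator (S i)) -> S i0 = id -> T i0 = id -> mxdom S T ->
  forall n (c : 'I_d -> 'M[C]_n),
  (forall x, 0 <= rinner (mxop (mxcomb c S) x) x) ->
  forall y, 0 <= rinner (mxop (mxcomb c T) y) y.
Proof.
move=> bS S0 T0 dom n c pos y.
have [M M0 hM] := bounded_opbound (bounded_mxcomb c bS).
have key (t : R) : 0 < t -> - (t * (M ^+ 2 * hnorm y ^+ 2)) <= 2 * rinner (mxop (mxcomb c T) y) y.
  move=> t0.
  pose c' i := (1 * (i == i0)%:R)%:M + (- t)%:C *: c i.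
  pose N := Num.sqrt (1 + t ^+ 2 * M ^+ 2).
  have q0 : 0 <= 1 + t ^+ 2 * M ^+ 2 by rewrite addr_ge0// mulr_ge0// sqr_ge0.
  have N2 : N ^+ 2 = 1 + t ^+ 2 * M ^+ 2 by rewrite sqr_sqrtr.
  have hN : opbound (mxop (mxcomb c' S)) N.
    move=> x; rewrite mxcomb_shift// scale1r.
    rewrite -ler_sqr ?nnegrE ?mulr_ge0 ?hnorm_ge0 ?sqrtr_ge0//.
    rewrite exprMn N2 hnorm_sqrD rinnerZr hnormZ cmod_real normrN gtr0_norm// exprMn rinnerC.
    have h1 := pos x.
    have h2 : hnorm (mxop (mxcomb c S) x) ^+ 2 <= (M * hnorm x) ^+ 2.
      by rewrite ler_sqr ?nnegrE ?mulr_ge0 ?hnorm_ge0//; exact: hM.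
    have h3 : t ^+ 2 * hnorm (mxop (mxcomb c S) x) ^+ 2 <= t ^+ 2 * (M * hnorm x) ^+ 2.
      by rewrite ler_wpM2l// sqr_ge0.
    have h4 : 0 <= t * rinner (mxop (mxcomb c S) x) x by rewrite mulr_ge0// ltW.
    move: h3 h4; set p := hnorm (mxop _ _); set q := rinner _ _; set r := hnorm x.
    clearbody p q r; clear => h3 h4; lra.
  have := dom _ _ _ (sqrtr_ge0 _) hN y.
  rewrite mxcomb_shift// scale1r.
  rewrite -ler_sqr ?nnegrE ?mulr_ge0 ?hnorm_ge0 ?sqrtr_ge0//.
  rewrite exprMn N2 hnorm_sqrD rinnerZr hnormZ cmod_real normrN gtr0_norm// exprMn rinnerC.
  set p := hnorm (mxop _ _); set q := rinner _ _; set r := hnorm y => h.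
  have h2 : 0 <= t ^+ 2 * p ^+ 2 by rewrite mulr_ge0// sqr_ge0.
  have h3 : 0 <= t * (2 * q + t * (M ^+ 2 * r ^+ 2)).
    by move: h h2; clearbody p q r; clear => h1 h2; lra.
  rewrite (pmulr_rge0 _ t0) in h3; move: h3.
  by set u := t * _; clear => *; lra.
apply/ler_addgt0Pr => e e0.
have q0 : 0 < M ^+ 2 * hnorm y ^+ 2 + 1 by rewrite ltr_wpDl// mulr_ge0// sqr_ge0.
have := key _ (divr_gt0 e0 q0).
have h : e / (M ^+ 2 * hnorm y ^+ 2 + 1) * (M ^+ 2 * hnorm y ^+ 2) <= e.
  by rewrite mulrAC ler_pdivrMr// ler_pM2l// lerDl.
move: h; set u := _ / _ * _; set v := rinner _ _; clear -e0 => *; lra.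
Qed.

Definition ampl (I : finType) H (T : H -> H) : hpower I H -> hpower I H :=
  fun x s => T (x s).

Lemma inner_ampl (I : finType) H (T : H -> H) (x y : hpower I H) :
  inner (ampl T x) y = \sum_s inner (T (x s)) (y s).
Proof. by []. Qed.

(* Arveson's extension theorem in approximate form: the moments of T lie in the
   closed cone of moments of S, since a separating functional would be an
   accretive matrix combination of S whose image in T is not accretive. *)
Lemma mxdom_moments_ord d H K (S : 'I_d -> H -> H) (T : 'I_d -> K -> K) (i0 : 'I_d) :
  (forall i, bounded_operator (S i)) -> S i0 = id -> T i0 = id -> mxdom S T ->
  forall (I' : finType) N (y : 'I_N -> hpower I' K) (e : R), 0 < e ->
  exists (I : finType) (v : 'I_N -> hpower I H), forall i a b,
    cmod (inner (ampl (S i) (v a)) (v b) - inner (ampl (T i) (y a)) (y b)) < e.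
Proof.
move=> bS S0 T0 dom I' N y e e0.
pose J : finType := ('I_d * 'I_N * 'I_N)%type.
pose Q := hpower J (hscalar R).
pose mom (I : finType) (v : 'I_N -> hpower I H) : Q :=
  fun j => inner (ampl (S j.1.1) (v j.1.2)) (v j.2).
pose mu (x : hpower 'I_N H) : Q := fun j => inner (S j.1.1 (x j.1.2)) (x j.2).
pose m0 : Q := fun j => inner (ampl (T j.1.1) (y j.1.2)) (y j.2).
pose w (x : hpower 'I_N H) := hnorm x ^+ 2.
pose w0 := \sum_a hnorm (y a) ^+ 2.
pose KK : set Q := [set z | exists (I : finType) (v : 'I_N -> hpower I H), z = mom I v].
have /choice [M hM] : forall i, exists M, 0 <= M /\ opbound (S i) M.
  by move=> i; have [M M0 hM] := bounded_opbound (bS i); exists M.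
pose B := \sum_(j : J) M j.1.1.
have B0 : 0 <= B by apply: sumr_ge0 => j _; case: (hM j.1.1).
suff [z [I [v ->]] hz] : exists2 z, KK z & hnorm (z - m0) < e.
  exists I, v => i a b.
  rewrite -(@hnorm_hscalar R); apply: le_lt_trans hz.
  exact: (hnorm_le_hpower (mom I v - m0) (i, a, b)).
apply: (@cone_approx _ _ _ mu w B KK m0 w0) => //.
- exists 'I_0, (fun _ => 0); apply/funext => j.
  by rewrite /mom inner_ampl big_ord0.
- move=> z t x [I [v ->]] t0.
  (* Moments are quadratic in the vectors, so weight t is a rescaling by its root; a summand is
     added by enlarging the index set by one point. *)
  pose r := (Num.sqrt t)%:C.
  have rr : r * r^*%C = t%:C by rewrite conjc_real -rmorphM -expr2 sqr_sqrtr.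
  exists (I + unit)%type, (fun a s => if s is inl s then v a s else r *: x a).
  apply/funext => j; rewrite /mom inner_ampl big_sumType /=.
  rewrite (big_pred1 tt); last by case.
  by rewrite (linearfZ (bS _).1) innerZl innerZr mulrA rr.
- move=> z t [I [v ->]] t0.
  pose r := (Num.sqrt t)%:C.
  have rr : r * r^*%C = t%:C by rewrite conjc_real -rmorphM -expr2 sqr_sqrtr.
  exists I, (fun a => r *: v a); apply/funext => j.
  rewrite /mom [RHS]inner_ampl.
  change (t%:C * inner (ampl (S j.1.1) (v j.1.2)) (v j.2) =
     \sum_s inner (S j.1.1 (r *: v j.1.2 s)) (r *: v j.2 s)).
  rewrite inner_ampl mulr_sumr; apply: eq_bigr => s _.
  by rewrite (linearfZ (bS _).1) innerZl innerZr mulrA rr.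
- by move=> x; rewrite /w sqr_ge0.
- by apply: sumr_ge0 => a _; rewrite sqr_ge0.
- move=> x; apply: le_trans (hnorm_hpower_le _) _; rewrite /B mulr_suml; apply: ler_sum => j _.
  rewrite hnorm_hscalar; apply: le_trans (inner_CS _ _) _; rewrite /w expr2 mulrA.
  have [Mj0 hMj] := hM j.1.1.
  apply: ler_pM; rewrite ?hnorm_ge0//; last exact: hnorm_le_hpower.
  by apply: le_trans (hMj _) _; rewrite ler_wpM2l// hnorm_le_hpower.
move=> D g g0 hD.
(* The functional D read as matrix coefficients: the form of the combination c at x is the pairing
   of the moments of x with D, which fixes the conjugation and the exchange of a and b. The slack g
   becomes the shift by g times the identity in c'. *)
pose c (i : 'I_d) : 'M[C]_N := \matrix_(a, b) (D (i, b, a))^*%C.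
pose c' i := (g%:C * (i == i0)%:R)%:M + 1 *: c i.
have innc (L : hilbertType R) (Z : 'I_d -> L -> L) (x : hpower 'I_N L) :
    inner (mxop (mxcomb c Z) x) x
    = inner ((fun j : J => inner (Z j.1.1 (x j.1.2)) (x j.2)) : Q) D.
  rewrite inner_mxcomb inner_hpower.
  rewrite exchange_big /=; under eq_bigr do rewrite exchange_big /=.
  rewrite exchange_big /= pair_bigA /= pair_bigA /=; apply: eq_bigr => -[[i a] b] _ /=.
  by rewrite mxE mulrC.
have posS x : 0 <= rinner (mxop (mxcomb c' S) x) x.
  rewrite mxcomb_shift// scale1r rinnerDl rinnerZl rinner_hnorm addrC.
  by rewrite {1}/rinner innc; exact: hD.
have posT := mxdom_accretive bS S0 T0 dom posS.
have h s : 0 <= rinner ((fun j : J => inner (T j.1.1 (y j.1.2 s)) (y j.2 s)) : Q) D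
    + g * hnorm ((fun a => y a s) : hpower 'I_N K) ^+ 2.
  have := posT (fun a => y a s); rewrite mxcomb_shift// scale1r rinnerDl rinnerZl rinner_hnorm addrC.
  by rewrite {1}/rinner innc.
have -> : m0 = \sum_(s : I') ((fun j : J => inner (T j.1.1 (y j.1.2 s)) (y j.2 s)) : Q).
  by apply/funext => j; rewrite hpower_sumE.
have -> : w0 = \sum_(s : I') hnorm ((fun a => y a s) : hpower 'I_N K) ^+ 2.
  rewrite /w0; under eq_bigr do rewrite hnorm_hpower.
  by rewrite exchange_big; apply: eq_bigr => a _; rewrite hnorm_hpower.
by rewrite rinner_suml mulr_sumr -big_split /=; apply: sumr_ge0 => s _; exact: h.
Qed.

Lemma mxdom_moments d H K (S : 'I_d -> H -> H) (T : 'I_d -> K -> K) (i0 : 'I_d) :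
  (forall i, bounded_operator (S i)) -> S i0 = id -> T i0 = id -> mxdom S T ->
  forall (I' J : finType) (y : J -> hpower I' K) (e : R), 0 < e ->
  exists (I : finType) (v : J -> hpower I H), forall i a b,
    cmod (inner (ampl (S i) (v a)) (v b) - inner (ampl (T i) (y a)) (y b)) < e.
Proof.
move=> bS S0 T0 dom I' J y e e0.
have [I [v hv]] := mxdom_moments_ord bS S0 T0 dom (fun a : 'I_#|J| => y (enum_val a)) e0.
exists I, (fun a => v (enum_rank a)) => i a b.
by have := hv i (enum_rank a) (enum_rank b); rewrite !enum_rankK.
Qed.

End Domination.

(** * Near models and rigidity *)

Section FiniteHilbert.
Context {R : realType}.
Local Notation C := R[i].

Definition hcn (k : nat) : hilbertType R := hpower 'I_k (hscalar R).

Definition hbasis k (p : 'I_k) : hcn k := fun q => ((q == p)%:R : C).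

Definition hlift (V : hilbertType R) k (v : 'I_k -> V) (x : hcn k) : V :=
  \sum_p (x p : C) *: v p.

(** The l^1 norm, which bounds a form on C^k from bounds on its matrix entries. *)
Definition hl1 k (x : hcn k) : R := \sum_p cmod (x p).

Lemma hl1_ge0 k (x : hcn k) : 0 <= hl1 x.
Proof. by apply: sumr_ge0 => p _; exact: cmod_ge0. Qed.

Lemma inner_hcn k (x y : hcn k) : inner x y = \sum_p (x p : C) * (y p : C)^*%C.
Proof. by []. Qed.

Lemma hnorm_hcn k (x : hcn k) : hnorm x ^+ 2 = \sum_p cmod (x p) ^+ 2.
Proof. by rewrite hnorm_hpower; apply: eq_bigr => p _; rewrite hnorm_hscalar. Qed.

Lemma inner_hbasis k (x : hcn k) p : inner x (hbasis p) = x p.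
Proof.
rewrite inner_hcn (bigD1 p)//= big1 => [|q /negPf qp]; last by rewrite /hbasis qp conjc0 mulr0.
by rewrite /hbasis eqxx conjc1 mulr1 addr0.
Qed.

Lemma hnorm_hbasis k (p : 'I_k) : hnorm (hbasis p) = 1.
Proof.
apply/eqP; rewrite -(@eqrXn2 _ 2) ?hnorm_ge0// expr1n; apply/eqP; apply: complexI.
by rewrite -inner_hnorm inner_hbasis /hbasis eqxx.
Qed.

Lemma hlift_hbasisE k (x : hcn k) : hlift (@hbasis k) x = x.
Proof.
apply: inner_eq => z; rewrite /hlift inner_suml [RHS]inner_hcn; apply: eq_bigr => p _.
by rewrite innerZl innerC inner_hbasis.
Qed.

Lemma hlift_linear (V : hilbertType R) k (v : 'I_k -> V) : linear (hlift v).
Proof.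
move=> a x y; rewrite /hlift scaler_sumr -big_split; apply: eq_bigr => p _ /=.
by rewrite scalerA -scalerDl.
Qed.

Lemma hlift_hbasis (V : hilbertType R) k (v : 'I_k -> V) p : hlift v (hbasis p) = v p.
Proof.
rewrite /hlift (bigD1 p)//= big1 => [|q /negPf qp]; last by rewrite /hbasis qp scale0r.
by rewrite /hbasis eqxx scale1r addr0.
Qed.

Lemma linear_hlift (V : hilbertType R) k (T : hcn k -> V) (x : hcn k) :
  linear T -> T x = hlift (fun p => T (hbasis p)) x.
Proof.
move=> lT; rewrite -[in LHS](hlift_hbasisE x) /hlift (linearf_sum lT).
by apply: eq_bigr => p _; rewrite linearfZ.
Qed.

Lemma hl1_hnorm k (x : hcn k) : hl1 x <= k%:R * hnorm x.
Proof.
rewrite mulr_natl -[X in _ *+ X]card_ord -sumr_const; apply: ler_sum => p _.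
by rewrite -hnorm_hscalar hnorm_le_hpower.
Qed.

Lemma bounded_hlift (V : hilbertType R) k (v : 'I_k -> V) : bounded_operator (hlift v).
Proof.
split; first exact: hlift_linear.
exists (\sum_p hnorm (v p)) => x; apply: le_trans (hnorm_sum _ _ _) _.
rewrite mulr_suml; apply: ler_sum => p _; rewrite hnormZ mulrC ler_wpM2l ?hnorm_ge0//.
by rewrite -hnorm_hscalar hnorm_le_hpower.
Qed.

Lemma bounded_linear (V : hilbertType R) k (T : hcn k -> V) : linear T -> bounded_operator T.
Proof.
move=> lT; rewrite (_ : T = hlift (fun p => T (hbasis p))); first exact: bounded_hlift.
by apply/funext => x; exact: linear_hlift.
Qed.

Lemma opbound_ampl (I : finType) (H : hilbertType R) (T : H -> H) (M : R) :
  0 <= M -> opbound T M -> opbound (@ampl R I H T) M.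
Proof.
move=> M0 hM x; rewrite -ler_sqr ?nnegrE ?mulr_ge0 ?hnorm_ge0//.
rewrite exprMn !hnorm_hpower mulr_sumr; apply: ler_sum => s _.
by rewrite -exprMn ler_sqr ?nnegrE ?mulr_ge0 ?hnorm_ge0//; exact: hM.
Qed.

Lemma bounded_ampl (I : finType) (H : hilbertType R) (T : H -> H) :
  bounded_operator T -> bounded_operator (@ampl R I H T).
Proof.
move=> bT; have [M M0 hM] := bounded_opbound bT; split.
  by move=> a x y; apply/funext => s; rewrite /ampl; exact: bT.1.
by exists M; exact: opbound_ampl.
Qed.

Lemma adjoint_ampl (I : finType) (H : hilbertType R) (S T : H -> H) :
  adjoint_of S T -> adjoint_of (@ampl R I H S) (@ampl R I H T).
Proof. by move=> h x y; rewrite !inner_hpower; apply: eq_bigr => s _; exact: h. Qed.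

Lemma adjoint_sym (H : hilbertType R) (S T : H -> H) : adjoint_of S T -> adjoint_of T S.
Proof. by move=> h x y; rewrite innerC -h -innerC. Qed.

(** Taking y as the multiple of X x of norm |x| recovers the norm bound. The hypothesis is additive
    in x and y, so it can be summed over the components of an amplification. *)
Lemma opbound_rinner (H : hilbertType R) (X : H -> H) (M : R) : linear X -> 0 <= M ->
  (forall x y, 2 * rinner (X x) y <= M * (hnorm x ^+ 2 + hnorm y ^+ 2)) -> opbound X M.
Proof.
move=> lX M0 h x.
have [r0|rn0] := eqVneq (hnorm x) 0.
  by rewrite (hnorm_eq0 r0) linearf0// !hnorm0 mulr0.
have [q0|qn0] := eqVneq (hnorm (X x)) 0.
  by rewrite q0 mulr_ge0 ?hnorm_ge0.
have r0 : 0 < hnorm x by rewrite lt_def rn0 hnorm_ge0.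
have q0 : 0 < hnorm (X x) by rewrite lt_def qn0 hnorm_ge0.
have t0 : 0 <= hnorm x / hnorm (X x) by rewrite divr_ge0 ?hnorm_ge0.
have := h x ((hnorm x / hnorm (X x))%:C *: X x).
rewrite rinnerZr rinner_hnorm hnormZ cmod_real ger0_norm// mulfVK ?gt_eqF//.
have -> : hnorm x / hnorm (X x) * hnorm (X x) ^+ 2 = hnorm x * hnorm (X x).
  by rewrite expr2 mulrA mulfVK ?gt_eqF.
move=> h1; rewrite -(ler_pM2l r0); move: h1; clear.
by move: (hnorm x) (hnorm (X x)) => a b h; lra.
Qed.

(* [near_model S E dlt v]: the completely positive map x |-> [<x v_p, v_q>]
   sends each S i to E i within dlt. *)
Definition near_model d (L : hilbertType R) (S : 'I_d -> L -> L) k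
    (E : 'I_d -> hcn k -> hcn k) (dlt : R) (I : finType) (v : 'I_k -> hpower I L) :=
  forall i p q, cmod (inner (ampl (S i) (v p)) (v q) - inner (E i (hbasis p)) (hbasis q)) < dlt.

Lemma sesqui_approx (V : hilbertType R) k (X : hcn k -> hcn k) (T : V -> V) (v : 'I_k -> V) (dlt : R) :
  linear T -> linear X ->
  (forall p q, cmod (inner (T (v p)) (v q) - inner (X (hbasis p)) (hbasis q)) <= dlt) ->
  forall x y, cmod (inner (T (hlift v x)) (hlift v y) - inner (X x) y) <= dlt * hl1 x * hl1 y.
Proof.
move=> lT lX h x y.
have -> : inner (T (hlift v x)) (hlift v y) = \sum_p \sum_q x p * (y q)^*%C * inner (T (v p)) (v q).
  rewrite /hlift (linearf_sum lT) inner_suml; apply: eq_bigr => p _.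
  rewrite linearfZ// innerZl inner_sumr mulr_sumr; apply: eq_bigr => q _.
  by rewrite innerZr mulrA.
have -> : inner (X x) y = \sum_p \sum_q x p * (y q)^*%C * inner (X (hbasis p)) (hbasis q).
  rewrite -{1}(hlift_hbasisE x) -{1}(hlift_hbasisE y) /hlift (linearf_sum lX) inner_suml.
  apply: eq_bigr => p _; rewrite linearfZ// innerZl inner_sumr mulr_sumr; apply: eq_bigr => q _.
  by rewrite innerZr mulrA.
rewrite -sumrB; apply: le_trans (cmod_sum _ _ _) _.
rewrite -mulrA /hl1 mulr_suml mulr_sumr; apply: ler_sum => p _.
rewrite -sumrB; apply: le_trans (cmod_sum _ _ _) _.
rewrite !mulr_sumr; apply: ler_sum => q _.
by rewrite -mulrBr !cmodM cmod_conj mulrC ler_wpM2r// mulr_ge0 ?cmod_ge0.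
Qed.

End FiniteHilbert.

(** * Compression to the complement of a vector *)

Section Compression.
Context {R : realType}.
Local Notation C := R[i].
Local Notation cn := (@hcn R).
Variables (d k k' : nat) (E : 'I_d -> cn k -> cn k) (i0 : 'I_d).
Hypotheses (bE : forall i, bounded_operator (E i)) (E0 : E i0 = id).
Variables (V : cn k' -> cn k) (W : cn k -> cn k') (u : cn k).
Hypotheses (VW : forall (x : cn k') (y : cn k), inner (V x) y = inner x (W y)).
Hypotheses (WK : forall x, W (V x) = x) (VWE : forall x : cn k, V (W x) = x - inner x u *: u).

Let WV (x : cn k) (y : cn k') : inner (W x) y = inner x (V y).
Proof. by rewrite innerC -VW -innerC. Qed.

Let hnormW : forall x, hnorm (W x) <= hnorm x := hnorm_coisometry VW WK.

Let Ec i := W \o E i \o V.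

(** Both vectors are split by the projection P = V W. The part inside the range of P only sees the
    compressed operators; the rest costs the norm B times the components along u, weighted by dl. *)
Let compress_split n (c : 'I_d -> 'M[C]_n) (M B : R) (x y : hpower 'I_n (cn k)) (dl : R) :
  0 <= M -> opbound (mxop (mxcomb c Ec)) M -> 0 <= B -> opbound (mxop (mxcomb c E)) B -> 0 < dl ->
  2 * rinner (mxop (mxcomb c E) x) y <= M * (hnorm x ^+ 2 + hnorm y ^+ 2)
    + B * ((\sum_a cmod (inner (x a) u) ^+ 2 + \sum_a cmod (inner (y a) u) ^+ 2) * hnorm u ^+ 2 / dl
           + dl * (hnorm x ^+ 2 + hnorm y ^+ 2)).
Proof.
move=> M0 hM B0 hB dl0; set X := mxop (mxcomb c E).
have lX : linear X := (bounded_mxcomb c bE).1.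
pose P (z : hpower 'I_n (cn k)) : hpower 'I_n (cn k) := fun a => V (W (z a)).
pose Wz (z : hpower 'I_n (cn k)) : hpower 'I_n (cn k') := fun a => W (z a).
have hWz z : hnorm (Wz z) <= hnorm z.
  rewrite -ler_sqr ?nnegrE ?hnorm_ge0// !hnorm_hpower; apply: ler_sum => a _.
  by rewrite ler_sqr ?nnegrE ?hnorm_ge0//; exact: hnormW.
have Psym z w : rinner (P z) w = rinner z (P w).
  congr complex.Re; rewrite !inner_hpower; apply: eq_bigr => a _.
  by rewrite /P VW WV.
have hP z : hnorm (P z) <= hnorm z.
  apply: le_trans (hWz z); rewrite -ler_sqr ?nnegrE ?hnorm_ge0// !hnorm_hpower.
  by apply: ler_sum => a _; rewrite -!rinner_hnorm /rinner VW WK.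
have hN z : hnorm (z - P z) ^+ 2 = (\sum_a cmod (inner (z a) u) ^+ 2) * hnorm u ^+ 2.
  rewrite hnorm_hpower mulr_suml; apply: eq_bigr => a _.
  have -> : (z - P z) a = inner (z a) u *: u.
    by rewrite -[LHS]/(z a - V (W (z a))) VWE opprB addrC subrK.
  by rewrite hnormZ exprMn.
have PXP : rinner (X (P x)) (P y) = rinner (mxop (mxcomb c Ec) (Wz x)) (Wz y).
  congr complex.Re; rewrite !inner_mxcomb; apply: eq_bigr => a _; apply: eq_bigr => b _.
  by apply: eq_bigr => i _; rewrite /P -WV.
have split_eq : rinner (X x) y = rinner (X (P x)) (P y) + rinner (X (P x)) (y - P y)
    + rinner (X (x - P x)) y.
  by rewrite -rinnerDr (linearfB lX) rinnerDl rinnerNl (addrC (P y)) subrK (addrC (rinner (X x) y)) addrA subrr add0r.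
rewrite split_eq PXP [(_ + _) * hnorm u ^+ 2]mulrDl -(hN x) -(hN y).
have h1 : 2 * rinner (mxop (mxcomb c Ec) (Wz x)) (Wz y) <= M * (hnorm x ^+ 2 + hnorm y ^+ 2).
  apply: (@le_trans _ _ (2 * (M * (hnorm x * hnorm y)))).
    rewrite ler_pM2l//; apply: le_trans (rinner_CS _ _) _; rewrite mulrA.
    apply: ler_pM; rewrite ?hnorm_ge0//.
    by apply: le_trans (hM _) _; rewrite ler_wpM2l.
  rewrite mulrCA ler_wpM2l//; have h : 0 <= (hnorm x - hnorm y) ^+ 2 by exact: sqr_ge0.
  by move: h; move: (hnorm x) (hnorm y) => a b h; lra.
(* The weight dl suits overlaps with u of size dl: their squares divided by dl are still of order
   dl. *)
have amgm (a b : R) : 2 * (a * b) <= a ^+ 2 / dl + dl * b ^+ 2.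
  have -> : a ^+ 2 / dl + dl * b ^+ 2 = (a ^+ 2 + (dl * b) ^+ 2) / dl.
    by rewrite mulrDl exprMn expr2 -[dl * dl * _]mulrA [dl * _ / dl]mulrC mulKf ?gt_eqF.
  rewrite ler_pdivlMr//.
  have h : 0 <= (a - dl * b) ^+ 2 by exact: sqr_ge0.
  by lra.
have h2 : 2 * rinner (X (P x)) (y - P y) <= B * (hnorm (y - P y) ^+ 2 / dl + dl * hnorm x ^+ 2).
  apply: (@le_trans _ _ (B * (2 * (hnorm (y - P y) * hnorm x)))); last by rewrite ler_wpM2l.
  rewrite mulrCA ler_pM2l// (mulrC (hnorm (y - P y))) mulrA; apply: le_trans (rinner_CS _ _) _.
  rewrite ler_wpM2r ?hnorm_ge0//; apply: le_trans (hB _) _; exact: ler_wpM2l.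
have h3 : 2 * rinner (X (x - P x)) y <= B * (hnorm (x - P x) ^+ 2 / dl + dl * hnorm y ^+ 2).
  apply: (@le_trans _ _ (B * (2 * (hnorm (x - P x) * hnorm y)))); last by rewrite ler_wpM2l.
  rewrite mulrCA ler_pM2l// mulrA; apply: le_trans (rinner_CS _ _) _.
  by rewrite ler_wpM2r ?hnorm_ge0//; exact: hB.
move: h1 h2 h3; set r1 := rinner _ _; set r2 := rinner _ _; set r3 := rinner _ _.
set a := hnorm x ^+ 2; set b := hnorm y ^+ 2; set p := hnorm _ ^+ 2; set q := hnorm (x - _) ^+ 2.
by set z := dl^-1 => *; lra.
Qed.

Hypothesis u1 : hnorm u = 1.
Hypothesis models : forall dl : R, 0 < dl ->
  exists (I : finType) (v : 'I_k -> hpower I (cn k)), near_model E E dl v /\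
    forall p, hnorm ((fun s => inner (v p s) u) : hpower I (hscalar R)) <= dl.

(* If completely positive maps almost fixing the E i can have range almost
   orthogonal to u, then nothing is lost by compressing to the complement of u. *)
Lemma compression_dom : mxdom Ec E.
Proof.
move=> n c M M0 hM; set X := mxop (mxcomb c E).
have [B B0 hB] : exists2 B, 0 <= B & opbound X B by apply: bounded_opbound; exact: bounded_mxcomb.
apply: opbound_rinner => //; first exact: (bounded_mxcomb c bE).1.
move=> xi eta; apply/ler_addgt0Pr => e e0.
pose C1 := \sum_a \sum_b \sum_i cmod (c i a b) * (hl1 (xi b) * hl1 (eta a)).
pose C2 (z : hpower 'I_n (cn k)) := \sum_a hl1 (z a) ^+ 2.
have C10 : 0 <= C1.
  by do 3!(apply: sumr_ge0 => ? _); rewrite !mulr_ge0 ?cmod_ge0 ?hl1_ge0.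
have C20 z : 0 <= C2 z by apply: sumr_ge0 => a _; rewrite sqr_ge0.
pose Nx := hnorm xi ^+ 2 + hnorm eta ^+ 2.
pose Cx := C2 xi + C2 eta.
have Nx0 : 0 <= Nx by rewrite addr_ge0 ?sqr_ge0.
have Cx0 : 0 <= Cx by rewrite addr_ge0.
(* The sum of the coefficients of dl in all error terms, plus 1 to make it positive. *)
pose K := 2 * C1 + M * Cx + B * (Cx + Nx + Cx) + 1.
have Kc : 0 <= Cx + Nx + Cx by do 2!apply: addr_ge0 => //.
have K0 : 0 < K.
  by apply: ltr_wpDl => //; apply: addr_ge0; [apply: addr_ge0|]; exact: mulr_ge0.
pose dl := Order.min 1 (e / K).
have dl0 : 0 < dl by rewrite lt_min ltr01 divr_gt0.
have dl1 : dl <= 1 by rewrite ge_min lexx.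
have dle : dl * K <= e by rewrite -ler_pdivlMr// ge_min lexx orbT.
have [I [v [nm vu]]] := models dl0.
(* The map C^k -> (C^k)^I given by v, applied to each entry of z, with the index s in I moved
   outside: [compress_split] is used for each s and the results are summed. *)
pose Th (z : hpower 'I_n (cn k)) : hpower I (hpower 'I_n (cn k)) := fun s a => hlift v (z a) s.
have mom i x y : cmod (inner (ampl (E i) (hlift v x)) (hlift v y) - inner (E i x) y)
    <= dl * hl1 x * hl1 y.
  apply: (sesqui_approx (bounded_ampl I (bE i)).1 (bE i).1).
  by move=> p q; apply: ltW.
have s1 : cmod (inner (ampl X (Th xi)) (Th eta) - inner (X xi) eta) <= dl * C1.
  have -> : inner (ampl X (Th xi)) (Th eta) =
      \sum_a \sum_b \sum_i c i a b * inner (ampl (E i) (hlift v (xi b))) (hlift v (eta a)).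
    rewrite inner_ampl; under eq_bigr do rewrite inner_mxcomb.
    rewrite exchange_big; apply: eq_bigr => a _; rewrite exchange_big; apply: eq_bigr => b _.
    rewrite exchange_big; apply: eq_bigr => i _; rewrite -mulr_sumr.
    by congr (_ * _).
  rewrite inner_mxcomb -sumrB; apply: le_trans (cmod_sum _ _ _) _.
  rewrite /C1 mulr_sumr; apply: ler_sum => a _.
  rewrite -sumrB; apply: le_trans (cmod_sum _ _ _) _.
  rewrite mulr_sumr; apply: ler_sum => b _.
  rewrite -sumrB; apply: le_trans (cmod_sum _ _ _) _.
  rewrite mulr_sumr; apply: ler_sum => i _.
  by rewrite -mulrBr cmodM mulrCA ler_wpM2l ?cmod_ge0// mulrA; exact: mom.
have s2 z : hnorm (Th z) ^+ 2 <= hnorm z ^+ 2 + dl * C2 z.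
  have -> : hnorm (Th z) ^+ 2 = \sum_a hnorm (hlift v (z a)) ^+ 2.
    rewrite hnorm_hpower; under eq_bigr do rewrite hnorm_hpower.
    by rewrite exchange_big; apply: eq_bigr => a _; rewrite hnorm_hpower.
  rewrite (hnorm_hpower z) mulr_sumr -big_split; apply: ler_sum => a _ /=.
  have := mom i0 (z a) (z a); rewrite E0 => h.
  rewrite -lerBlDl -!rinner_hnorm /rinner -ReB expr2 mulrA.
  exact: le_trans (ler_norm _) (le_trans (cmod_Re _) h).
have s4 z : \sum_s \sum_a cmod (inner (Th z s a) u) ^+ 2 <= dl ^+ 2 * C2 z.
  rewrite exchange_big /C2 mulr_sumr; apply: ler_sum => a _.
  have -> : \sum_s cmod (inner (Th z s a) u) ^+ 2 =
     hnorm (hlift (fun p => (fun s => inner (v p s) u) : hpower I (hscalar R)) (z a)) ^+ 2.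
    rewrite hnorm_hpower; apply: eq_bigr => s _; rewrite hnorm_hscalar.
    congr (cmod _ ^+ 2); rewrite /Th /hlift !hpower_sumE inner_suml.
    by apply: eq_bigr => p _; exact: innerZl.
  rewrite -exprMn ler_sqr ?nnegrE ?mulr_ge0 ?hnorm_ge0 ?hl1_ge0 ?(ltW dl0)//.
  apply: le_trans (hnorm_sum _ _ _) _; rewrite /hl1 mulr_sumr; apply: ler_sum => p _.
  by rewrite hnormZ mulrC ler_wpM2r ?cmod_ge0.
have s3 : 2 * rinner (ampl X (Th xi)) (Th eta) <=
    M * (hnorm (Th xi) ^+ 2 + hnorm (Th eta) ^+ 2) + B * ((dl ^+ 2 * C2 xi + dl ^+ 2 * C2 eta) / dl
      + dl * (hnorm (Th xi) ^+ 2 + hnorm (Th eta) ^+ 2)).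
  have -> : rinner (ampl X (Th xi)) (Th eta) = \sum_s rinner (X (Th xi s)) (Th eta s).
    by rewrite /rinner inner_ampl Re_sum.
  have hs s := compress_split (Th xi s) (Th eta s) M0 hM B0 hB dl0.
  rewrite mulr_sumr; apply: le_trans (ler_sum _ (fun s _ => hs s)) _.
  rewrite u1 expr1n big_split /= -!mulr_sumr big_split /= -!hnorm_hpower.
  rewrite lerD2l ler_wpM2l// big_split /= -!mulr_sumr big_split /= -!hnorm_hpower.
  rewrite lerD2r -mulr_suml ler_pM2r ?invr_gt0//.
  under eq_bigr do rewrite mulr1.
  by rewrite big_split /=; apply: lerD; exact: s4.
have s5 : 2 * rinner (X xi) eta <= 2 * rinner (ampl X (Th xi)) (Th eta) + 2 * (dl * C1).
  rewrite -mulrDr ler_pM2l// -lerBlDl -/(rinner _ _) /rinner -ReB -opprB ReN.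
  apply: le_trans (ler_norm _) _; rewrite normrN.
  exact: le_trans (cmod_Re _) s1.
apply: le_trans s5 _.
have e1 := s2 xi; have e2 := s2 eta.
have q1 : (dl ^+ 2 * C2 xi + dl ^+ 2 * C2 eta) / dl = dl * Cx.
  by rewrite -mulrDr -/Cx expr2 -!mulrA [Cx / dl]mulrC mulVKf ?gt_eqF.
rewrite q1 in s3.
have q2 : hnorm (Th xi) ^+ 2 + hnorm (Th eta) ^+ 2 <= Nx + dl * Cx by rewrite /Nx /Cx; lra.
have q3 : hnorm (Th xi) ^+ 2 + hnorm (Th eta) ^+ 2 <= Nx + Cx.
  apply: le_trans q2 _; rewrite lerD2l; exact: ler_piMl.
have q4 := ler_wpM2l M0 q2.
have q5 : B * (dl * Cx + dl * (hnorm (Th xi) ^+ 2 + hnorm (Th eta) ^+ 2)) <= B * (dl * Cx + dl * (Nx + Cx)).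
  by rewrite ler_wpM2l// lerD2l ler_wpM2l// ltW.
apply: le_trans (_ : _ <= M * (Nx + dl * Cx) + B * (dl * Cx + dl * (Nx + Cx)) + 2 * (dl * C1)) _.
  by rewrite lerD2r; apply: le_trans s3 _; exact: lerD.
apply: le_trans (_ : _ <= M * Nx + dl * K) _; last by rewrite lerD2l.
rewrite /K; move: (C1) (Cx) (Nx) (M) (B) (dl) dl0 => a1 a2 a3 a4 a5 a6 *; lra.
Qed.

End Compression.

Lemma real_family_cluster (R : realType) (J : finType) (f : nat -> J -> R) :
  (forall n i, `|f n i| <= 1) ->
  exists l : J -> R, forall (e : R) N, 0 < e ->
    exists2 n, (N <= n)%N & forall i, `|f n i - l i| < e.
Proof.
move=> f1.
pose g n : 'rV[R]_#|J| := \row_i f n (enum_val i).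
have cA := rV_compact (fun i : 'I_#|J| => @segment_compact R (-1) 1).
have FA : (g @ \oo) [set v : 'rV[R]_#|J| | forall i, `[-1, 1]%classic (v ord0 i)].
  by exists 0%N => // n _ /= i; rewrite mxE /= in_itv /= -ler_norml.
have [v [_ clv]] := cA (g @ \oo) _ FA.
exists (fun i => v ord0 (enum_rank i)) => e N e0.
have GN : (g @ \oo) [set g n | n in [set n | (N <= n)%N]].
  by exists N => // n /= hn; exists n.
have [_ [[n hn <-] hb]] := clv _ _ GN (nbhsx_ballx v e e0).
exists n => // i; case: hb => _ /(_ ord0 (enum_rank i)).
by rewrite mxE enum_rankK /ball /= distrC.
Qed.

(** * A uniform lower bound for near models *)

Section LowerBound.
Context {R : realType}.
Local Notation C := R[i].
Local Notation cn := (@hcn R).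

Lemma hcn_sphere_cluster k (w : nat -> cn k) : (forall n, hnorm (w n) = 1) ->
  exists2 u : cn k, hnorm u = 1 & forall (e : R) N, 0 < e ->
    exists2 n, (N <= n)%N & hnorm (w n - u) < e.
Proof.
move=> w1.
pose f n (j : 'I_k * bool) : R := if j.2 then complex.Re (w n j.1) else complex.Im (w n j.1).
have wp n p : cmod (w n p) <= 1 by rewrite -(w1 n) -hnorm_hscalar hnorm_le_hpower.
have [l hl] : exists l : 'I_k * bool -> R, forall (e : R) N, 0 < e ->
    exists2 n, (N <= n)%N & forall i, `|f n i - l i| < e.
  apply: real_family_cluster => n [p []] /=.
    by apply: le_trans (wp n p); exact: cmod_Re.
  by apply: le_trans (wp n p); exact: cmod_Im.
pose u : cn k := fun p => (l (p, true) +i* l (p, false)).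
have hu (e : R) N : 0 < e -> exists2 n, (N <= n)%N & hnorm (w n - u) < e.
  move=> e0.
  have k0 : 0 < 2 * k%:R + 1 :> R by rewrite ltr_wpDl// mulr_ge0.
  have [n hn hN] := hl _ N (divr_gt0 e0 k0).
  exists n => //; apply: le_lt_trans (hnorm_hpower_le _) _.
  apply: (@le_lt_trans _ _ (\sum_(p < k) 2 * (e / (2 * k%:R + 1)))).
    apply: ler_sum => p _; rewrite hnorm_hscalar; apply: le_trans (cmod_le _) _.
    rewrite -[(w n - u) p]/(w n p - u p : C) ReB ImB mulr_natl mulr2n.
    by apply: lerD; apply: ltW; [exact: hN (p, true)|exact: hN (p, false)].
  rewrite sumr_const card_ord -[_ *+ k]mulr_natl mulrCA !mulrA ltr_pdivrMr// mulrC.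
  by rewrite ltr_pM2l// ltrDl.
exists u => //; apply/eqP; rewrite -subr_eq0 -normr_eq0; apply/eqP/le_anti; rewrite normr_ge0 andbT.
apply/ler_addgt0Pr => e /(hu _ 0%N) [n _ hn]; rewrite add0r -(w1 n).
have h1 := hnorm_triB u (w n) 0; have h2 := hnorm_triB (w n) u 0.
rewrite !subr0 in h1 h2; rewrite (hnormBC u) in h1.
by rewrite ler_norml; apply/andP; split; move: hn h1 h2; set a := hnorm _; lra.
Qed.

Variables (d k : nat) (E : 'I_d -> cn k -> cn k) (i0 : 'I_d).
Hypothesis E0 : E i0 = id.

(** Its squared norm is <(w w^* (x) 1) x, x>. Summed over the vectors of a near model, it is the
    trace of the image of w w^* under the completely positive map. *)
Definition overlap (I : finType) (L : hilbertType R) (x : hpower I L) (w : L) : hpower I (hscalar R) :=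
  fun s => inner (x s) w.

Lemma hnorm_overlap (I : finType) (L : hilbertType R) (x : hpower I L) (w : L) :
  hnorm (overlap x w) <= hnorm x * hnorm w.
Proof.
rewrite -ler_sqr ?nnegrE ?mulr_ge0 ?hnorm_ge0// exprMn !hnorm_hpower mulr_suml.
apply: ler_sum => s _; rewrite hnorm_hscalar -exprMn.
by rewrite ler_sqr ?nnegrE ?mulr_ge0 ?hnorm_ge0 ?cmod_ge0//; exact: inner_CS.
Qed.

Lemma overlapD (I : finType) (L : hilbertType R) (x : hpower I L) (w w' : L) :
  overlap x (w + w') = overlap x w + overlap x w'.
Proof. by apply/funext => s; rewrite /overlap innerDr. Qed.

Lemma hnorm_overlapZ (I : finType) (L : hilbertType R) (x : hpower I L) (a : C) (w : L) :
  hnorm (overlap x (a *: w)) = cmod a * hnorm (overlap x w).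
Proof.
have -> : overlap x (a *: w) = a^*%C *: overlap x w.
  by apply/funext => s; rewrite /overlap innerZr.
by rewrite hnormZ cmod_conj.
Qed.

Lemma near_model_norm (L : hilbertType R) (S : 'I_d -> L -> L) dl (I : finType) (v : 'I_k -> hpower I L) p :
  S i0 = id -> near_model S E dl v -> hnorm (v p) ^+ 2 <= 1 + dl.
Proof.
move=> S0 /(_ i0 p p); rewrite S0 E0 => h.
rewrite -lerBlDl -[X in _ - X](expr1n _ 2) -(hnorm_hbasis p) -!rinner_hnorm /rinner -ReB.
exact/ltW/(le_lt_trans (le_trans (ler_norm _) (cmod_Re _)) h).
Qed.

Hypothesis rigid : ~ exists2 u : cn k, hnorm u = 1 & forall dl : R, 0 < dl ->
  exists (I : finType) (v : 'I_k -> hpower I (cn k)), near_model E E dl v /\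
    forall p, hnorm (overlap (v p) u) <= dl.

(** Otherwise there are near models with tolerance 1/(j+1) whose overlaps with unit vectors w_j tend
    to 0. A cluster point u of the w_j on the sphere of C^k is then forbidden by [rigid], overlaps
    being continuous in w uniformly over near models. *)
Lemma near_model_lower_bound : exists c dl : R, [/\ 0 < c, 0 < dl &
  forall (I : finType) (v : 'I_k -> hpower I (cn k)), near_model E E dl v ->
  forall w, c * hnorm w ^+ 2 <= \sum_p hnorm (overlap (v p) w) ^+ 2].
Proof.
apply: contrapT => hn; apply: rigid.
have hj (j : nat) : exists x : {I : finType & ('I_k -> hpower I (cn k)) * cn k}%type,
   [/\ near_model E E j.+1%:R^-1 (projT2 x).1, hnorm (projT2 x).2 = 1 &
     \sum_p hnorm (overlap ((projT2 x).1 p) (projT2 x).2) ^+ 2 <= j.+1%:R^-1].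
  apply: contrapT => hn2; apply: hn; exists j.+1%:R^-1, j.+1%:R^-1.
  split; rewrite ?invr_gt0// => I v nm w.
  rewrite leNgt; apply/negP => hlt; apply: hn2.
  have w0 : 0 < hnorm w.
    rewrite lt_def hnorm_ge0 andbT; apply: contraTneq hlt => w0.
    by rewrite w0 expr0n mulr0 -leNgt sumr_ge0// => p _; exact: sqr_ge0.
  exists (existT _ I (v, (hnorm w)^-1%:C *: w)); split=> //=.
    by rewrite hnormZ cmod_real ger0_norm ?invr_ge0 ?hnorm_ge0// mulVf ?gt_eqF.
  under eq_bigr do rewrite hnorm_overlapZ cmod_real ger0_norm ?invr_ge0 ?hnorm_ge0// exprMn.
  rewrite -mulr_sumr exprVn mulrC ler_pdivrMr ?exprn_gt0//; exact: ltW.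
have {hj} [x hx] := choice hj.
have [u u1 hu] := @hcn_sphere_cluster k (fun j => (projT2 (x j)).2) (fun j => let: And3 _ h _ := hx j in h).
exists u => // dl dl0.
have d4 : 0 < dl / 4 by rewrite divr_gt0.
have d2 : 0 < dl / 2 by rewrite divr_gt0.
have [N1 hN1] := invSn_small dl0.
have [N2 hN2] := invSn_small (exprn_gt0 2 d2).
have [N3 hN3] := invSn_small (ltr01 : 0 < 1 :> R).
have [j hj wu] := hu _ (maxn N1 (maxn N2 N3)) d4.
move: hj; rewrite !geq_max => /andP[j1 /andP[j2 j3]].
have [nm w1 hs] := hx j.
exists (projT1 (x j)), (projT2 (x j)).1; split.
  by move=> i p q; apply: lt_trans (nm i p q) _; exact: hN1.
move=> p; rewrite -[u](subrK (projT2 (x j)).2) overlapD; apply: le_trans (hnormD _ _) _.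
have h1 : hnorm (overlap ((projT2 (x j)).1 p) (projT2 (x j)).2) <= dl / 2.
  rewrite -ler_sqr ?nnegrE ?hnorm_ge0 ?(ltW d2)//.
  apply: le_trans (ltW (hN2 j j2)); apply: le_trans hs.
  by rewrite (bigD1 p)//= lerDl sumr_ge0// => q _; exact: sqr_ge0.
have h2 : hnorm ((projT2 (x j)).1 p) <= 2.
  rewrite -ler_sqr ?nnegrE ?hnorm_ge0//; apply: le_trans (near_model_norm p E0 nm) _.
  by have h3 := hN3 j j3; move: h3; set q := _^-1 => *; lra.
have h3 : hnorm (overlap ((projT2 (x j)).1 p) (u - (projT2 (x j)).2)) <= 2 * (dl / 4).
  apply: le_trans (hnorm_overlap _ _) _; apply: ler_pM; rewrite ?hnorm_ge0//.
  by rewrite hnormBC ltW.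
move: h1 h3; set a := hnorm _; set b := hnorm _ => *; lra.
Qed.

End LowerBound.

(** * Near models of E on itself are almost multiplicative *)

Section Rigidity.
Context {R : realType}.
Local Notation C := R[i].
Local Notation cn := (@hcn R).
Variables (d k : nat) (E : 'I_d -> cn k -> cn k) (i0 : 'I_d).
Hypothesis bE : forall i, bounded_operator (E i).
Hypothesis E0 : E i0 = id.

Definition defect (L : hilbertType R) (Y : L -> L) (X : cn k -> cn k) (v : 'I_k -> L) (x : cn k) : L :=
  Y (hlift v x) - hlift v (X x).

Lemma near_model_moment (L : hilbertType R) (S : 'I_d -> L -> L) dl (I : finType)
    (v : 'I_k -> hpower I L) i : bounded_operator (S i) -> near_model S E dl v ->
  forall (x y : cn k), cmod (inner (ampl (S i) (hlift v x)) (hlift v y) - inner (E i x) y)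
    <= dl * hl1 x * hl1 y.
Proof.
move=> bS nm; apply: (sesqui_approx (bounded_ampl I bS).1 (bE i).1) => p q.
exact/ltW/nm.
Qed.

(** Positive maps commute with adjoints: exchanging the two vectors turns moments of S_i into
    moments of its adjoint, so near models control these too. *)
Lemma near_model_adjoint_moment (L : hilbertType R) (S : 'I_d -> L -> L) dl (I : finType)
    (v : 'I_k -> hpower I L) i (S' : L -> L) (E' : cn k -> cn k) :
  bounded_operator (S i) -> adjoint_of (S i) S' -> adjoint_of (E i) E' -> near_model S E dl v ->
  forall (x y : cn k), cmod (inner (ampl S' (hlift v x)) (hlift v y) - inner (E' x) y)
    <= dl * hl1 x * hl1 y.
Proof.
move=> bS SS' EE' nm x y.
rewrite (adjoint_sym (adjoint_ampl SS')) (adjoint_sym EE') (innerC (hlift v x)) (innerC x).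
rewrite -rmorphB cmod_conj -mulrA (mulrC (hl1 x)) mulrA.
exact: near_model_moment.
Qed.

Lemma near_model_isometry (L : hilbertType R) (S : 'I_d -> L -> L) dl (I : finType)
    (v : 'I_k -> hpower I L) : S i0 = id -> near_model S E dl v ->
  forall (x y : cn k), cmod (inner (hlift v x) (hlift v y) - inner x y) <= dl * hl1 x * hl1 y.
Proof.
move=> S0 nm x y; have bS : bounded_operator (S i0) by rewrite S0; exact: bounded_id.
by have := near_model_moment bS nm x y; rewrite S0 E0.
Qed.

Lemma defect_inner (L : hilbertType R) (Y : L -> L) (X : cn k -> cn k) dl (v : 'I_k -> L) :
  (forall (x y : cn k), cmod (inner (Y (hlift v x)) (hlift v y) - inner (X x) y) <= dl * hl1 x * hl1 y) ->
  (forall (x y : cn k), cmod (inner (hlift v x) (hlift v y) - inner x y) <= dl * hl1 x * hl1 y) ->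
  forall (x y : cn k), cmod (inner (defect Y X v x) (hlift v y)) <= dl * ((hl1 x + hl1 (X x)) * hl1 y).
Proof.
move=> h1 h2 x y; rewrite innerBl.
have -> : inner (Y (hlift v x)) (hlift v y) - inner (hlift v (X x)) (hlift v y) =
  (inner (Y (hlift v x)) (hlift v y) - inner (X x) y) - (inner (hlift v (X x)) (hlift v y) - inner (X x) y).
  by rewrite opprB addrA subrK.
apply: le_trans (cmodD _ _) _; rewrite cmodN mulrDl mulrDr !mulrA.
by apply: lerD; [exact: h1|exact: h2].
Qed.

(** Writing V for [hlift v], the defect Y V x - V X x is almost orthogonal to the range of V, and
    Pythagoras applies up to O(dl). Its squared norm is therefore the gap in the Kadison-Schwarz
    inequality |X x|^2 <= |Y V x|^2. *)
Lemma hnorm_defect (L : hilbertType R) (Y : L -> L) (X : cn k -> cn k) dl (v : 'I_k -> L) :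
  (forall (x y : cn k), cmod (inner (Y (hlift v x)) (hlift v y) - inner (X x) y) <= dl * hl1 x * hl1 y) ->
  (forall (x y : cn k), cmod (inner (hlift v x) (hlift v y) - inner x y) <= dl * hl1 x * hl1 y) ->
  forall (x : cn k), `|hnorm (Y (hlift v x)) ^+ 2 - (hnorm (defect Y X v x) ^+ 2 + hnorm (X x) ^+ 2)|
    <= dl * (2 * ((hl1 x + hl1 (X x)) * hl1 (X x)) + hl1 (X x) * hl1 (X x)).
Proof.
move=> h1 h2 x.
have -> : Y (hlift v x) = defect Y X v x + hlift v (X x) by rewrite subrK.
rewrite hnorm_sqrD.
have a1 : `|rinner (defect Y X v x) (hlift v (X x))| <= dl * ((hl1 x + hl1 (X x)) * hl1 (X x)).
  exact: le_trans (cmod_Re _) (defect_inner h1 h2 _ _).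
have a2 : `|hnorm (hlift v (X x)) ^+ 2 - hnorm (X x) ^+ 2| <= dl * (hl1 (X x) * hl1 (X x)).
  rewrite -!rinner_hnorm /rinner -ReB mulrA; exact: le_trans (cmod_Re _) (h2 _ _).
set a := hnorm _ ^+ 2; set b := rinner _ _ in a1 *; set c := hnorm _ ^+ 2 in a2 *.
set e := hnorm _ ^+ 2 in a2 *.
have -> : a + 2 * b + c - (a + e) = 2 * b + (c - e) by ring.
apply: le_trans (ler_normD _ _) _; rewrite mulrDr normrM ger0_norm// (mulrCA dl).
by apply: lerD => //; rewrite ler_pM2l.
Qed.

Variables (c dl0 : R).
Hypothesis c_gt0 : 0 < c.
Hypothesis dl0_gt0 : 0 < dl0.
Hypothesis lower_bound : forall (I : finType) (v : 'I_k -> hpower I (cn k)), near_model E E dl0 v ->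
  forall w : cn k, c * hnorm w ^+ 2 <= \sum_p hnorm (overlap (v p) w) ^+ 2.

(** Each coordinate of G is an inner product with a fixed vector h, to which the scalar bound
    applies; summing over coordinates says that the map given by th shrinks the trace of G^* G at
    most by the factor c. *)
Lemma lower_bound_vector (I J : finType) (th : 'I_k -> hpower I (cn k)) (G : cn k -> hpower J (cn k)) :
  linear G -> near_model E E dl0 th ->
  c * (\sum_q hnorm (G (hbasis q)) ^+ 2) <= \sum_p \sum_s hnorm (G (th p s)) ^+ 2.
Proof.
move=> lG nm.
have hG y : hnorm (G y) ^+ 2 = \sum_t \sum_r cmod (G y t r) ^+ 2.
  by rewrite hnorm_hpower; apply: eq_bigr => t _; rewrite hnorm_hcn.
under eq_bigr do rewrite hG.
have -> : \sum_p \sum_s hnorm (G (th p s)) ^+ 2 =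
    \sum_p \sum_s \sum_t \sum_r cmod (G (th p s) t r) ^+ 2.
  by apply: eq_bigr => p _; apply: eq_bigr => s _; rewrite hG.
rewrite exchange_big mulr_sumr /=.
under [X in _ <= X]eq_bigr do rewrite exchange_big /=.
rewrite [X in _ <= X]exchange_big /=; apply: ler_sum => t _.
rewrite exchange_big mulr_sumr /=.
under [X in _ <= X]eq_bigr do rewrite exchange_big /=.
rewrite [X in _ <= X]exchange_big /=; apply: ler_sum => r _.
pose h : cn k := fun q => (G (hbasis q) t r : C)^*%C.
have Gh y : G y t r = inner y h.
  rewrite (linear_hlift y lG) /hlift !hpower_sumE inner_hcn.
  by apply: eq_bigr => q _; rewrite /h conjcK.
have := lower_bound nm h; rewrite hnorm_hcn => hb.
have -> : \sum_i cmod (G (hbasis i) t r) ^+ 2 = \sum_i cmod (h i) ^+ 2.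
  by apply: eq_bigr => i _; rewrite /h cmod_conj.
apply: le_trans hb _; apply: ler_sum => p _.
by rewrite hnorm_hpower; apply: ler_sum => s _; rewrite hnorm_hscalar Gh.
Qed.

Variable X : cn k -> cn k.
Hypothesis bX : bounded_operator X.
Hypothesis momX : forall dl (I : finType) (z : 'I_k -> hpower I (cn k)), near_model E E dl z ->
  forall (x y : cn k), cmod (inner (ampl X (hlift z x)) (hlift z y) - inner (X x) y)
    <= dl * hl1 x * hl1 y.

(** The trace of the image of X^* X under the map represented by th. *)
Let mu (I : finType) (th : 'I_k -> hpower I (cn k)) : R := \sum_p hnorm (ampl X (th p)) ^+ 2.

(** Represents the composite of completely positive maps in which z acts before th. *)
Definition model_comp (I J : finType) (th : 'I_k -> hpower I (cn k)) (z : 'I_k -> hpower J (cn k)) :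
  'I_k -> hpower (I * J)%type (cn k) := fun p st => hlift z (th p st.1) st.2.

Lemma inner_model_comp (I J : finType) (th : 'I_k -> hpower I (cn k)) (z : 'I_k -> hpower J (cn k))
    (T T' : cn k -> cn k) p q :
  inner (ampl T (model_comp th z p)) (ampl T' (model_comp th z q)) =
  \sum_s inner (ampl T (hlift z (th p s))) (ampl T' (hlift z (th q s))).
Proof.
rewrite inner_hpower; under [RHS]eq_bigr do rewrite inner_hpower.
by rewrite [RHS]pair_bigA; apply: eq_bigr => -[s t] _ /=.
Qed.

(** The errors of z are amplified by a factor depending on th, so the tolerance of z has to be
    chosen after th. *)
Lemma near_model_comp (I : finType) (th : 'I_k -> hpower I (cn k)) (dl : R) :
  0 < dl -> near_model E E (dl / 2) th ->
  exists2 dl', 0 < dl' & forall (J : finType) (z : 'I_k -> hpower J (cn k)),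
    near_model E E dl' z -> near_model E E dl (model_comp th z).
Proof.
move=> dl_gt0 nm.
pose K := \sum_p \sum_q \sum_s hl1 (th p s) * hl1 (th q s).
have hK p q : \sum_s hl1 (th p s) * hl1 (th q s) <= K.
  rewrite /K (bigD1 p)//= (bigD1 q)//= -addrA lerDl addr_ge0//.
    by apply: sumr_ge0 => r _; apply: sumr_ge0 => s _; rewrite mulr_ge0 ?hl1_ge0.
  by apply: sumr_ge0 => r _; apply: sumr_ge0 => r' _; apply: sumr_ge0 => s _; rewrite mulr_ge0 ?hl1_ge0.
have K0 : 0 <= K.
  by apply: sumr_ge0 => r _; apply: sumr_ge0 => r' _; apply: sumr_ge0 => s _; rewrite mulr_ge0 ?hl1_ge0.
have K1 : 0 < K + 1 by rewrite ltr_wpDl.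
have d2 : 0 < dl / 2 by rewrite divr_gt0.
have dl'0 : 0 < dl / 2 / (K + 1) by rewrite divr_gt0.
exists (dl / 2 / (K + 1)) => // J z nz i p q.
have mom := near_model_moment (bE i) nz.
have -> : inner (ampl (E i) (model_comp th z p)) (model_comp th z q) =
    \sum_s inner (ampl (E i) (hlift z (th p s))) (hlift z (th q s)).
  exact: (inner_model_comp th z (E i) id p q).
have -> : \sum_s inner (ampl (E i) (hlift z (th p s))) (hlift z (th q s)) - inner (E i (hbasis p)) (hbasis q)
   = \sum_s (inner (ampl (E i) (hlift z (th p s))) (hlift z (th q s)) - inner (E i (th p s)) (th q s))
     + (inner (ampl (E i) (th p)) (th q) - inner (E i (hbasis p)) (hbasis q)).
  by rewrite sumrB inner_ampl addrA subrK.
apply: le_lt_trans (cmodD _ _) _; rewrite [ltRHS]splitr; apply: ler_ltD; last exact: nm.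
apply: le_trans (cmod_sum _ _ _) _.
apply: le_trans (ler_sum _ (fun s _ => mom (th p s) (th q s))) _.
apply: (@le_trans _ _ (dl / 2 / (K + 1) * K)).
  under eq_bigr do rewrite -mulrA.
  by rewrite -mulr_sumr ler_wpM2l// ltW.
by rewrite mulrAC ler_pdivrMr// ler_wpM2l ?(ltW d2)// lerDl.
Qed.

(** By Kadison-Schwarz, the map given by z sends X^* X above X^* X, up to O(dl), with gap G^* G for
    the defect G; applying th and taking traces keeps at least the fraction c of that gap. *)
Lemma mu_comp (I : finType) (th : 'I_k -> hpower I (cn k)) : near_model E E dl0 th ->
  exists2 K : R, 0 <= K & forall dl (J : finType) (z : 'I_k -> hpower J (cn k)), 0 < dl ->
    near_model E E dl z ->
    mu th + c * (\sum_q hnorm (defect (@ampl R J _ X) X z (hbasis q)) ^+ 2) - dl * K <= mu (model_comp th z).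
Proof.
move=> nm.
pose f (x : cn k) := 2 * ((hl1 x + hl1 (X x)) * hl1 (X x)) + hl1 (X x) * hl1 (X x).
have f0 x : 0 <= f x by rewrite /f addr_ge0 ?mulr_ge0 ?addr_ge0 ?hl1_ge0.
exists (\sum_p \sum_s f (th p s)).
  by apply: sumr_ge0 => p _; apply: sumr_ge0 => s _; exact: f0.
move=> dl J z dl_gt0 nz.
have bXJ := bounded_ampl J bX.
pose G (x : cn k) := defect (@ampl R J _ X) X z x.
have lG : linear G.
  move=> a x y; rewrite /G /defect (hlift_linear z) (bX.1 a) bXJ.1 (hlift_linear z) scalerBr.
  by rewrite opprD addrACA.
have hb := lower_bound_vector lG nm.
rewrite -addrA addrC -lerBrDr; apply: (@le_trans _ _ (\sum_p \sum_s hnorm (G (th p s)) ^+ 2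
   - dl * (\sum_p \sum_s f (th p s)))); first by rewrite lerD2r.
rewrite /mu mulr_sumr -!sumrB; apply: ler_sum => p _.
rewrite mulr_sumr -sumrB.
have -> : hnorm (ampl X (model_comp th z p)) ^+ 2 = \sum_s hnorm (ampl X (hlift z (th p s))) ^+ 2.
  apply: complexI; rewrite -inner_hnorm inner_model_comp rmorph_sum.
  by apply: eq_bigr => s _; rewrite inner_hnorm.
rewrite (hnorm_hpower (ampl X (th p))) -sumrB; apply: ler_sum => s _.
have := hnorm_defect (momX nz) (near_model_isometry E0 nz) (th p s).
rewrite -/(G _) -/(f _) ler_distl => /andP[h _].
move: h; rewrite -[ampl X (th p) s]/(X (th p s)).
by set a := hnorm _ ^+ 2; set b := hnorm _ ^+ 2; set e := hnorm _ ^+ 2; set g := dl * _ => *; lra.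
Qed.

(* Composing near models does not decrease [mu], and increases it by at least
   [c] times the defect; as [mu] is bounded, the defect must become small. *)
Lemma near_model_defect (e : R) : 0 < e -> exists2 dl, 0 < dl &
  forall (J : finType) (z : 'I_k -> hpower J (cn k)), near_model E E dl z ->
    \sum_q hnorm (defect (@ampl R J _ X) X z (hbasis q)) ^+ 2 < e.
Proof.
move=> e0; apply: contrapT => hn.
have {hn} hn dl : 0 < dl -> exists (J : finType) (z : 'I_k -> hpower J (cn k)), near_model E E dl z /\
    e <= \sum_q hnorm (defect (@ampl R J _ X) X z (hbasis q)) ^+ 2.
  move=> h; apply: contrapT => hn2; apply: hn; exists dl => // J z nz.
  by rewrite ltNge; apply/negP => h2; apply: hn2; exists J, z.
have ce : 0 < c * e / 2 by rewrite divr_gt0// mulr_gt0.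
(* Starting from the identity map, each composition gains c e by [mu_comp]; half of it absorbs the
   error dl2 K. The induction hypothesis is used at dl / 2 to leave room for the next factor. *)
have grow n : forall dl, 0 < dl -> dl <= dl0 -> exists (I : finType) (th : 'I_k -> hpower I (cn k)),
    near_model E E dl th /\ n%:R * (c * e / 2) <= mu th.
  elim: n => [|n IH] dl h hdl.
    exists unit, (fun p _ => hbasis p); split.
      move=> i p q; rewrite inner_ampl (big_pred1 tt); last by case.
      by rewrite subrr cmod0.
    by rewrite mul0r sumr_ge0// => p _; exact: sqr_ge0.
  have d2 : 0 < dl / 2 by rewrite divr_gt0.
  have d2' : dl / 2 <= dl by rewrite ler_pdivrMr// ler_pMr// ler1n.
  have [I [th [nm hmu]]] := IH _ d2 (le_trans d2' hdl).
  have [dl1 dl10 hcomp] := near_model_comp h nm.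
  have nm0 : near_model E E dl0 th by move=> i p q; apply: lt_le_trans (nm i p q) (le_trans d2' hdl).
  have [K K0 hK] := mu_comp nm0.
  have K1 : 0 < K + 1 by rewrite ltr_wpDl.
  pose dl2 := Order.min dl1 (c * e / 2 / (K + 1)).
  have dl20 : 0 < dl2 by rewrite lt_min dl10 divr_gt0.
  have [J [z [nz hz]]] := hn _ dl20.
  exists (I * J)%type, (model_comp th z); split.
    apply: hcomp => i p q; apply: lt_le_trans (nz i p q) _.
    by rewrite ge_min lexx.
  apply: le_trans (hK _ _ _ dl20 nz).
  have h3 : dl2 * K <= c * e / 2.
    apply: (@le_trans _ _ (c * e / 2 / (K + 1) * K)).
      by rewrite ler_wpM2r// ge_min lexx orbT.
    by rewrite mulrAC ler_pdivrMr// ler_wpM2l ?(ltW ce)// lerDl.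
  have h4 := ler_wpM2l (ltW c_gt0) hz.
  rewrite -natr1 mulrDl mul1r.
  by move: hmu h3 h4; set a := n%:R * _; set b := c * \sum_(_ < _) _; set g := dl2 * K; set q := c * e => *; lra.
have [B B0 hB] := bounded_opbound bX.
have bd (I : finType) (th : 'I_k -> hpower I (cn k)) : near_model E E dl0 th ->
    mu th <= B ^+ 2 * (k%:R * (1 + dl0)).
  move=> nm; rewrite /mu mulr_natl -[X in _ *+ X]card_ord -sumr_const mulr_sumr; apply: ler_sum => p _.
  apply: (@le_trans _ _ ((B * hnorm (th p)) ^+ 2)).
    by rewrite ler_sqr ?nnegrE ?mulr_ge0 ?hnorm_ge0//; exact: opbound_ampl.
  rewrite exprMn ler_wpM2l ?sqr_ge0//; exact: (near_model_norm E0 p E0 nm).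
pose M := B ^+ 2 * (k%:R * (1 + dl0)).
(* More steps than the bound on [mu] allows. *)
have [I [th [nm h]]] := grow (Num.truncn (M / (c * e / 2))).+1 _ dl0_gt0 (lexx _).
have := le_trans h (bd _ _ nm); rewrite leNgt -/M -ltr_pdivrMr//.
by rewrite truncnS_gt.
Qed.

End Rigidity.

Lemma finite_min (R : realType) (T : finType) (P : T -> R -> Prop) :
  (forall t (a b : R), 0 < a -> a <= b -> P t b -> P t a) ->
  (forall t, exists2 a, 0 < a & P t a) -> exists2 a, 0 < a & forall t, P t a.
Proof.
move=> mono hP.
have /choice [f hf] : forall t, exists a, 0 < a /\ P t a.
  by move=> t; have [a a0 Pa] := hP t; exists a.
(* The inverse of s is positive and below every f t, and it is also meaningful when T is empty. *)
pose s := 1 + \sum_t (f t)^-1.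
have f0 t : 0 <= (f t)^-1 by rewrite invr_ge0 ltW//; case: (hf t).
have s0 : 0 < s by rewrite ltr_wpDr// sumr_ge0.
exists s^-1; rewrite ?invr_gt0// => t; have [ft Pt] := hf t.
apply: mono Pt; rewrite ?invr_gt0// invf_ple ?posrE//.
by rewrite /s (bigD1 t)//= addrCA lerDl addr_ge0// sumr_ge0.
Qed.

(** * Approximate intertwining of two embeddings *)

Section ApproximateIntertwining.
Context {R : realType}.
Local Notation C := R[i].
Local Notation cn := (@hcn R).
Variables (d k : nat) (E E' : 'I_d -> cn k -> cn k) (i0 : 'I_d).
Hypothesis bE : forall i, bounded_operator (E i).
Hypothesis bE' : forall i, bounded_operator (E' i).
Hypothesis EE' : forall i, adjoint_of (E i) (E' i).
Hypothesis E0 : E i0 = id.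
Hypothesis rigid : ~ exists2 u : cn k, hnorm u = 1 & forall dl : R, 0 < dl ->
  exists (I : finType) (v : 'I_k -> hpower I (cn k)), near_model E E dl v /\
    forall p, hnorm (overlap (v p) u) <= dl.

Variables (L : hilbertType R) (S S' : 'I_d -> L -> L).
Hypothesis bS : forall i, bounded_operator (S i).
Hypothesis SS' : forall i, adjoint_of (S i) (S' i).
Hypothesis S0 : S i0 = id.
Hypotheses (domSE : mxdom S E) (domES : mxdom E S).

(** The boolean chooses between an operator and its adjoint, so that each estimate is proved once
    for both. *)
Let X (t : 'I_d * bool) := if t.2 then E t.1 else E' t.1.
Let Y (t : 'I_d * bool) := if t.2 then S t.1 else S' t.1.

Lemma near_model_mono (K : hilbertType R) (T : 'I_d -> K -> K) a b (I : finType)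
    (v : 'I_k -> hpower I K) : a <= b -> near_model T E a v -> near_model T E b v.
Proof. by move=> ab nm i p q; exact: lt_le_trans (nm i p q) ab. Qed.

Let momE t dl (I : finType) (z : 'I_k -> hpower I (cn k)) : near_model E E dl z ->
  forall (x y : cn k), cmod (inner (ampl (X t) (hlift z x)) (hlift z y) - inner (X t x) y)
    <= dl * hl1 x * hl1 y.
Proof.
move=> nm x y; case: t => i []; first exact: near_model_moment.
exact: (near_model_adjoint_moment bE (bE i) (EE' i) (EE' i)).
Qed.

Let momS t dl (I : finType) (v : 'I_k -> hpower I L) : near_model S E dl v ->
  forall (x y : cn k), cmod (inner (ampl (Y t) (hlift v x)) (hlift v y) - inner (X t x) y)
    <= dl * hl1 x * hl1 y.
Proof.
move=> nm x y; case: t => i []; first exact: near_model_moment.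
exact: (near_model_adjoint_moment bE (bS i) (SS' i) (EE' i)).
Qed.

Let bX t : bounded_operator (X t).
Proof. by case: t => i []; [exact: bE|exact: bE']. Qed.

(* Compose a near model S -> E with one E -> S: the composite has small defect
   by near_model_defect, and the Kadison-Schwarz inequality transfers this to
   the first factor. *)
Lemma approximate_intertwining (e : R) : 0 < e ->
  exists (I : finType) (v : 'I_k -> hpower I L), [/\ near_model S E e v,
    forall i p, hnorm (ampl (S i) (v p) - hlift v (E i (hbasis p))) < e &
    forall i p, hnorm (ampl (S' i) (v p) - hlift v (E' i (hbasis p))) < e].
Proof.
move=> e0.
have e4 : 0 < e ^+ 2 / 4 by rewrite divr_gt0// exprn_gt0.
have [c [dl0 [c0 dl00 lb]]] := near_model_lower_bound E0 rigid.
have [dl dl_gt0 hdl] : exists2 a, 0 < a & forall t (J : finType) (z : 'I_k -> hpower J (cn k)),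
    near_model E E a z -> \sum_q hnorm (defect (@ampl R J _ (X t)) (X t) z (hbasis q)) ^+ 2 < e ^+ 2 / 4.
  apply: finite_min => [t a b a0 ab h J z nm|t].
    by apply: h; exact: near_model_mono nm.
  exact: (near_model_defect bE E0 c0 dl00 lb (bX t) (momE t) e4).
pose f t (x : cn k) := 2 * ((hl1 x + hl1 (X t x)) * hl1 (X t x)) + hl1 (X t x) * hl1 (X t x).
have f0 t x : 0 <= f t x by rewrite /f addr_ge0 ?mulr_ge0 ?addr_ge0 ?hl1_ge0.
pose F := \sum_t \sum_p f t (hbasis p).
have fF t p : f t (hbasis p) <= F.
  rewrite /F (bigD1 t)//= (bigD1 p)//= -addrA lerDl addr_ge0//.
    by apply: sumr_ge0 => q _; exact: f0.
  by apply: sumr_ge0 => s _; apply: sumr_ge0 => q _; exact: f0.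
have F0 : 0 <= F by apply: sumr_ge0 => s _; apply: sumr_ge0 => q _; exact: f0.
have F1 : 0 < 3 + 3 * F by rewrite ltr_wpDr// mulr_ge0.
(* In the final estimate the squared defect is at most e^2 / 4 + d1 (3 + 3 F): three moment errors,
   and three errors of [hnorm_defect], each bounded by d1 F. *)
pose d1 := Order.min e (Order.min (dl / 2) (e ^+ 2 / 4 / (3 + 3 * F))).
have d10 : 0 < d1 by rewrite !lt_min e0 !divr_gt0// exprn_gt0.
have d1e : d1 <= e by rewrite ge_min lexx.
have d1dl : d1 + d1 <= dl by rewrite [leRHS]splitr; apply: lerD; rewrite !ge_min lexx ?orbT.
have d1F : d1 * (3 + 3 * F) <= e ^+ 2 / 4 by rewrite -ler_pdivlMr// !ge_min lexx ?orbT.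
pose y1 (p : 'I_k) : hpower unit (cn k) := fun _ => hbasis p.
have [I [v hv]] := mxdom_moments bS S0 E0 domSE y1 d10.
have nmv : near_model S E d1 v.
  move=> i p q; have := hv i p q; rewrite [inner (ampl (E i) (y1 p)) _]inner_ampl.
  by rewrite (big_pred1 tt)//; case.
(* The second map must record the images of the v_p under all Y t besides the v_p themselves, since
   inner products between the two kinds are compared below. *)
pose J : finType := ('I_k + ('I_d * bool) * 'I_k)%type.
pose y2 (j : J) : hpower I L := match j with inl p => v p | inr tp => ampl (Y tp.1) (v tp.2) end.
have [I' [z hz]] := mxdom_moments bE E0 S0 domES y2 d10.
pose z0 p := z (inl p).
have nmz2 : near_model E E (d1 + d1) z0.
  move=> i p q.
  have -> : inner (ampl (E i) (z0 p)) (z0 q) - inner (E i (hbasis p)) (hbasis q) =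
    (inner (ampl (E i) (z0 p)) (z0 q) - inner (ampl (S i) (v p)) (v q)) +
    (inner (ampl (S i) (v p)) (v q) - inner (E i (hbasis p)) (hbasis q)) by rewrite addrA subrK.
  apply: le_lt_trans (cmodD _ _) _; apply: ltrD; last exact: nmv.
  exact: (hz i (inl p) (inl q)).
have nmz : near_model E E dl z0 := near_model_mono d1dl nmz2.
have main t p : hnorm (ampl (Y t) (v p) - hlift v (X t (hbasis p))) < e.
  (* w is the copy of Y v_p in the power of C^k and A applies X to the copy of v_p. As |w|^2 and <A,
     w> are both close to |Y v_p|^2, expanding 0 <= |A - w|^2 gives |Y v_p|^2 <= |A|^2 up to errors,
     and rigidity gives |A|^2 <= |X e_p|^2 up to errors. The defect of v is squeezed between the
     two. *)
  pose yv := ampl (Y t) (v p); pose w := z (inr (t, p)); pose A := ampl (X t) (z0 p).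
  have a1 : hnorm w ^+ 2 <= hnorm yv ^+ 2 + d1.
    rewrite -lerBlDl -!rinner_hnorm /rinner -ReB.
    apply/ltW/(le_lt_trans (le_trans (ler_norm _) (cmod_Re _))).
    by have := hz i0 (inr (t, p)) (inr (t, p)); rewrite E0 S0.
  have a2 : hnorm yv ^+ 2 - d1 <= rinner A w.
    rewrite lerBlDl -lerBlDr -rinner_hnorm /rinner -ReB.
    apply/ltW/(le_lt_trans (le_trans (ler_norm _) (cmod_Re _))).
    rewrite -cmodN opprB /A /yv /w /X /Y; clear a1 yv w A; case: t => i [].
      exact: (hz i (inl p) (inr ((i, true), p))).
    have h := hz i (inr ((i, false), p)) (inl p).
    change (cmod (inner (ampl (E' i) (z0 p)) (z (inr ((i, false), p))) -
      inner (ampl (S' i) (v p)) (ampl (S' i) (v p))) < d1).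
    rewrite (adjoint_sym (adjoint_ampl (EE' i))) innerC.
    rewrite [X in _ - X](_ : _ = (inner (ampl (S i) (ampl (S' i) (v p))) (v p))^*%C).
      by rewrite -rmorphB cmod_conj.
    by rewrite (adjoint_ampl (SS' i)) -innerC.
  have a3 : hnorm A ^+ 2 <= e ^+ 2 / 4 + hnorm (X t (hbasis p)) ^+ 2 + (d1 + d1) * F.
    have := hnorm_defect (momE t nmz2) (near_model_isometry bE E0 E0 nmz2) (hbasis p).
    rewrite hlift_hbasis -/A -/(f t _) ler_distl => /andP[_ h]; apply: le_trans h _.
    apply: lerD; last by rewrite ler_wpM2l// addr_ge0// ltW.
    rewrite lerD2r; apply: le_trans (ltW (hdl t _ _ nmz)).
    by rewrite (bigD1 p)//= lerDl sumr_ge0// => q _; exact: sqr_ge0.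
  have a4 : hnorm (defect (@ampl R I _ (Y t)) (X t) v (hbasis p)) ^+ 2 + hnorm (X t (hbasis p)) ^+ 2
      <= hnorm yv ^+ 2 + d1 * F.
    have := hnorm_defect (momS t nmv) (near_model_isometry bE E0 S0 nmv) (hbasis p).
    rewrite hlift_hbasis -/yv -/(f t _) ler_distl => /andP[h _].
    by rewrite -lerBlDr; apply: le_trans h; rewrite lerD2l lerN2 ler_wpM2l// ltW.
  have a5 : 0 <= hnorm (A - w) ^+ 2 by exact: sqr_ge0.
  rewrite hnorm_sqrB in a5.
  rewrite /defect hlift_hbasis in a4.
  rewrite -ltr_sqr ?nnegrE ?hnorm_ge0 ?(ltW e0)//.
  have e5 : 0 < e ^+ 2 by rewrite exprn_gt0.
  move: a1 a2 a3 a4 a5 d1F e5; set q1 := hnorm w ^+ 2; set q2 := hnorm yv ^+ 2; set q3 := rinner _ _.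
  set q4 := hnorm A ^+ 2; set q5 := hnorm (X _ _) ^+ 2; set q6 := hnorm _ ^+ 2; set q7 := e ^+ 2 => *; nra.
exists I, v; split.
- exact: near_model_mono nmv.
- by move=> i p; exact: (main (i, true) p).
- by move=> i p; exact: (main (i, false) p).
Qed.

End ApproximateIntertwining.

(** * Finite-dimensional subspaces and algebras *)

Section GramSchmidt.
Context {R : realType} {Q : hilbertType R}.
Local Notation C := R[i].

Definition orthonormal_family (J : finType) (y : J -> Q) :=
  forall i j, inner (y i) (y j) = (i == j)%:R.

(** The x_i may be dependent, hence the separate index type: a zero residual leaves the family
    unchanged, a nonzero one is normalised and added as [None]. *)
Lemma gram_schmidt n (x : 'I_n -> Q) : exists (J : finType) (y : J -> Q),
  [/\ orthonormal_family y,
      forall j, exists c : 'I_n -> C, y j = \sum_i c i *: x i &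
      forall i, x i = \sum_j inner (x i) (y j) *: y j].
Proof.
elim: n x => [|n IH] x.
  by exists void, (fun j : void => match j with end); split; case.
have [J [y [oy yx xy]]] := IH (fun i => x (widen_ord (leqnSn n) i)).
pose z := x ord_max; pose r := z - \sum_j inner z (y j) *: y j.
have yx' j : exists c : 'I_n.+1 -> C, y j = \sum_i c i *: x i.
  have [c ->] := yx j; exists (fun i => if unlift ord_max i is Some i' then c i' else 0).
  rewrite big_ord_recr /= unlift_none scale0r addr0; apply: eq_bigr => i _.
  have -> : widen_ord (leqnSn n) i = lift ord_max i by apply: val_inj; rewrite /= /bump leqNgt ltn_ord.
  by rewrite liftK.
have ry j : inner r (y j) = 0.
  rewrite innerBl inner_suml (bigD1 j)//= innerZl oy eqxx mulr1 big1 ?addr0 ?subrr// => i ij.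
  by rewrite innerZl oy (negPf ij) mulr0.
have wid i (P : 'I_n.+1 -> Prop) : (forall i, P (widen_ord (leqnSn n) i)) -> P ord_max -> P i.
  move=> h1 h2; case: (unliftP ord_max i) => [j ->|->//].
  have -> : lift ord_max j = widen_ord (leqnSn n) j by apply: val_inj; rewrite /= /bump leqNgt ltn_ord.
  exact: h1.
have [r0|rn0] := eqVneq (hnorm r) 0.
  exists J, y; split=> // i; apply: (wid i (fun i => x i = \sum_j inner (x i) (y j) *: y j)) => //.
  by apply/eqP; rewrite -subr_eq0 -/z -/r (hnorm_eq0 r0).
pose a : C := ((hnorm r)^-1)%:C.
have aa : a * (hnorm r)%:C = 1 by rewrite -rmorphM mulVf.
have ac : a^*%C = a by rewrite conjc_real.
pose y' (o : option J) := if o is Some j then y j else a *: r.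
have rr : inner r r = (hnorm r)%:C * (hnorm r)%:C by rewrite inner_hnorm expr2 rmorphM.
exists (option J), y'; split.
- move=> [i|] [j|] /=; first by rewrite oy.
  + by rewrite innerZr innerC ry conjc0 mulr0.
  + by rewrite innerZl ry mulr0.
  + by rewrite innerZl innerZr ac rr mulrA mulrACA aa mulr1.
- move=> [j|] /=; first exact: yx'.
  have /choice [cc hcc] := yx'.
  exists (fun i => a * ((i == ord_max)%:R - \sum_j inner z (y j) * cc j i)).
  under eq_bigr do rewrite -scalerA scalerBl; rewrite -scaler_sumr; congr (_ *: _).
  rewrite sumrB (bigD1 ord_max)//= eqxx scale1r big1 ?addr0 => [|i /negPf ->]; last by rewrite scale0r.
  congr (_ - _); under [RHS]eq_bigr do rewrite scaler_suml.
  rewrite exchange_big; apply: eq_bigr => j _ /=.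
  transitivity (inner z (y j) *: \sum_i cc j i *: x i); first by rewrite -hcc.
  by rewrite scaler_sumr; apply: eq_bigr => i _; rewrite scalerA.
- have opt (F : option J -> Q) : \sum_o F o = F None + \sum_j F (Some j).
    rewrite (bigD1 None)//=; congr (_ + _).
    rewrite (reindex_omap Some id) /=; last by case.
    by apply: eq_bigl => j; rewrite eqxx.
  move=> i; rewrite opt /=.
  apply: (wid i (fun i => x i = inner (x i) (a *: r) *: (a *: r) + \sum_j inner (x i) (y j) *: y j)).
    move=> {}i; rewrite {2}(xy i) inner_suml big1 ?scale0r ?add0r// => j _.
    by rewrite innerZl innerZr (innerC (y j) r) ry conjc0 !mulr0.
  rewrite -/z.
  have -> : inner z (a *: r) = (hnorm r)%:C.
    have {1}-> : z = r + \sum_j inner z (y j) *: y j by rewrite subrK.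
    rewrite innerDl innerZr rr ac mulrA aa mul1r inner_suml big1 ?addr0// => j _.
    by rewrite innerZl innerZr (innerC (y j) r) ry conjc0 !mulr0.
  by rewrite scalerA mulrC aa scale1r subrK.
Qed.

Lemma gram_schmidt_ord n (x : 'I_n -> Q) : exists m (y : 'I_m -> Q),
  [/\ orthonormal_family y,
      forall j, exists c : 'I_n -> C, y j = \sum_i c i *: x i &
      forall i, x i = \sum_j inner (x i) (y j) *: y j].
Proof.
have [J [y [oy yx xy]]] := gram_schmidt x.
exists #|J|, (y \o enum_val); split.
- by move=> i j; rewrite /= oy (inj_eq enum_val_inj).
- by move=> j; exact: yx.
- move=> i; rewrite {1}(xy i) (reindex (@enum_val J predT))//.
  by apply: onW_bij; exact: enum_val_bij.
Qed.

End GramSchmidt.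

Section OrthonormalCoordinates.
Context {R : realType} {Q : hilbertType R}.
Local Notation C := R[i].
Local Notation cn := (@hcn R).

Definition coordinates k (y : 'I_k -> Q) (z : Q) : cn k := fun j => inner z (y j).

Lemma coordinates_linear k (y : 'I_k -> Q) : linear (coordinates y).
Proof. by move=> a z w; apply/funext => j; rewrite /coordinates innerDl innerZl. Qed.

Lemma inner_hlift k (y : 'I_k -> Q) (z : cn k) (w : Q) :
  inner (hlift y z) w = inner z (coordinates y w).
Proof.
rewrite /hlift inner_suml inner_hcn; apply: eq_bigr => j _.
by rewrite innerZl /coordinates -innerC.
Qed.

Lemma hliftK k (y : 'I_k -> Q) : orthonormal_family y -> cancel (hlift y) (coordinates y).
Proof.
move=> oy z; apply/funext => j; rewrite /coordinates /hlift inner_suml.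
under eq_bigr do rewrite innerZl oy.
rewrite (bigD1 j)// eqxx mulr1 big1 => [|i /andP[_ /negPf ij]].
  exact: (addr0 (z j : C)).
by rewrite ij mulr0.
Qed.

End OrthonormalCoordinates.

Section OrthogonalComplement.
Context {R : realType}.
Local Notation C := R[i].
Local Notation cn := (@hcn R).

(** V and W are the inclusion and the projection for an orthonormal basis of the complement of u,
    obtained by orthonormalising the projected basis vectors. The strict inequality comes from a
    comparison of traces. *)
Lemma orthocomplement k (u : cn k) : hnorm u = 1 ->
  exists k' (V : cn k' -> cn k) (W : cn k -> cn k'), (k' < k)%N /\
   [/\ linear V, linear W, forall (x : cn k') (y : cn k), inner (V x) y = inner x (W y),
      forall x : cn k', W (V x) = x & forall x : cn k, V (W x) = x - inner x u *: u].
Proof.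
move=> u1.
have uu : inner u u = 1 by rewrite inner_hnorm u1 expr1n.
pose x (p : 'I_k) := hbasis p - inner (hbasis p) u *: u.
have xu p : inner (x p) u = 0 by rewrite innerBl innerZl uu mulr1 subrr.
have [k' [y [oy yx xy]]] := gram_schmidt_ord x.
have yu j : inner (y j) u = 0.
  have [c ->] := yx j; rewrite inner_suml big1// => i _.
  by rewrite innerZl xu mulr0.
pose W : cn k -> cn k' := coordinates y.
have lW : linear W := @coordinates_linear _ _ _ y.
have VW := inner_hlift y.
have VWx (z : cn k) : hlift y (W z) = z - inner z u *: u.
  pose L1 (z : cn k) : cn k := z - inner z u *: u.
  have lL1 : linear L1.
    move=> a s t; rewrite /L1 innerDl innerZl scalerDl -scalerA scalerBr.
    by rewrite opprD addrACA.
  have lL2 : linear (hlift y \o W) by move=> a s t /=; rewrite lW hlift_linear.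
  rewrite -[LHS]/((hlift y \o W) z) -[RHS]/(L1 z) (linear_hlift z lL1) (linear_hlift z lL2).
  rewrite /hlift; apply: eq_bigr => p _; congr (_ *: _).
  rewrite /= /hlift /L1 -/(x p) [RHS]xy; apply: eq_bigr => j _; congr (_ *: _).
  by rewrite /W /x innerBl innerZl (innerC u) yu conjc0 mulr0 subr0.
exists k', (hlift y), W; split; last first.
  split=> //; first exact: hlift_linear.
  exact: hliftK.
(* The diagonal entry at p of V W + u u^* = 1. *)
have bessel p : \sum_j cmod (y j p) ^+ 2 + cmod (u p) ^+ 2 = 1.
  have h : inner (hlift y (W (hbasis p))) (hbasis p) = 1 - inner (hbasis p) u * inner u (hbasis p).
    by rewrite VWx innerBl innerZl inner_hnorm hnorm_hbasis expr1n.
  rewrite VW (innerC (hbasis p) u) mulJ_cmod inner_hbasis in h.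
  have -> : \sum_j cmod (y j p) ^+ 2 = hnorm (W (hbasis p)) ^+ 2.
    by rewrite hnorm_hcn; apply: eq_bigr => j _; rewrite /W /coordinates innerC cmod_conj inner_hbasis.
  by move: h; rewrite inner_hnorm => /(congr1 (@complex.Re R)) /= ->; rewrite subrK.
(* Summing the diagonal entries both ways: each of the k' vectors y_j, and u, contributes 1. *)
have tot : k'%:R + 1 = k%:R :> R.
  have : \sum_p (\sum_j cmod (y j p) ^+ 2 + cmod (u p) ^+ 2) = k%:R.
    by under eq_bigr do rewrite bessel; rewrite sumr_const card_ord.
  rewrite big_split /= -hnorm_hcn u1 expr1n exchange_big /= => <-; congr (_ + _).
  rewrite -[in LHS](card_ord k') -sumr_const; apply: eq_bigr => j _.
  by rewrite -hnorm_hcn; apply: complexI; rewrite -inner_hnorm oy eqxx.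
by rewrite -(ltr_nat R) -tot ltrDl.
Qed.

End OrthogonalComplement.

Section Subspaces.
Context {R : realType}.
Local Notation C := R[i].

Definition subspace (V : lmodType C) (S : set V) :=
  S 0 /\ forall (a : C) x y, S x -> S y -> S (a *: x + y).

Lemma subspaceD (V : lmodType C) (S : set V) x y : subspace S -> S x -> S y -> S (x + y).
Proof. by move=> [_ h] Sx Sy; rewrite -[x]scale1r; exact: h. Qed.

Lemma subspaceZ (V : lmodType C) (S : set V) (a : C) x : subspace S -> S x -> S (a *: x).
Proof. by move=> [S0 h] Sx; rewrite -[_ *: _]addr0; exact: h. Qed.

Lemma subspace_sum (V : lmodType C) (S : set V) (I : Type) (r : seq I) (F : I -> V) :
  subspace S -> (forall i, S (F i)) -> S (\sum_(i <- r) F i).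
Proof.
move=> hS hF; elim/big_ind: _ => [|x y|//]; first by case: hS.
exact: subspaceD.
Qed.

(** [finite_dimensional] asks for spanning vectors inside S, while the w_i may lie outside it; the
    induction eliminates the last of them. *)
Lemma subspace_finite_dimensional (V : lmodType C) n (w : 'I_n -> V) (S : set V) : subspace S ->
  (forall x, S x -> exists c : 'I_n -> C, x = \sum_i c i *: w i) -> finite_dimensional S.
Proof.
elim: n w S => [|n IH] w S hS hw.
  exists 0%N, w; split; first by case.
  exact: hw.
pose w' i := w (widen_ord (leqnSn n) i).
pose S' := [set x | S x /\ exists c : 'I_n -> C, x = \sum_i c i *: w' i].
have hS' : subspace S'.
  split.
    split; first by case: hS.
    by exists (fun _ => 0); rewrite big1// => i _; rewrite scale0r.
  move=> a x y [Sx [cx xE]] [Sy [cy yE]]; split; first exact: hS.2.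
  rewrite xE yE.
  exists (fun i => a * cx i + cy i); rewrite scaler_sumr -big_split; apply: eq_bigr => i _ /=.
  by rewrite scalerDl scalerA.
have [m [v [Sv hv]]] := IH w' S' hS' (fun x h => h.2).
(* x0 is a pivot: if it exists, subtracting a multiple of it removes the last w from any element of
   S; otherwise no element needs the last w. *)
have [[x0 [Sx0 [c0 [x0E c00]]]]|hn] := pselect (exists x0, S x0 /\ exists c : 'I_n.+1 -> C,
  x0 = \sum_i c i *: w i /\ c ord_max != 0); last first.
  exists m, v; split; first by move=> i; case: (Sv i).
  move=> x Sx; apply: hv; split=> //.
  have [c xE] := hw x Sx; exists (fun i => c (widen_ord (leqnSn n) i)).
  rewrite xE big_ord_recr /= [c ord_max](_ : _ = 0) ?scale0r ?addr0//.
  by apply/eqP/negPn/negP => cn0; apply: hn; exists x; split=> //; exists c.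
exists m.+1, (fun i => if unlift ord_max i is Some i' then v i' else x0); split.
  by move=> i; case: unliftP => [j _|_//]; case: (Sv j).
move=> x Sx; have [c xE] := hw x Sx.
pose t := c ord_max / c0 ord_max.
have [c' hc'] : exists c' : 'I_m -> C, x - t *: x0 = \sum_i c' i *: v i.
  apply: hv; split.
    by rewrite addrC -scaleNr; exact: hS.2.
  exists (fun i => c (widen_ord (leqnSn n) i) - t * c0 (widen_ord (leqnSn n) i)).
  rewrite xE x0E !big_ord_recr /= scalerDr scalerA mulfVK// opprD addrACA subrr addr0.
  rewrite scaler_sumr -sumrB; apply: eq_bigr => i _.
  by rewrite scalerBl scalerA.
exists (fun i => if unlift ord_max i is Some i' then c' i' else t).
rewrite big_ord_recr /= unlift_none -[LHS](subrK (t *: x0)) hc'; congr (_ + _).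
apply: eq_bigr => i _.
have -> : widen_ord (leqnSn m) i = lift ord_max i by apply: val_inj; rewrite /= /bump leqNgt ltn_ord.
by rewrite liftK.
Qed.

(** Let h separate the span of all b_i but the last. An operator of the full span that vanishes on h
    is determined by its last coefficient, so all of these are multiples of one T c0, and a single
    further vector x with T c0 x <> 0 separates them. *)
Lemma separating_vectors (H : hilbertType R) n (b : 'I_n -> H -> H) :
  exists m (h : 'I_m -> H), forall c : 'I_n -> C,
    (forall s, (\sum_i c i *: b i) (h s) = 0) -> \sum_i c i *: b i = 0.
Proof.
elim: n b => [|n IH] b; first by exists 0%N, (fun _ => 0) => c _; rewrite big_ord0.
pose b' i := b (widen_ord (leqnSn n) i).
have [m [h hh]] := IH b'.
pose T (c : 'I_n.+1 -> C) := \sum_i c i *: b i.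
have T0 c : c ord_max = 0 -> (forall s, T c (h s) = 0) -> T c = 0.
  move=> c0; have TE : T c = \sum_i c (widen_ord (leqnSn n) i) *: b' i.
    by rewrite /T big_ord_recr /= c0 scale0r addr0.
  by rewrite TE; exact: hh.
have [[c0 [h0 [x hx]]]|hn] := pselect (exists c0, (forall s, T c0 (h s) = 0) /\ exists x, T c0 x != 0); last first.
  exists m, h => c hc; apply/funext => x; apply/eqP/negPn/negP => cx.
  by apply: hn; exists c; split=> //; exists x.
exists m.+1, (fun i => if unlift ord_max i is Some i' then h i' else x) => c hc.
have hc1 s : T c (h s) = 0 by have := hc (lift ord_max s); rewrite liftK.
have hc2 : T c x = 0 by have := hc ord_max; rewrite unlift_none.
have c0n : c0 ord_max != 0.
  by apply: contra_neq hx => h1; rewrite (T0 _ h1 h0).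
pose t := c ord_max / c0 ord_max.
have Tlin : T (fun i => c i - t * c0 i) = T c - t *: T c0.
  rewrite /T scaler_sumr -sumrB; apply: eq_bigr => i _.
  by rewrite scalerBl scalerA.
have : T (fun i => c i - t * c0 i) = 0.
  apply: T0; first by rewrite /t mulfVK// subrr.
  by move=> s; rewrite Tlin -[LHS]/(T c (h s) - t *: T c0 (h s)) hc1 h0 scaler0 subrr.
rewrite Tlin => /eqP; rewrite subr_eq0 => /eqP TE.
have := hc2; rewrite TE -[LHS]/(t *: T c0 x) => /eqP; rewrite scaler_eq0 (negPf hx) orbF => /eqP t0.
by rewrite -/(T c) TE t0 scale0r.
Qed.

End Subspaces.

Section AlgebraFacts.
Context {R : realType}.
Local Notation C := R[i].
Local Notation cn := (@hcn R).
Implicit Types H K L : hilbertType R.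

Lemma operator_algebra_subspace H (A : set (H -> H)) : operator_algebra A -> subspace A.
Proof. by case=> _ A0 hA _ _; split. Qed.

Lemma linear_on_sum H K (A : set (H -> H)) (phi : (H -> H) -> K -> K) : subspace A ->
  linear_on A phi -> forall n (c : 'I_n -> C) (b : 'I_n -> H -> H), (forall i, A (b i)) ->
  phi (\sum_i c i *: b i) = \sum_i c i *: phi (b i).
Proof.
move=> hA lin.
have p0 : phi 0 = 0.
  have := lin 1 0 0 hA.1 hA.1; rewrite !scale1r addr0 => h.
  by apply: (addrI (phi 0)); rewrite -h addr0.
elim=> [|n IH] c b Ab; first by rewrite !big_ord0.
rewrite !big_ord_recl lin ?IH//.
by apply: subspace_sum => // i; exact: subspaceZ.
Qed.

Lemma opbound_opnorm H K (T : H -> K) (M : R) : bounded_operator T -> 0 <= M ->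
  opnorm T <= M -> opbound T M.
Proof.
move=> bT M0 h x; apply: le_trans (opnorm_bound bT x) _.
by rewrite ler_wpM2r ?hnorm_ge0.
Qed.

(** A matrix combination of the phi(b_i) is the entrywise image of the same combination of the b_i,
    so equality of norms is domination in both directions. *)
Lemma uci_mxdom H K (A : set (H -> H)) (phi : (H -> H) -> K -> K) d (b : 'I_d -> H -> H) :
  A `<=` bounded_operator -> subspace A -> (forall i, A (b i)) -> unital_complete_isometry A phi ->
  mxdom b (phi \o b) /\ mxdom (phi \o b) b.
Proof.
move=> Ab hA bA [pb lin _ ci].
have E n (c : 'I_d -> 'M[C]_n) : map_mx phi (mxcomb c b) = mxcomb c (phi \o b).
  apply/matrixP => i j; rewrite !mxE; exact: (linear_on_sum hA lin).
have mA n (c : 'I_d -> 'M[C]_n) i j : A (mxcomb c b i j).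
  by rewrite mxE; apply: subspace_sum => // l; exact: subspaceZ.
have bb n (c : 'I_d -> 'M[C]_n) : bounded_operator (mxop (mxcomb c b)).
  by apply: bounded_mxcomb => i; exact: Ab.
have bp n (c : 'I_d -> 'M[C]_n) : bounded_operator (mxop (mxcomb c (phi \o b))).
  by apply: bounded_mxcomb => i; exact: pb.
have N n (c : 'I_d -> 'M[C]_n) : opnorm (mxop (mxcomb c (phi \o b))) = opnorm (mxop (mxcomb c b)).
  by rewrite -!mxopnormE -E ci.
split=> n c M M0 h; apply: opbound_opnorm => //.
  by rewrite N; exact: opnorm_le.
by rewrite -N; exact: opnorm_le.
Qed.

Lemma mxdom_trans d H K L (S : 'I_d -> H -> H) (T : 'I_d -> K -> K) (U : 'I_d -> L -> L) :
  mxdom S T -> mxdom T U -> mxdom S U.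
Proof. by move=> h1 h2 n c M M0 h; apply: h2 => //; exact: h1. Qed.

Lemma adjoint_uniq H (T S S' : H -> H) : adjoint_of T S -> adjoint_of T S' -> S = S'.
Proof.
move=> h h'; apply/funext => y; apply: inner_eq => z.
by rewrite innerC -h h' -innerC.
Qed.

Lemma adjointP H (a : C) (S T S' T' : H -> H) : adjoint_of S S' -> adjoint_of T T' ->
  adjoint_of (a *: S + T) (a^*%C *: S' + T').
Proof.
move=> hS hT x y.
rewrite -[(a *: S + T) x]/(a *: S x + T x) -[(a^*%C *: S' + T') y]/(a^*%C *: S' y + T' y).
by rewrite innerDl innerDr innerZl innerZr hS hT conjcK.
Qed.

Lemma adjointM H (S T S' T' : H -> H) : adjoint_of S S' -> adjoint_of T T' ->
  adjoint_of (S \o T) (T' \o S').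
Proof. by move=> hS hT x y /=; rewrite hS hT. Qed.

Lemma opbound_adjoint H (T T' : H -> H) (M : R) : adjoint_of T T' -> 0 <= M ->
  opbound T M -> opbound T' M.
Proof.
move=> h M0 hM y.
have [S0|Sn0] := eqVneq (hnorm (T' y)) 0.
  by rewrite S0 mulr_ge0 ?hnorm_ge0.
have Sp : 0 < hnorm (T' y) by rewrite lt_def Sn0 hnorm_ge0.
rewrite -(ler_pM2l Sp) -expr2 -rinner_hnorm /rinner -h.
apply: (le_trans (rinner_CS _ _)); rewrite mulrA ler_wpM2r ?hnorm_ge0//.
by rewrite mulrC.
Qed.

Lemma bounded_cstar H : cstar_algebra (@bounded_operator R H H).
Proof.
split; last by [].
split=> //; first exact: bounded0.
- by move=> a S T; exact: bounded_operatorP.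
- by move=> S T; exact: bounded_comp.
Qed.

Lemma cstar_generated_cstar H (S : set (H -> H)) : S `<=` bounded_operator ->
  cstar_algebra (cstar_generated S).
Proof.
move=> Sb; split; last first.
  move=> T T' hT bT' adj M [hM SM]; apply: (hM.2 T) => //; exact: hT.
split.
- by move=> T /(_ _ (conj (@bounded_cstar H) Sb)).
- by move=> M [[[_ ? _ _ _] _] _].
- by move=> a T U hT hU M [hM SM]; case: (hM) => [[_ _ h _ _] _]; apply: h; [exact: hT|exact: hU].
- by move=> T U hT hU M [hM SM]; case: (hM) => [[_ _ _ h _] _]; apply: h; [exact: hT|exact: hU].
- move=> T bT h M [hM SM]; case: (hM) => [[_ _ _ _ cl] _]; apply: cl => // e e0.
  by have [U hU hTU] := h e e0; exists U => //; exact: hU.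
Qed.

Lemma cstar_generated_sub H (S M : set (H -> H)) : cstar_algebra M -> S `<=` M ->
  cstar_generated S `<=` M.
Proof. by move=> hM SM T; exact. Qed.

Lemma sub_cstar_generated H (S : set (H -> H)) : S `<=` cstar_generated S.
Proof. by move=> T ST M [_]; exact. Qed.

Lemma hcn_operators_finite k (S : set (cn k -> cn k)) : S `<=` bounded_operator -> subspace S ->
  finite_dimensional S.
Proof.
move=> Sb hS.
pose J : finType := ('I_k * 'I_k)%type.
(* The matrix units of C^k. *)
pose w (i : 'I_#|J|) : cn k -> cn k := fun x => (x (enum_val i).1 : C) *: hbasis (enum_val i).2.
apply: (subspace_finite_dimensional (w := w)) => // T /Sb [lT _].
exists (fun i => T (hbasis (enum_val i).1) (enum_val i).2); apply/funext => x.
rewrite fct_sumx (linear_hlift x lT) /hlift.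
rewrite -(reindex (@enum_val J predT) (P := xpredT) (F := fun p : J =>
   (T (hbasis p.1) p.2 : C) *: ((x p.1 : C) *: hbasis p.2))) /=; last first.
  by apply: onW_bij; exact: enum_val_bij.
rewrite -(pair_bigA _ (fun p q => (T (hbasis p) q : C) *: ((x p : C) *: hbasis q))) /=.
apply: eq_bigr => p _; rewrite -[in LHS](hlift_hbasisE (T (hbasis p))) /hlift scaler_sumr.
by apply: eq_bigr => q _; rewrite !scalerA mulrC.
Qed.

End AlgebraFacts.

(** * Rigidity from minimality of the dimension *)

Section Envelope.
Context {R : realType}.
Local Notation C := R[i].
Local Notation cn := (@hcn R).

Lemma mxdom_opnorm d (H K : hilbertType R) (S : 'I_d -> H -> H) (T : 'I_d -> K -> K) n (c : 'I_d -> 'M[C]_n) :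
  (forall i, bounded_operator (S i)) -> mxdom S T ->
  opnorm (mxop (mxcomb c T)) <= opnorm (mxop (mxcomb c S)).
Proof.
move=> bS dom; have bc := bounded_mxcomb c bS.
apply: opnorm_le; first exact: opnorm_ge0.
by apply: dom; [exact: opnorm_ge0|exact: opnorm_bound].
Qed.

Lemma mxdom_compression d k k' (E : 'I_d -> cn k -> cn k) (V : cn k' -> cn k) (W : cn k -> cn k') :
  linear W -> (forall (x : cn k') (y : cn k), inner (V x) y = inner x (W y)) ->
  (forall x : cn k', W (V x) = x) -> mxdom E (fun i => W \o E i \o V).
Proof.
move=> lW VW WK n c M M0 hM x.
have hV := hnorm_isometry VW WK; have hW := hnorm_coisometry VW WK.
pose Vx : hpower 'I_n (cn k) := fun a => V (x a).
have XE a : mxop (mxcomb c (fun i => W \o E i \o V)) x a = W (mxop (mxcomb c E) Vx a).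
  rewrite !mxop_comb (linearf_sum lW); apply: eq_bigr => l _.
  by rewrite (linearf_sum lW); apply: eq_bigr => i _; rewrite linearfZ.
have -> : hnorm x = hnorm Vx.
  apply/eqP; rewrite -(@eqrXn2 _ 2) ?hnorm_ge0// !hnorm_hpower.
  by apply/eqP; apply: eq_bigr => a _; rewrite hV.
apply: le_trans (hM Vx).
rewrite -ler_sqr ?nnegrE ?hnorm_ge0// !hnorm_hpower; apply: ler_sum => a _.
by rewrite XE ler_sqr ?nnegrE ?hnorm_ge0.
Qed.

Variables (H : hilbertType R) (G : set (H -> H)) (d : nat) (b : 'I_d -> H -> H) (i0 : 'I_d).
Hypothesis hG : operator_algebra G.
Hypothesis Gb : forall i, G (b i).
Hypothesis b0 : b i0 = id.
Hypothesis span : forall T, G T -> exists c : 'I_d -> C, T = \sum_i c i *: b i.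

Let Gs : subspace G := operator_algebra_subspace hG.
Let Gbd : G `<=` bounded_operator. Proof. by case: hG. Qed.

(** Compression never increases matrix norms, and by [compression_dom] a vector u as described would
    keep it from decreasing them. Compressing eps to the complement of u would then give a unital
    complete isometry into smaller matrices. *)
Lemma minimal_rigid k (eps : (H -> H) -> cn k -> cn k) : unital_complete_isometry G eps ->
  (forall k' (eps' : (H -> H) -> cn k' -> cn k'), unital_complete_isometry G eps' -> (k <= k')%N) ->
  ~ exists2 u : cn k, hnorm u = 1 & forall dl : R, 0 < dl ->
    exists (I : finType) (v : 'I_k -> hpower I (cn k)), near_model (eps \o b) (eps \o b) dl v /\
      forall p, hnorm (overlap (v p) u) <= dl.
Proof.
move=> uci kmin [u u1 models]; have [be lin e1 ci] := uci.
have [k' [V [W [k'k [lV lW VW WK VWE]]]]] := orthocomplement u1.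
pose E i := eps (b i).
have bE i : bounded_operator (E i) by apply: be.
have E0 : E i0 = id by rewrite /E b0.
have bV := bounded_linear lV; have bW := bounded_linear lW.
have dom1 := mxdom_compression (E := E) lW VW WK.
have dom2 : mxdom (fun i => W \o E i \o V) E := compression_dom bE E0 VW WK VWE u1 models.
suff uci' : unital_complete_isometry G (fun T => W \o eps T \o V).
  by have := kmin _ _ uci'; rewrite leqNgt k'k.
split.
- by move=> T GT; apply: bounded_comp bV; apply: bounded_comp bW _; exact: be.
- move=> a S T GS GT; rewrite lin//; apply/funext => x.
  rewrite -[RHS]/(a *: W (eps S (V x)) + W (eps T (V x))) -[LHS]/(W (a *: eps S (V x) + eps T (V x))).
  exact: lW.
- by rewrite e1; apply/funext => x /=; exact: WK.
- move=> n T GT.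
  have /choice [c hc] : forall p : 'I_n * 'I_n, exists c : 'I_d -> C, T p.1 p.2 = \sum_i c i *: b i.
    by move=> p; apply: span; exact: GT.
  pose cc i : 'M[C]_n := \matrix_(x, y) c (x, y) i.
  have TE : T = mxcomb cc b.
    apply/matrixP => x y; rewrite mxE (hc (x, y)); apply: eq_bigr => i _.
    by rewrite mxE.
  have T1 : map_mx eps T = mxcomb cc E.
    by apply/matrixP => x y; rewrite TE !mxE; exact: (linear_on_sum Gs lin).
  have T2 : map_mx (fun T => W \o eps T \o V) T = mxcomb cc (fun i => W \o E i \o V).
    apply/matrixP => x y.
    have -> : map_mx (fun T => W \o eps T \o V) T x y = W \o map_mx eps T x y \o V by rewrite !mxE.
    rewrite T1 !mxE; apply/funext => z.
    rewrite fct_sumx /= fct_sumx (linearf_sum lW); apply: eq_bigr => i _.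
    by rewrite -[LHS]/(W (cc i x y *: E i (V z))) linearfZ.
  rewrite -ci// T1 T2 !mxopnormE; apply/eqP; rewrite eq_le !mxdom_opnorm// => i.
  by apply: bounded_comp bV; apply: bounded_comp bW _.
Qed.

End Envelope.

(** * The C*-envelope of a matricial algebra *)

Lemma adjointB (R : realType) (H : hilbertType R) (S T S' T' : H -> H) :
  adjoint_of S S' -> adjoint_of T T' -> adjoint_of (S - T) (S' - T').
Proof.
move=> hS hT x y; rewrite -[(S - T) x]/(S x - T x) -[(S' - T') y]/(S' y - T' y).
by rewrite innerBl innerBr hS hT.
Qed.

Section Homomorphism.
Context {R : realType}.
Local Notation C := R[i].
Local Notation cn := (@hcn R).
Variables (k : nat) (L : hilbertType R).
Variable I : nat -> finType.
Variable v : forall j, 'I_k -> hpower (I j) L.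
Arguments v : clear implicits.
Hypothesis v2 : forall j p, hnorm (v j p) <= 2.
Hypothesis v_isom : forall e : R, 0 < e -> exists N, forall j, (N <= j)%N ->
  forall (x y : cn k), cmod (inner (hlift (v j) x) (hlift (v j) y) - inner x y) <= e * hl1 x * hl1 y.

(* A concrete form of the *-homomorphism sought: T is sent to m when the
   asymptotically isometric maps [hlift (v j)] asymptotically intertwine m
   with the amplification of T. *)
Definition asymptotic (T : L -> L) (m : cn k -> cn k) := forall e : R, 0 < e ->
  exists N, forall j, (N <= j)%N -> forall p,
    hnorm (ampl T (v j p) - hlift (v j) (m (hbasis p))) <= e.

Let hnorm_hlift j (x : cn k) : hnorm (hlift (v j) x) <= 2 * hl1 x.
Proof.
apply: le_trans (hnorm_sum _ _ _) _; rewrite /hl1 mulr_sumr; apply: ler_sum => p _.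
by rewrite hnormZ mulrC ler_wpM2r ?cmod_ge0.
Qed.

Let hlift_norm (x : cn k) (e : R) : 0 < e -> exists N, forall j, (N <= j)%N ->
  `|hnorm (hlift (v j) x) - hnorm x| <= e.
Proof.
move=> e0; have c0 : 0 < hl1 x * hl1 x + 1 by rewrite ltr_wpDl// mulr_ge0 ?hl1_ge0.
have [N hN] := v_isom (divr_gt0 (exprn_gt0 2 e0) c0); exists N => j hj.
have h : `|hnorm (hlift (v j) x) ^+ 2 - hnorm x ^+ 2| <= e ^+ 2.
  rewrite -!rinner_hnorm /rinner -ReB; apply: le_trans (cmod_Re _) _.
  apply: le_trans (hN j hj x x) _; rewrite -mulrA mulrAC ler_pdivrMr//.
  by rewrite ler_wpM2l ?sqr_ge0// lerDl.
rewrite -ler_sqr ?nnegrE ?(ltW e0)//; apply: le_trans h.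
rewrite subr_sqr normrM expr2 ler_wpM2l// [leRHS]ger0_norm ?addr_ge0 ?hnorm_ge0//.
by apply: le_trans (ler_normB _ _) _; rewrite !ger0_norm ?hnorm_ge0.
Qed.

Lemma asymptotic_vec T m (x : cn k) (e : R) : linear T -> linear m -> asymptotic T m -> 0 < e ->
  exists N, forall j, (N <= j)%N -> hnorm (ampl T (hlift (v j) x) - hlift (v j) (m x)) <= e.
Proof.
move=> lT lm as_ e0; have c0 : 0 < hl1 x + 1 by rewrite ltr_wpDl ?hl1_ge0.
have [N hN] := as_ _ (divr_gt0 e0 c0); exists N => j hj.
have -> : ampl T (hlift (v j) x) - hlift (v j) (m x)
    = \sum_p (x p : C) *: (ampl T (v j p) - hlift (v j) (m (hbasis p))).
  have -> : ampl T (hlift (v j) x) = \sum_p (x p : C) *: ampl T (v j p).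
    apply/funext => s; rewrite /ampl /hlift !hpower_sumE (linearf_sum lT).
    by apply: eq_bigr => p _; rewrite -[LHS]/(T ((x p : C) *: v j p s)) linearfZ.
  have -> : hlift (v j) (m x) = \sum_p (x p : C) *: hlift (v j) (m (hbasis p)).
    rewrite (linear_hlift x lm) {2}/hlift (linearf_sum (hlift_linear (v j))).
    by apply: eq_bigr => p _; rewrite (linearfZ (hlift_linear (v j))).
  by rewrite -sumrB; apply: eq_bigr => p _; rewrite scalerBr.
apply: le_trans (hnorm_sum _ _ _) _.
apply: (@le_trans _ _ (e / (hl1 x + 1) * hl1 x)).
  rewrite /hl1 mulr_sumr; apply: ler_sum => p _; rewrite hnormZ mulrC.
  by rewrite ler_wpM2r ?cmod_ge0//; exact: hN.
by rewrite mulrAC ler_pdivrMr// ler_wpM2l ?(ltW e0)// lerDl.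
Qed.

(** The maps [hlift (v j)] are almost isometric, so norm bounds on T pass to m. This makes the
    correspondence single-valued and continuous. *)
Lemma asymptotic_opbound T m (M : R) : linear T -> linear m -> asymptotic T m -> 0 <= M ->
  opbound T M -> opbound m M.
Proof.
move=> lT lm as_ M0 hM x; apply/ler_addgt0Pr => e e0.
(* Two errors count once, the intertwining and the norm of the lift of m x; the norm of the lift of
   x is multiplied by M. *)
have c0 : 0 < 2 + M by rewrite ltr_pwDl.
have e1 : 0 < e / (2 + M) by rewrite divr_gt0.
have [N1 hN1] := asymptotic_vec x lT lm as_ e1.
have [N2 hN2] := hlift_norm x e1; have [N3 hN3] := hlift_norm (m x) e1.
pose j := maxn N1 (maxn N2 N3).
have := hN1 j (leq_maxl _ _).
have h2 : `|hnorm (hlift (v j) x) - hnorm x| <= e / (2 + M).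
  by apply: hN2; rewrite /j leq_max leq_max leqnn orbT.
have h3 : `|hnorm (hlift (v j) (m x)) - hnorm (m x)| <= e / (2 + M).
  by apply: hN3; rewrite /j !leq_max leqnn !orbT.
have h4 := opbound_ampl (I := I j) M0 hM (hlift (v j) x).
have h5 := hnorm_triB (hlift (v j) (m x)) (ampl T (hlift (v j) x)) 0.
rewrite !subr0 hnormBC in h5.
move: h2 h3; rewrite !ler_norml => /andP[_ h2] /andP[h3 _].
have h6 : M * hnorm (hlift (v j) x) <= M * (hnorm x + e / (2 + M)).
  by rewrite ler_wpM2l// -lerBlDl.
have h7 : e = 2 * (e / (2 + M)) + M * (e / (2 + M)) by rewrite -mulrDl mulrC mulfVK ?gt_eqF.
move: h3 h4 h5 h6 h7; rewrite mulrDr.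
set a := hnorm _; set b := hnorm _; set f := hnorm (hlift _ x).
set g := e / _; move: (M * f) (M * hnorm x) (M * g) => *; lra.
Qed.

(** A relation rather than a map: C*(phi(G)) has no explicit description on which a map could be
    defined beforehand. *)
Definition implemented (T : L -> L) (m : cn k -> cn k) :=
  [/\ bounded_operator T, bounded_operator m & asymptotic T m].

Lemma implementedP (a : C) S T m n : implemented S m -> implemented T n ->
  implemented (a *: S + T) (a *: m + n).
Proof.
move=> [bS bm am] [bT bn an]; split; try exact: bounded_operatorP.
move=> e e0; have c0 : 0 < cmod a + 1 by rewrite ltr_wpDl ?cmod_ge0.
have e1 : 0 < e / (cmod a + 1) by rewrite divr_gt0.
have [N1 hN1] := am _ e1; have [N2 hN2] := an _ e1; exists (maxn N1 N2) => j.
rewrite geq_max => /andP[/hN1 h1 /hN2 h2] p.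
have -> : ampl (a *: S + T) (v j p) - hlift (v j) ((a *: m + n) (hbasis p)) =
   a *: (ampl S (v j p) - hlift (v j) (m (hbasis p))) + (ampl T (v j p) - hlift (v j) (n (hbasis p))).
  rewrite -[(a *: m + n) _]/(a *: m (hbasis p) + n (hbasis p)) hlift_linear scalerBr.
  by rewrite opprD addrACA.
apply: le_trans (hnormD _ _) _; rewrite hnormZ.
have -> : e = cmod a * (e / (cmod a + 1)) + e / (cmod a + 1).
  by rewrite -[X in _ + X]mul1r -mulrDl mulrC mulfVK ?gt_eqF.
by apply: lerD => //; rewrite ler_wpM2l ?cmod_ge0.
Qed.

Lemma implemented0 : implemented 0 0.
Proof.
split; try exact: bounded0.
move=> e e0; exists 0%N => j _ p.
have -> : ampl (0 : L -> L) (v j p) - hlift (v j) ((0 : cn k -> cn k) (hbasis p)) = 0.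
  by rewrite -[(0 : cn k -> cn k) _]/(0 : cn k) (linearf0 (hlift_linear _)) subr0.
by rewrite hnorm0 ltW.
Qed.

Lemma implementedM S T m n : implemented S m -> implemented T n -> implemented (S \o T) (m \o n).
Proof.
move=> [bS bm am] [bT bn an]; split; try exact: bounded_comp.
move=> e e0; have [M M0 hM] := bounded_opbound bS.
have c0 : 0 < M + 1 by rewrite ltr_wpDl.
have e1 : 0 < e / (M + 1) by rewrite divr_gt0.
have [N1 hN1] := an _ e1.
have [N2 hN2] : exists N, forall j, (N <= j)%N -> forall p,
    hnorm (ampl S (hlift (v j) (n (hbasis p))) - hlift (v j) (m (n (hbasis p)))) <= e / (M + 1).
  have := @eventually_fin 'I_k (fun p j => hnorm (ampl S (hlift (v j) (n (hbasis p))) -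
     hlift (v j) (m (n (hbasis p)))) <= e / (M + 1)); apply => p.
  by apply: asymptotic_vec => //; [exact: bS.1|exact: bm.1].
exists (maxn N1 N2) => j; rewrite geq_max => /andP[/hN1 h1 /hN2 h2] p.
apply: le_trans (hnorm_triB _ (ampl S (hlift (v j) (n (hbasis p)))) _) _.
have -> : e = M * (e / (M + 1)) + e / (M + 1).
  by rewrite -[X in _ + X]mul1r -mulrDl mulrC mulfVK ?gt_eqF.
apply: lerD; last exact: h2.
rewrite -[ampl (S \o T) _]/(ampl S (ampl T (v j p))) -(linearfB (bounded_ampl (I j) bS).1).
by apply: le_trans (opbound_ampl M0 hM _) _; rewrite ler_wpM2l//; exact: h1.
Qed.

(** m - n corresponds to T - T = 0, so the norm bound with M = 0 applies. *)
Lemma implemented_uniq T m n : implemented T m -> implemented T n -> m = n.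
Proof.
move=> hm hn; have [bT bm _] := hm; have [_ bn _] := hn.
have [bTT bmn a0] := implementedP (-1) hm hn.
have h0 : opbound (-1 *: T + T) 0.
  by move=> x; rewrite scaleN1r addNr mul0r -[(0 : L -> L) x]/(0 : L) hnorm0.
have := asymptotic_opbound bTT.1 bmn.1 a0 (lexx _) h0.
rewrite scaleN1r => h; apply/funext => x.
have := h x; rewrite mul0r => hx; apply/eqP; rewrite eq_sym -subr_eq0; apply/eqP/hnorm_eq0/eqP.
rewrite eq_le hnorm_ge0 andbT.
by rewrite -[n x - m x]addrC.
Qed.

Variable Cs : set (cn k -> cn k).
Hypothesis CsC : cstar_algebra Cs.

(** Intertwining T does not by itself intertwine the adjoint of T, so both are demanded, with
    mutually adjoint partners in Cs. The set is a C*-algebra, and containing phi(G) it then contains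
    C*(phi(G)). *)
Definition star_implemented : set (L -> L) := [set T | exists m T' m',
  [/\ implemented T m /\ implemented T' m', adjoint_of T T', adjoint_of m m', Cs m & Cs m']].

(** If S_n tends to T, the partners m_n are Cauchy because m_n - m_l is the partner of S_n - S_l and
    obeys the same norm bound; their limit is the partner of T. *)
Lemma star_implemented_closed : norm_closed star_implemented.
Proof.
have [[Cb C0 CP CM Ccl] Cstar] := CsC.
move=> T bT hT.
have /choice [S hS] : forall n : nat, exists S, star_implemented S /\ opbound (T - S) n.+1%:R^-1.
  move=> n; have n0 : 0 < n.+1%:R^-1 :> R by rewrite invr_gt0.
  have [S aS hS] := hT _ n0; exists S; split=> //.
  apply: opbound_opnorm; [|exact: ltW|exact: ltW].
  by apply: boundedB bT; case: aS => [m [T' [m' [[[bS _ _] _] _ _ _ _]]]].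
have /choice [m hm] : forall n, exists m, implemented (S n) m /\ Cs m.
  by move=> n; have [[m [T' [m' [[h _] _ _ Cm _]]]] _] := hS n; exists m.
have diff n l : implemented (S n - S l) (m n - m l).
  have := implementedP (-1) (hm l).1 (hm n).1.
  by rewrite !scaleN1r !(addrC (- _)).
have bSS n l : opbound (S n - S l) (n.+1%:R^-1 + l.+1%:R^-1).
  move=> x; rewrite mulrDl [leRHS]addrC.
  have -> : (S n - S l) x = (T - S l) x - (T - S n) x.
    rewrite -[(S n - S l) x]/(S n x - S l x) -[(T - S l) x]/(T x - S l x) -[(T - S n) x]/(T x - S n x).
    by rewrite opprB addrC addrA subrK.
  by apply: le_trans (hnormB _ _) _; apply: lerD; [exact: (hS l).2|exact: (hS n).2].
have bmm n l x : hnorm (m n x - m l x) <= (n.+1%:R^-1 + l.+1%:R^-1) * hnorm x.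
  have [bd bmd am] := diff n l.
  by apply: (asymptotic_opbound bd.1 bmd.1 am _ (bSS n l) x); rewrite addr_ge0 ?invr_ge0.
have [m0 bm0 cm0] : exists2 m0, bounded_operator m0 & opcvg m m0.
  apply: opcvg_exists; first by move=> n; case: (hm n) => [[]].
  move=> e e0; have e2 : 0 < e / 2 by rewrite divr_gt0.
  have [N hN] := invSn_small e2; exists N => n l hn hl x.
  apply: le_trans (bmm n l x) _; rewrite ler_wpM2r ?hnorm_ge0// [leRHS]splitr.
  by apply: lerD; apply: ltW; exact: hN.
have Cm0 : Cs m0.
  apply: Ccl => // e e0; have e2 : 0 < e / 2 by rewrite divr_gt0.
  have [N hN] := cm0 _ e2; exists (m N); first by case: (hm N).
  apply: (@le_lt_trans _ _ (e / 2)); last by rewrite ltr_pdivrMr// ltr_pMr// ltr1n.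
  apply: opnorm_le; first exact: ltW.
  by move=> x; rewrite -[(m0 - m N) x]/(m0 x - m N x) hnormBC; apply: hN.
(* A three-term estimate stated for arbitrary sequences, since it serves for T and again for its
   adjoint. *)
have impl (T1 : L -> L) (S1 : nat -> L -> L) (m1 : nat -> cn k -> cn k) (n0 : cn k -> cn k) :
    bounded_operator T1 -> bounded_operator n0 -> (forall n, implemented (S1 n) (m1 n)) ->
    (forall n, opbound (T1 - S1 n) n.+1%:R^-1) -> opcvg m1 n0 -> implemented T1 n0.
  move=> bT1 bn0 h1 h2 h3; split=> // e e0.
  have e4 : 0 < e / 4 by rewrite divr_gt0.
  have c0 : 0 < 2 * k%:R + 1 :> R by rewrite ltr_wpDl// mulr_ge0.
  have [N1 hN1] := invSn_small e4.
  have [N2 hN2] := h3 _ (divr_gt0 e4 c0).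
  pose n := maxn N1 N2.
  have [_ _ am] := h1 n; have [N hN] := am _ e4.
  exists N => j hj p.
  apply: le_trans (hnorm_triB _ (ampl (S1 n) (v j p)) _) _.
  have q1 : hnorm (ampl T1 (v j p) - ampl (S1 n) (v j p)) <= e / 4 * 2.
    have := opbound_ampl (I := I j) _ (h2 n) (v j p); rewrite invr_ge0 ler0n => /(_ isT).
    rewrite -[ampl (T1 - S1 n) _]/(ampl T1 (v j p) - ampl (S1 n) (v j p)) => h; apply: le_trans h _.
    by apply: ler_pM; rewrite ?invr_ge0 ?hnorm_ge0// ltW// hN1// leq_maxl.
  have q2 : hnorm (hlift (v j) (m1 n (hbasis p)) - hlift (v j) (n0 (hbasis p))) <= e / 4.
    rewrite -(linearfB (hlift_linear _)); apply: le_trans (hnorm_hlift _ _) _.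
    apply: le_trans (ler_wpM2l (ler0n R 2) (hl1_hnorm _)) _.
    apply: (@le_trans _ _ (2 * (k%:R * (e / 4 / (2 * k%:R + 1))))).
      rewrite ler_wpM2l// ler_wpM2l//; have := hN2 n (leq_maxr _ _) (hbasis p).
      by rewrite hnorm_hbasis mulr1.
    by rewrite mulrA mulrA ler_pdivrMr// mulrC ler_wpM2l ?(ltW e4)// lerDl.
  apply: le_trans (lerD q1 (hnorm_triB _ (hlift (v j) (m1 n (hbasis p))) _)) _.
  apply: le_trans (lerD (lexx _) (lerD (hN j hj p) q2)) _.
  lra.
have [T' bT' TT'] := adjoint_exists bT.
have [m0' bm0' mm0'] := adjoint_exists bm0.
(* The adjoint data of S n comes with a partner of its own; uniqueness identifies that partner with
   the m n chosen above. *)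
have /choice [m' hm'] : forall n, exists m', adjoint_of (m n) m' /\ exists S', adjoint_of (S n) S' /\ implemented S' m'.
  move=> n; have [[m1 [S' [m1' [[h1 h2] h3 h4 h5 h6]]]] _] := hS n.
  by exists m1'; rewrite (implemented_uniq (hm n).1 h1); split=> //; exists S'.
have /choice [S' hS'] := fun n => (hm' n).2.
exists m0, T', m0'; split=> //; last exact: Cstar mm0'.
split.
  by apply: (impl T S m) => // n; [exact: (hm n).1|exact: (hS n).2].
apply: (impl T' S' m') => //.
- by move=> n; exact: (hS' n).2.
- move=> n; apply: (@opbound_adjoint _ _ (T - S n)); rewrite ?invr_ge0//; last exact: (hS n).2.
  exact: adjointB TT' (hS' n).1.
- move=> e e0; have [N hN] := cm0 _ e0; exists N => n hn x.
  exact: (opbound_adjoint (adjointB (hm' n).1 mm0') (ltW e0) (hN n hn)).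
Qed.

Lemma star_implemented_cstar : cstar_algebra star_implemented.
Proof.
have [[Cb C0 CP CM Ccl] Cstar] := CsC.
split; last first.
  move=> T S [m [T' [m' [[h1 h2] h3 h4 h5 h6]]]] bS TS.
  rewrite (adjoint_uniq TS h3); exists m', T, m; split=> //; exact: adjoint_sym.
split.
- by move=> T [m [T' [m' [[[]]]]]].
- exists 0, 0, 0; split=> //; first by split; exact: implemented0.
    by move=> x y; rewrite -[(0 : L -> L) x]/(0 : L) -[(0 : L -> L) y]/(0 : L) inner0l inner0r.
  by move=> x y; rewrite -[(0 : cn k -> cn k) x]/(0 : cn k) -[(0 : cn k -> cn k) y]/(0 : cn k) inner0l inner0r.
- move=> a S T [m [S' [m' [[h1 h2] h3 h4 h5 h6]]]] [n [T' [n' [[g1 g2] g3 g4 g5 g6]]]].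
  exists (a *: m + n), (a^*%C *: S' + T'), (a^*%C *: m' + n'); split; try exact: adjointP; try exact: CP.
  by split; exact: implementedP.
- move=> S T [m [S' [m' [[h1 h2] h3 h4 h5 h6]]]] [n [T' [n' [[g1 g2] g3 g4 g5 g6]]]].
  exists (m \o n), (T' \o S'), (n' \o m'); split; try exact: adjointM; try exact: CM.
  by split; exact: implementedM.
- exact: star_implemented_closed.
Qed.

End Homomorphism.

(** * Existence of a finite-dimensional envelope *)

Section EnvelopeTheorem.
Context {R : realType}.
Local Notation C := R[i].
Local Notation cn := (@hcn R).

Lemma finite_dimensional_unital_span (H : hilbertType R) (G : set (H -> H)) :
  unital_operator_algebra G -> finite_dimensional G ->
  exists d (b : 'I_d.+1 -> H -> H), [/\ forall i, G (b i), b ord0 = id &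
    forall T, G T -> exists c : 'I_d.+1 -> C, T = \sum_i c i *: b i].
Proof.
move=> [hG Gid] [n [w [Gw hw]]].
exists n, (fun i => if unlift ord0 i is Some j then w j else id); split.
- by move=> i; case: unliftP.
- by rewrite unlift_none.
move=> T /hw [c ->]; exists (fun i => if unlift ord0 i is Some j then c j else 0).
rewrite big_ord_recl unlift_none scale0r add0r; apply: eq_bigr => i _.
by rewrite liftK.
Qed.

Lemma implemented_sum k (L : hilbertType R) (I : nat -> finType) (v : forall j, 'I_k -> hpower (I j) L)
    d (c : 'I_d -> C) (S : 'I_d -> L -> L) (E : 'I_d -> cn k -> cn k) :
  (forall i, implemented v (S i) (E i)) ->
  implemented v (\sum_i c i *: S i) (\sum_i c i *: E i).
Proof.
move=> h; elim: d c S E h => [|d IH] c S E h; first by rewrite !big_ord0; exact: implemented0.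
by rewrite !big_ord_recl; apply: implementedP => //; exact: IH.
Qed.

Theorem matricial_envelope (H : hilbertType R) (G : set (H -> H)) k0 (eps0 : (H -> H) -> cn k0 -> cn k0) :
  unital_operator_algebra G -> finite_dimensional G -> unital_complete_isometry G eps0 ->
  finite_dimensional_cstar_envelope G.
Proof.
move=> uG fG uci0; have [hG Gid] := uG.
have [d [b [Gb b0 span]]] := finite_dimensional_unital_span uG fG.
have Gs := operator_algebra_subspace hG.
have Gbd : G `<=` bounded_operator by case: hG.
pose P k := `[< exists eps : (H -> H) -> cn k -> cn k, unital_complete_isometry G eps >].
have exP : exists k, P k by exists k0; apply/asboolP; exists eps0.
have [k /asboolP [eps uci] kmin] := ex_minnP exP.
have kmin' k' (eps' : (H -> H) -> cn k' -> cn k') : unital_complete_isometry G eps' -> (k <= k')%N.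
  by move=> h; apply: kmin; apply/asboolP; exists eps'.
have rigid := minimal_rigid hG Gb b0 span uci kmin'.
have [be lin e1 ci] := uci.
pose E i := eps (b i).
have bE i : bounded_operator (E i) by exact: be.
have E0 : E ord0 = id by rewrite /E b0.
have /choice [E' hE'] : forall i, exists E', bounded_operator E' /\ adjoint_of (E i) E'.
  by move=> i; have [E' ? ?] := adjoint_exists (bE i); exists E'.
have epsb : eps @` G `<=` bounded_operator by move=> _ [T GT <-]; exact: be.
pose Cs := cstar_generated (eps @` G).
have CsC : cstar_algebra Cs := cstar_generated_cstar epsb.
have CsE i : Cs (E i) by apply: sub_cstar_generated; exists (b i).
have CsE' i : Cs (E' i) by apply: CsC.2 (CsE i) _ _; case: (hE' i).
exists (cn k), eps; split; last first.
  by apply: hcn_operators_finite; [case: CsC.1|exact: operator_algebra_subspace CsC.1].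
split=> // L phi ucip; have [bp plin p1 _] := ucip.
pose S i := phi (b i).
have bS i : bounded_operator (S i) by exact: bp.
have S0 : S ord0 = id by rewrite /S b0.
have /choice [S' hS'] : forall i, exists S', bounded_operator S' /\ adjoint_of (S i) S'.
  by move=> i; have [S' ? ?] := adjoint_exists (bS i); exists S'.
have [domE1 domE2] := uci_mxdom Gbd Gs Gb uci.
have [domS1 domS2] := uci_mxdom Gbd Gs Gb ucip.
have domSE : mxdom S E := mxdom_trans domS2 domE1.
have domES : mxdom E S := mxdom_trans domE2 domS1.
have appr (j : nat) : exists x : {I : finType & 'I_k -> hpower I L}, [/\ near_model S E j.+1%:R^-1 (projT2 x),
    forall i p, hnorm (ampl (S i) (projT2 x p) - hlift (projT2 x) (E i (hbasis p))) < j.+1%:R^-1 &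
    forall i p, hnorm (ampl (S' i) (projT2 x p) - hlift (projT2 x) (E' i (hbasis p))) < j.+1%:R^-1].
  have j0 : 0 < j.+1%:R^-1 :> R by rewrite invr_gt0.
  have [I [v h]] := approximate_intertwining bE (fun i => (hE' i).1) (fun i => (hE' i).2) E0 rigid
    bS (fun i => (hS' i).2) S0 domSE domES j0.
  by exists (existT _ I v).
have [x hx] := choice appr.
pose I j := projT1 (x j); pose v j : 'I_k -> hpower (I j) L := projT2 (x j).
have v2 j p : hnorm (v j p) <= 2.
  rewrite -ler_sqr ?nnegrE ?hnorm_ge0//.
  have [nm _ _] := hx j; apply: le_trans (near_model_norm E0 p S0 nm) _.
  have h : j.+1%:R^-1 <= 1 :> R by rewrite invf_le1 ?ltr0n// ler1n.
  by move: h; set q := _^-1 => h; lra.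
have v_isom e : 0 < e -> exists N, forall j, (N <= j)%N -> forall (y z : cn k),
    cmod (inner (hlift (v j) y) (hlift (v j) z) - inner y z) <= e * hl1 y * hl1 z.
  move=> e0; have [N hN] := invSn_small e0; exists N => j hj y z.
  have [nm _ _] := hx j; apply: le_trans (near_model_isometry bE E0 S0 nm y z) _.
  by rewrite ler_wpM2r ?hl1_ge0// ler_wpM2r ?hl1_ge0// ltW// hN.
have impS i : implemented v (S i) (E i).
  split=> // e e0; have [N hN] := invSn_small e0; exists N => j hj p.
  by have [_ h _] := hx j; apply: ltW; apply: lt_trans (h i p) _; exact: hN.
have impS' i : implemented v (S' i) (E' i).
  split; [by case: (hS' i)|by case: (hE' i)|].
  move=> e e0; have [N hN] := invSn_small e0; exists N => j hj p.
  by have [_ _ h] := hx j; apply: ltW; apply: lt_trans (h i p) _; exact: hN.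
have impG T : G T -> implemented v (phi T) (eps T).
  move=> /span [c ->]; rewrite (linear_on_sum Gs lin)// (linear_on_sum Gs plin)//.
  exact: implemented_sum.
have uniq T m n : implemented v T m -> implemented v T n -> m = n by exact: implemented_uniq.
have MC := star_implemented_cstar v2 v_isom CsC.
have MS := operator_algebra_subspace MC.1.
have sub : cstar_generated (phi @` G) `<=` star_implemented v Cs.
  apply: cstar_generated_sub => // _ [T /span [c ->] <-].
  rewrite (linear_on_sum Gs plin)//; apply: subspace_sum => // i; apply: subspaceZ => //.
  exists (E i), (S' i), (E' i); split;
    [by split; [exact: impS|exact: impS']|by case: (hS' i)|by case: (hE' i)|exact: CsE|exact: CsE'].
(* Operators without a partner get the default value 0; [pi] is only constrained on C*(phi(G)),
   where partners exist. *)
have [pi hpi] : exists pi : (L -> L) -> (cn k -> cn k), forall T m, implemented v T m -> pi T = m.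
  have /choice [pi hpi] : forall T, exists m, forall m', implemented v T m' -> m = m'.
    move=> T; have [[m hm]|hn] := pselect (exists m, implemented v T m).
      by exists m => m' hm'; exact: uniq hm hm'.
    by exists 0 => m' hm'; case: hn; exists m'.
  by exists pi.
exists pi; split; last by move=> T GT; apply: hpi; exact: impG.
have [[_ _ genP genM _] _] : cstar_algebra (cstar_generated (phi @` G)).
  by apply: cstar_generated_cstar => _ [T GT <-]; exact: bp.
split.
- by move=> T /sub [m [T' [m' [[h _] _ _ Cm _]]]]; rewrite (hpi _ _ h).
- move=> a T U /sub [m [T' [m' [[h _] _ _ _ _]]]] /sub [n [U' [n' [[g _] _ _ _ _]]]].
  rewrite (hpi _ _ h) (hpi _ _ g); apply: hpi; exact: implementedP.
- move=> T U /sub [m [T' [m' [[h _] _ _ _ _]]]] /sub [n [U' [n' [[g _] _ _ _ _]]]].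
  rewrite (hpi _ _ h) (hpi _ _ g); apply: hpi; exact: implementedM.
- move=> T U /sub [m [T' [m' [[h h'] adT adm _ _]]]] _ TU.
  by rewrite (adjoint_uniq TU adT) (hpi _ _ h) (hpi _ _ h').
Qed.

End EnvelopeTheorem.

(** * Transfer of finite dimension *)

Section FiniteDimensionTransfer.
Context {R : realType}.
Local Notation C := R[i].

Lemma opbound_mxop1 (H : hilbertType R) (T : H -> H) (M : R) :
  opbound (mxop (\matrix_(i < 1, j < 1) T)) M <-> opbound T M.
Proof.
have E (x : hpower 'I_1 H) : hnorm x = hnorm (x ord0).
  by apply/eqP; rewrite -(@eqrXn2 _ 2) ?hnorm_ge0// hnorm_hpower big_ord1.
have mE (x : hpower 'I_1 H) : mxop (\matrix_(i < 1, j < 1) T) x ord0 = T (x ord0).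
  by rewrite /mxop big_ord1 mxE.
split=> h x; last by rewrite !E mE.
by have := h (fun=> x); rewrite !E mE.
Qed.

Lemma mxopnorm_eq (H K : hilbertType R) n (S : 'M[H -> H]_n) (T : 'M[K -> K]_n) :
  (forall i j, bounded_operator (S i j)) -> (forall i j, bounded_operator (T i j)) ->
  (forall M : R, 0 <= M -> opbound (mxop S) M <-> opbound (mxop T) M) ->
  mxopnorm S = mxopnorm T.
Proof.
move=> bS bT h; rewrite !mxopnormE; apply/eqP; rewrite eq_le.
have [bS' bT'] := (bounded_mxop bS, bounded_mxop bT).
rewrite !opnorm_le ?opnorm_ge0//; first by apply/h; [exact: opnorm_ge0|exact: opnorm_bound].
by apply/h; [exact: opnorm_ge0|exact: opnorm_bound].
Qed.

Lemma ci_injective (H K : hilbertType R) (A : set (H -> H)) (phi : (H -> H) -> K -> K) :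
  A `<=` bounded_operator -> completely_isometric_on A phi ->
  forall T, A T -> phi T = 0 -> T = 0.
Proof.
move=> Ab ci T AT p0; pose T1 : 'M[H -> H]_1 := \matrix_(i < 1, j < 1) T.
have AT1 i j : A (T1 i j) by rewrite mxE.
have T0 : opbound T 0.
  apply/opbound_mxop1; apply: opbound_opnorm => //; first by apply: bounded_mxop => i j; exact: Ab.
  rewrite -mxopnormE -ci// mxopnormE; apply: opnorm_le => // x.
  rewrite mul0r [mxop _ x](_ : _ = 0) ?hnorm0//.
  by apply/funext => i; rewrite /mxop big1// => j _; rewrite !mxE p0.
apply/funext => x; apply: hnorm_eq0; apply/eqP; rewrite eq_le hnorm_ge0 andbT.
by rewrite (le_trans (T0 x))// mul0r.
Qed.

(** Finite dimension is pulled back: preimages of a spanning family of phi(A) span A because phi is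
    injective. *)
Lemma finite_dimensional_ci (H K : hilbertType R) (A : set (H -> H)) (phi : (H -> H) -> K -> K) :
  A `<=` bounded_operator -> subspace A -> linear_on A phi -> completely_isometric_on A phi ->
  finite_dimensional (phi @` A) -> finite_dimensional A.
Proof.
move=> Ab As lin ci [n [w [pw hw]]].
have /choice [g hg] : forall i, exists T, A T /\ phi T = w i.
  by move=> i; have [T AT <-] := pw i; exists T.
exists n, g; split; first by move=> i; case: (hg i).
move=> T AT; have [|c hc] := hw (phi T); first by exists T.
exists c.
have Asum : A (\sum_i c i *: g i).
  by apply: subspace_sum => // i; apply: subspaceZ => //; case: (hg i).
have sum : phi (\sum_i c i *: g i) = phi T.
  rewrite (linear_on_sum As lin); last by move=> i; case: (hg i).
  by rewrite hc; apply: eq_bigr => i _; case: (hg i) => _ ->.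
have AD : A (-1 *: (\sum_i c i *: g i) + T) by exact: As.2.
have D0 := ci_injective Ab ci AD.
rewrite lin// sum scaleN1r addNr in D0.
by apply/eqP; rewrite -subr_eq0 addrC -scaleN1r D0.
Qed.

Lemma finite_dimensional_image (V W : lmodType C) (S : set V) (f : V -> W) :
  subspace S -> (forall (a : C) x y, S x -> S y -> f (a *: x + y) = a *: f x + f y) ->
  finite_dimensional S -> finite_dimensional (f @` S).
Proof.
move=> Ss lin [n [w [Sw hw]]].
have f0 : f 0 = 0.
  have := lin 1 0 0 Ss.1 Ss.1; rewrite !scale1r addr0 => h.
  by apply: (addrI (f 0)); rewrite -h addr0.
exists n, (f \o w); split; first by move=> i; exists (w i).
move=> _ [x Sx <-]; have [c ->] := hw x Sx; exists c.
elim: n w Sw c {hw} => [|n IH] w Sw c; first by rewrite !big_ord0.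
rewrite !big_ord_recl lin ?IH//.
by apply: subspace_sum => // i; exact: subspaceZ.
Qed.

Lemma finite_dimensional_sub (V : lmodType C) (S S' : set V) : subspace S -> S `<=` S' ->
  finite_dimensional S' -> finite_dimensional S.
Proof.
move=> Ss SS' [n [w [_ hw]]]; apply: (subspace_finite_dimensional (w := w)) => // x /SS'.
exact: hw.
Qed.

Lemma subspace_image (V W : lmodType C) (S : set V) (f : V -> W) :
  subspace S -> (forall (a : C) x y, S x -> S y -> f (a *: x + y) = a *: f x + f y) ->
  subspace (f @` S).
Proof.
move=> Ss lin; split.
  exists 0; first by case: Ss.
  have := lin 1 0 0 Ss.1 Ss.1; rewrite !scale1r addr0 => h.
  by apply: (addrI (f 0)); rewrite -h addr0.
move=> a _ _ [x Sx <-] [y Sy <-]; exists (a *: x + y); first exact: Ss.2.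
exact: lin.
Qed.

Lemma finite_dimensional_of_envelope (H : hilbertType R) (G : set (H -> H)) :
  operator_algebra G -> finite_dimensional_cstar_envelope G -> finite_dimensional G.
Proof.
move=> hG [K [eps [[[be lin _ ci] _] fd]]].
have Gs := operator_algebra_subspace hG.
apply: (finite_dimensional_ci (phi := eps)) => //; first by case: hG.
apply: finite_dimensional_sub fd; first exact: subspace_image.
exact: sub_cstar_generated.
Qed.

Lemma similar_finite_dimensional (K : hilbertType R) (F G : set (K -> K)) :
  operator_algebra G -> similar_algebras F G -> finite_dimensional G -> finite_dimensional F.
Proof.
move=> hG [Z [Zinv [_ bZi _ _ ->]]]; apply: finite_dimensional_image.
  exact: operator_algebra_subspace.
by move=> a S T _ _; apply/funext => x; exact: bZi.1.
Qed.

Lemma conjugate_algebra (K : hilbertType R) (F : set (K -> K)) (Z Zinv : K -> K) :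
  bounded_operator Z -> bounded_operator Zinv -> Zinv \o Z = id -> Z \o Zinv = id ->
  unital_operator_algebra F -> unital_operator_algebra [set Z \o X \o Zinv | X in F].
Proof.
move=> bZ bZi ZiZ ZZi [[Fb F0 FP FM Fcl] Fid].
have ZiZx x : Zinv (Z x) = x := congr1 (fun f => f x) ZiZ.
have ZZix x : Z (Zinv x) = x := congr1 (fun f => f x) ZZi.
split; last by exists id => //; rewrite compidr.
split.
- by move=> _ [X FX <-]; apply: bounded_comp bZi; apply: bounded_comp bZ _; exact: Fb.
- by exists 0 => //; apply/funext => x; exact: (linearf0 bZ.1).
- move=> a _ _ [S FS <-] [T FT <-]; exists (a *: S + T); first exact: FP.
  by apply/funext => x; exact: bZ.1.
- move=> _ _ [S FS <-] [T FT <-]; exists (S \o T); first exact: FM.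
  by apply/funext => x; rewrite /= ZiZx.
move=> T bT hT; exists (Zinv \o T \o Z); last first.
  by apply/funext => x; rewrite /= !ZZix.
apply: Fcl; first by apply: bounded_comp bZ; exact: bounded_comp.
move=> e e0.
have [M M0 hM] := bounded_opbound bZ; have [N N0 hN] := bounded_opbound bZi.
(* Undoing the conjugation multiplies distances by at most N M, a bound for |Zinv| |Z|; the 1 avoids
   dividing by 0. *)
have c0 : 0 < N * M + 1 by rewrite ltr_wpDl// mulr_ge0.
have [_ [X FX <-] hX] := hT _ (divr_gt0 e0 c0).
exists X => //.
have bD : bounded_operator (T - (Z \o X \o Zinv)).
  by apply: boundedB bT; apply: bounded_comp bZi; apply: bounded_comp bZ _; exact: Fb.
have D0 := opnorm_ge0 bD.
apply: (@le_lt_trans _ _ (N * M * opnorm (T - (Z \o X \o Zinv)))).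
  apply: opnorm_le; first by rewrite !mulr_ge0.
  move=> x.
  have -> : ((Zinv \o T \o Z) - X) x = Zinv ((T - (Z \o X \o Zinv)) (Z x)).
    rewrite -[LHS]/(Zinv (T (Z x)) - X x) -[(T - _) (Z x)]/(T (Z x) - Z (X (Zinv (Z x)))).
    by rewrite (linearfB bZi.1) !ZiZx.
  apply: le_trans (hN _) _; rewrite -!mulrA ler_wpM2l//.
  apply: le_trans (opnorm_bound bD _) _; rewrite mulrCA ler_wpM2l//.
rewrite ltr_pdivlMr// in hX; apply: le_lt_trans hX.
by rewrite mulrC ler_wpM2l// lerDl.
Qed.

End FiniteDimensionTransfer.

(** * Direct sums and the regular representation *)

Section DirectSum.
Context {R : realType} {L1 L2 : hilbertType R}.
Local Notation C := R[i].

Definition dsum (S : L1 -> L1) (m : L2 -> L2) : hsum L1 L2 -> hsum L1 L2 :=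
  fun x => (S x.1, m x.2).

Lemma hsum_le1 (x : hsum L1 L2) : hnorm x.1 <= hnorm x.
Proof.
by rewrite -ler_sqr ?nnegrE ?hnorm_ge0// hnorm_hsum lerDl sqr_ge0.
Qed.

Lemma hsum_le2 (x : hsum L1 L2) : hnorm x.2 <= hnorm x.
Proof.
by rewrite -ler_sqr ?nnegrE ?hnorm_ge0// hnorm_hsum lerDr sqr_ge0.
Qed.

Lemma hnorm_inl (x : L1) : hnorm ((x, 0) : hsum L1 L2) = hnorm x.
Proof.
apply/eqP; rewrite -(@eqrXn2 _ 2) ?hnorm_ge0// hnorm_hsum /= hnorm0.
by rewrite expr0n addr0.
Qed.

Lemma hnorm_inr (x : L2) : hnorm ((0, x) : hsum L1 L2) = hnorm x.
Proof.
apply/eqP; rewrite -(@eqrXn2 _ 2) ?hnorm_ge0// hnorm_hsum /= hnorm0.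
by rewrite expr0n add0r.
Qed.

Lemma opbound_dsum S m (M : R) : 0 <= M -> opbound S M -> opbound m M -> opbound (dsum S m) M.
Proof.
move=> M0 hS hm x.
rewrite -ler_sqr ?nnegrE ?mulr_ge0 ?hnorm_ge0// exprMn !hnorm_hsum mulrDr -!exprMn.
by apply: lerD; rewrite ler_sqr ?nnegrE ?mulr_ge0 ?hnorm_ge0//; [exact: hS|exact: hm].
Qed.

Lemma bounded_dsum S m : bounded_operator S -> bounded_operator m -> bounded_operator (dsum S m).
Proof.
move=> bS bm; have [M M0 hM] := bounded_opbound bS; have [N N0 hN] := bounded_opbound bm.
split; first by move=> a x y; congr pair; [exact: bS.1|exact: bm.1].
exists (M + N); apply: opbound_dsum; first exact: addr_ge0.
  by move=> x; apply: le_trans (hM x) _; rewrite ler_wpM2r ?hnorm_ge0// lerDl.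
by move=> x; apply: le_trans (hN x) _; rewrite ler_wpM2r ?hnorm_ge0// lerDr.
Qed.

(** Compression to the second summand. On G it returns lam T, and it is the unital complete isometry
    into matrices that [matricial_envelope] requires. *)
Definition corner2 (X : hsum L1 L2 -> hsum L1 L2) : L2 -> L2 := fun y => (X (0, y)).2.

Lemma corner2P (a : C) X Y : corner2 (a *: X + Y) = a *: corner2 X + corner2 Y.
Proof. by apply/funext. Qed.

Lemma corner2_id : corner2 id = id.
Proof. by []. Qed.

Definition mxdsum n (S : 'M[L1 -> L1]_n) (m : 'M[L2 -> L2]_n) : 'M[hsum L1 L2 -> hsum L1 L2]_n :=
  \matrix_(a, b) dsum (S a b) (m a b).

Lemma hnorm_hpower_hsum n (x : hpower 'I_n (hsum L1 L2)) :
  hnorm x ^+ 2 = hnorm ((fun a => (x a).1) : hpower 'I_n L1) ^+ 2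
    + hnorm ((fun a => (x a).2) : hpower 'I_n L2) ^+ 2.
Proof.
rewrite !hnorm_hpower -big_split; apply: eq_bigr => a _.
by rewrite hnorm_hsum.
Qed.

Lemma mxop_mxdsum n (S : 'M[L1 -> L1]_n) (m : 'M[L2 -> L2]_n) x a :
  mxop (mxdsum S m) x a = (mxop S (fun b => (x b).1) a, mxop m (fun b => (x b).2) a).
Proof.
rewrite /mxop; under eq_bigr do rewrite mxE.
have sumE (F : 'I_n -> hsum L1 L2) : \sum_b F b = (\sum_b (F b).1, \sum_b (F b).2).
  by elim/big_rec3: _ => // i y1 y2 y _ ->.
exact: sumE.
Qed.

Lemma opbound_mxdsum n (S : 'M[L1 -> L1]_n) (m : 'M[L2 -> L2]_n) (M : R) : 0 <= M ->
  opbound (mxop S) M -> opbound (mxop m) M -> opbound (mxop (mxdsum S m)) M.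
Proof.
move=> M0 hS hm x.
rewrite -ler_sqr ?nnegrE ?mulr_ge0 ?hnorm_ge0// exprMn !hnorm_hpower_hsum mulrDr -!exprMn.
apply: lerD.
  rewrite (_ : (fun a => _) = mxop S (fun b => (x b).1)); last first.
    by apply/funext => a; rewrite mxop_mxdsum.
  by rewrite ler_sqr ?nnegrE ?mulr_ge0 ?hnorm_ge0//; exact: hS.
rewrite (_ : (fun a => _) = mxop m (fun b => (x b).2)); last first.
  by apply/funext => a; rewrite mxop_mxdsum.
by rewrite ler_sqr ?nnegrE ?mulr_ge0 ?hnorm_ge0//; exact: hm.
Qed.

Lemma opbound_mxdsum1 n (S : 'M[L1 -> L1]_n) (m : 'M[L2 -> L2]_n) (M : R) :
  opbound (mxop (mxdsum S m)) M -> opbound (mxop S) M.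
Proof.
move=> h x; pose x' : hpower 'I_n (hsum L1 L2) := fun a => (x a, 0).
have -> : hnorm x = hnorm x'.
  apply/eqP; rewrite -(@eqrXn2 _ 2) ?hnorm_ge0// !hnorm_hpower; apply/eqP.
  by apply: eq_bigr => a _; rewrite hnorm_inl.
apply: le_trans (h x').
rewrite -ler_sqr ?nnegrE ?hnorm_ge0// !hnorm_hpower; apply: ler_sum => a _.
rewrite ler_sqr ?nnegrE ?hnorm_ge0// mxop_mxdsum.
exact: (hsum_le1 (mxop S x a, _)).
Qed.

Lemma opbound_mxdsum2 n (S : 'M[L1 -> L1]_n) (m : 'M[L2 -> L2]_n) (M : R) :
  opbound (mxop (mxdsum S m)) M -> opbound (mxop m) M.
Proof.
move=> h x; pose x' : hpower 'I_n (hsum L1 L2) := fun a => (0, x a).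
have -> : hnorm x = hnorm x'.
  apply/eqP; rewrite -(@eqrXn2 _ 2) ?hnorm_ge0// !hnorm_hpower; apply/eqP.
  by apply: eq_bigr => a _; rewrite hnorm_inr.
apply: le_trans (h x').
rewrite -ler_sqr ?nnegrE ?hnorm_ge0// !hnorm_hpower; apply: ler_sum => a _.
rewrite ler_sqr ?nnegrE ?hnorm_ge0// mxop_mxdsum.
exact: (hsum_le2 (_, mxop m x a)).
Qed.

End DirectSum.

(** * Scalar matrices acting on vectors with entries in H *)

Section TensorBound.
Context {R : realType} {H : hilbertType R}.
Local Notation C := R[i].
Local Notation cn := (@hcn R).

(** The operator m (x) 1 on C^d (x) H. *)
Definition mxact d (m : cn d -> cn d) (u : hpower 'I_d H) : hpower 'I_d H :=
  fun i => \sum_j (m (hbasis j) i : C) *: u j.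

(* Expanding the H-valued entries in an orthonormal family reduces the action
   of scalar matrices on them to finitely many scalar vectors. *)
Lemma opbound_mxact d n (X : 'M[cn d -> cn d]_n) (M : R) : (forall a b, linear (X a b)) ->
  opbound (mxop X) M -> 0 <= M -> forall y : 'I_n -> hpower 'I_d H,
  \sum_a hnorm (\sum_b mxact (X a b) (y b)) ^+ 2 <= M ^+ 2 * \sum_b hnorm (y b) ^+ 2.
Proof.
move=> lX hM M0 y.
pose J : finType := ('I_n * 'I_d)%type.
have [N [e [oe _ ye]]] := gram_schmidt_ord (fun p : 'I_#|J| => y (enum_val p).1 (enum_val p).2).
have yE b j : y b j = \sum_t inner (y b j) (e t) *: e t.
  by have := ye (enum_rank (b, j)); rewrite enum_rankK.
have pyth (z : 'I_N -> C) : hnorm (\sum_t z t *: e t) ^+ 2 = \sum_t cmod (z t) ^+ 2.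
  apply: complexI; rewrite -inner_hnorm inner_suml rmorph_sum; apply: eq_bigr => t _.
  rewrite innerZl inner_sumr (bigD1 t)//= big1 => [|s /negPf st]; last first.
    by rewrite innerZr oe eq_sym st mulr0.
  by rewrite innerZr oe eqxx addr0 mulr1 mulrC mulJ_cmod.
(* The scalar vectors of coefficients along e_t; m (x) 1 acts on each of them separately. *)
pose yt t : hpower 'I_n (cn d) := fun b j => inner (y b j) (e t).
have hy b j : hnorm (y b j) ^+ 2 = \sum_t cmod (yt t b j) ^+ 2.
  by rewrite {1}yE pyth.
have hX a i : hnorm ((\sum_b mxact (X a b) (y b)) i) ^+ 2 = \sum_t cmod (mxop X (yt t) a i) ^+ 2.
  rewrite -pyth; congr (hnorm _ ^+ 2); rewrite hpower_sumE.
  have -> : \sum_t (mxop X (yt t) a i : C) *: e t = \sum_b \sum_j \sum_t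
      ((X a b (hbasis j) i : C) * (yt t b j : C)) *: e t.
    have xE t : mxop X (yt t) a i = \sum_b \sum_j (X a b (hbasis j) i : C) * (yt t b j : C).
      rewrite /mxop hpower_sumE; apply: eq_bigr => b _.
      rewrite (linear_hlift _ (lX a b)) /hlift hpower_sumE; apply: eq_bigr => j _.
      exact: mulrC.
    under eq_bigr do rewrite xE scaler_suml.
    rewrite exchange_big; apply: eq_bigr => b _ /=.
    by under eq_bigr do rewrite scaler_suml; rewrite exchange_big.
  apply: eq_bigr => b _; apply: eq_bigr => j _.
  rewrite {1}yE scaler_sumr; apply: eq_bigr => t _.
  by rewrite scalerA.
have -> : \sum_a hnorm (\sum_b mxact (X a b) (y b)) ^+ 2 = \sum_t hnorm (mxop X (yt t)) ^+ 2.
  transitivity (\sum_a \sum_i \sum_t cmod (mxop X (yt t) a i) ^+ 2).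
    by apply: eq_bigr => a _; rewrite hnorm_hpower; apply: eq_bigr => i _; exact: hX.
  under eq_bigr do rewrite exchange_big /=.
  rewrite exchange_big; apply: eq_bigr => t _ /=.
  by rewrite hnorm_hpower; apply: eq_bigr => a _; rewrite hnorm_hcn.
have -> : \sum_b hnorm (y b) ^+ 2 = \sum_t hnorm (yt t) ^+ 2.
  transitivity (\sum_b \sum_j \sum_t cmod (yt t b j) ^+ 2).
    by apply: eq_bigr => b _; rewrite hnorm_hpower; apply: eq_bigr => j _; exact: hy.
  under eq_bigr do rewrite exchange_big /=.
  rewrite exchange_big; apply: eq_bigr => t _ /=.
  by rewrite hnorm_hpower; apply: eq_bigr => b _; rewrite hnorm_hcn.
rewrite mulr_sumr; apply: ler_sum => t _.
by rewrite -exprMn ler_sqr ?nnegrE ?mulr_ge0 ?hnorm_ge0.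
Qed.

End TensorBound.

(** * The regular representation and the similarity *)

Section MatricialModel.
Context {R : realType} {H : hilbertType R}.
Local Notation C := R[i].
Local Notation cn := (@hcn R).
Variable A : set (H -> H).
Hypothesis hA : unital_operator_algebra A.

Let As : subspace A := operator_algebra_subspace hA.1.
Let Abd : A `<=` bounded_operator. Proof. by case: hA.1. Qed.
Let AM S T : A S -> A T -> A (S \o T). Proof. by case: hA.1 => _ _ _ h _; exact: h. Qed.

(* Left multiplication on A, for an inner product <T, U> = sum_s <T h_s, U h_s>
   on A: being the restriction of a multiple of the identity representation to
   an invariant subspace, it is completely contractive. *)
Lemma regular_representation : finite_dimensional A ->
  exists d (a : 'I_d -> H -> H) (lam : (H -> H) -> cn d -> cn d),
  [/\ forall i, A (a i), exists g : 'I_d -> C, id = \sum_i g i *: a i,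
      forall T, A T -> forall j x, T (a j x) = \sum_i (lam T (hbasis j) i : C) *: a i x,
      [/\ forall T, A T -> bounded_operator (lam T), linear_on A lam, lam id = id & multiplicative_on A lam] &
      forall n (T : 'M[H -> H]_n) (M : R), (forall i j, A (T i j)) -> 0 <= M ->
        opbound (mxop T) M -> opbound (mxop (map_mx lam T)) M].
Proof.
move=> fA; have [n0 [b [Ab b0 span]]] := finite_dimensional_unital_span hA fA.
have [m [h sep]] := separating_vectors b.
(* Evaluation at the separating vectors embeds A in H^m; the inner product on A is the one induced
   by J. *)
pose J (T : H -> H) : hpower 'I_m H := fun s => T (h s).
have Jsum n (c : 'I_n -> C) (T : 'I_n -> H -> H) : J (\sum_i c i *: T i) = \sum_i c i *: J (T i).
  by apply/funext => s; rewrite hpower_sumE /J fct_sumx.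
have Jinj T : A T -> J T = 0 -> T = 0.
  move=> /span [c ->] J0; apply: sep => s.
  by rewrite -[LHS]/(J (\sum_i c i *: b i) s) J0.
have [d [y [oy yx xy]]] := gram_schmidt_ord (fun i => J (b i)).
have /choice [g hg] := yx.
(* The orthonormal basis of A: J carries a_j to y_j. *)
pose a j := \sum_i g j i *: b i.
have Aa j : A (a j) by apply: subspace_sum => // i; exact: subspaceZ.
have Ja j : J (a j) = y j by rewrite Jsum -hg.
pose W : hpower 'I_m H -> cn d := coordinates y.
have lW : linear W := @coordinates_linear _ _ _ y.
have yJ T : A T -> J T = \sum_j inner (J T) (y j) *: y j.
  move=> /span [c ->]; rewrite Jsum.
  under [RHS]eq_bigr do rewrite inner_suml scaler_suml.
  rewrite exchange_big; apply: eq_bigr => i _ /=; rewrite {1}xy scaler_sumr.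
  by apply: eq_bigr => j _; rewrite scalerA; congr (_ *: _); rewrite -innerZl.
have VWJ T : A T -> hlift y (W (J T)) = J T by move=> AT; rewrite [RHS]yJ.
have WV := hliftK oy.
have hV := hnorm_isometry (inner_hlift y) WV.
have hW := hnorm_coisometry (inner_hlift y) WV.
have aJ T : A T -> T = \sum_j inner (J T) (y j) *: a j.
  move=> AT; set T' := \sum_j _.
  have AT' : A T' by apply: subspace_sum => // j; exact: subspaceZ.
  have JT' : J T' = J T by rewrite Jsum [RHS]yJ//; apply: eq_bigr => j _; rewrite Ja.
  have : -1 *: T' + T = 0.
    apply: Jinj; first exact: As.2.
    rewrite -[LHS]/(-1 *: J T' + J T) JT' scaleN1r; exact: addNr.
  by rewrite scaleN1r => /eqP; rewrite addrC subr_eq0 => /eqP.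
pose lam (T : H -> H) : cn d -> cn d := fun x => W (ampl T (hlift y x)).
(* J(A) is invariant under the amplification of T, as A is closed under products. This is what makes
   the compression [lam] multiplicative. *)
have amplJ T (x : cn d) : A T -> exists2 U, A U & ampl T (hlift y x) = J U.
  move=> AT; exists (T \o (\sum_j (x j : C) *: a j)).
    by apply: AM => //; apply: subspace_sum => // j; exact: subspaceZ.
  have -> : hlift y x = J (\sum_j (x j : C) *: a j).
    by rewrite Jsum; apply: eq_bigr => j _; rewrite Ja.
  by [].
exists d, a, lam; split=> //.
- by exists (fun j => inner (J id) (y j)); apply: aJ; exact: hA.2.
- move=> T AT j x.
  have E : T \o a j = \sum_i (lam T (hbasis j) i : C) *: a i.
    rewrite {1}(aJ _ (AM AT (Aa j))); apply: eq_bigr => i _.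
    by rewrite /lam hlift_hbasis -(Ja j).
  by rewrite -[LHS]/((T \o a j) x) E fct_sumx.
- split.
  + move=> T AT; apply: bounded_linear => t x z; rewrite /lam.
    by rewrite (hlift_linear y) (bounded_ampl _ (Abd AT)).1 lW.
  + move=> t S T AS AT; apply/funext => x.
    rewrite -[RHS]/(t *: W (ampl S (hlift y x)) + W (ampl T (hlift y x))) -lW.
    by [].
  + by apply/funext => x; exact: WV.
  + move=> S T AS AT; apply/funext => x; rewrite /lam /=.
    have [U AU E] := amplJ T x AT.
    by rewrite E VWJ// -E.
- move=> n T M AT M0 hM x.
  (* The index s of the separating vectors is moved outside, so that the bound on T is used for each
     s separately. *)
  pose yx' s : hpower 'I_n H := fun l => hlift y (x l) s.
  have E l : mxop (map_mx lam T) x l = W (fun s => mxop T (yx' s) l).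
    rewrite /mxop; under eq_bigr do rewrite mxE.
    rewrite -(linearf_sum lW); congr W; apply/funext => s.
    by rewrite hpower_sumE.
  rewrite -ler_sqr ?nnegrE ?mulr_ge0 ?hnorm_ge0// hnorm_hpower.
  apply: (@le_trans _ _ (\sum_s hnorm (mxop T (yx' s)) ^+ 2)).
    have -> : \sum_s hnorm (mxop T (yx' s)) ^+ 2 =
        \sum_l hnorm ((fun s => mxop T (yx' s) l) : hpower 'I_m H) ^+ 2.
      under eq_bigr do rewrite hnorm_hpower.
      by rewrite exchange_big; apply: eq_bigr => l _; rewrite hnorm_hpower.
    by apply: ler_sum => l _; rewrite E ler_sqr ?nnegrE ?hnorm_ge0.
  have -> : hnorm x = hnorm ((fun l => hlift y (x l)) : hpower 'I_n (hpower 'I_m H)).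
    apply/eqP; rewrite -(@eqrXn2 _ 2) ?hnorm_ge0// !hnorm_hpower.
    by apply/eqP; apply: eq_bigr => l _; rewrite hV.
  rewrite exprMn hnorm_hpower.
  have -> : \sum_l hnorm (hlift y (x l)) ^+ 2 = \sum_s hnorm (yx' s) ^+ 2.
    under eq_bigr do rewrite hnorm_hpower.
    by rewrite exchange_big; apply: eq_bigr => s _; rewrite hnorm_hpower.
  rewrite mulr_sumr; apply: ler_sum => s _.
  by rewrite -exprMn ler_sqr ?nnegrE ?mulr_ge0 ?hnorm_ge0.
Qed.

(* With P = sum_i a_i a_i^*, the operator u |-> P^(-1/2) sum_i a_i u_i is a
   coisometry intertwining lam (x) 1 with T |-> P^(-1/2) T P^(1/2). *)
Lemma similar_to_contractive d (a : 'I_d -> H -> H) (lam : (H -> H) -> cn d -> cn d) :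
  (forall i, A (a i)) -> (exists g : 'I_d -> C, id = \sum_i g i *: a i) ->
  (forall T, A T -> forall j x, T (a j x) = \sum_i (lam T (hbasis j) i : C) *: a i x) ->
  (forall T, A T -> bounded_operator (lam T)) ->
  exists S Sinv : H -> H, [/\ bounded_operator S, bounded_operator Sinv, S \o Sinv = id, Sinv \o S = id &
    forall n (T : 'M[H -> H]_n) (M : R), (forall i j, A (T i j)) -> 0 <= M ->
      opbound (mxop (map_mx lam T)) M -> opbound (mxop (map_mx (fun X : H -> H => S \o X \o Sinv) T)) M].
Proof.
move=> Aa [g idE] rel blam.
have ba i : bounded_operator (a i) by exact: Abd.
have /choice [a' ha'] : forall i, exists a', bounded_operator a' /\ adjoint_of (a i) a'.
  by move=> i; have [a' ? ?] := adjoint_exists (ba i); exists a'.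
pose P : H -> H := \sum_i (a i \o a' i).
have PE x : P x = \sum_i a i (a' i x) by rewrite /P fct_sumx.
have bP : bounded_operator P.
  by apply: bounded_sum => i _; apply: bounded_comp (ba i) _; case: (ha' i).
have Pinner x y : inner (P x) y = \sum_i inner (a' i x) (a' i y).
  by rewrite PE inner_suml; apply: eq_bigr => i _; exact: (ha' i).2.
have sP : adjoint_of P P.
  move=> x y; rewrite Pinner innerC Pinner rmorph_sum; apply: eq_bigr => i _.
  by rewrite /= -innerC.
pose ax x : hpower 'I_d H := fun i => a' i x.
have Pax x : rinner (P x) x = hnorm (ax x) ^+ 2.
  by rewrite /rinner Pinner -rinner_hnorm.
pose Gm := \sum_i cmod (g i).
have Gm0 : 0 <= Gm by apply: sumr_ge0 => i _; exact: cmod_ge0.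
(* Since the identity is a combination of the a_i, |x|^2 is the sum of the g_i <x, a_i^* x>. This
   bounds P from below. *)
have lowx x : hnorm x <= Gm * hnorm (ax x).
  have [x0|xn0] := eqVneq (hnorm x) 0; first by rewrite x0 mulr_ge0 ?hnorm_ge0.
  have xp : 0 < hnorm x by rewrite lt_def xn0 hnorm_ge0.
  rewrite -(ler_pM2l xp) -expr2 -rinner_hnorm.
  have -> : rinner x x = complex.Re (\sum_i g i * inner x (a' i x)).
    rewrite /rinner; congr complex.Re; rewrite -[X in inner X _]/(id x) idE fct_sumx inner_suml.
    apply: eq_bigr => i _; rewrite -[(g i *: a i) x]/(g i *: a i x) innerZl.
    by rewrite (ha' i).2.
  apply: le_trans (ler_norm _) (le_trans (cmod_Re _) _).
  apply: le_trans (cmod_sum _ _ _) _; rewrite /Gm mulr_suml mulr_sumr; apply: ler_sum => i _.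
  rewrite cmodM mulrCA ler_wpM2l ?cmod_ge0//; apply: le_trans (inner_CS _ _) _.
  by rewrite ler_wpM2l ?hnorm_ge0//; exact: (hnorm_le_hpower (ax x) i).
have c0 : 0 < (Gm ^+ 2 + 1)^-1 by rewrite invr_gt0 ltr_wpDl// sqr_ge0.
have lowP x : (Gm ^+ 2 + 1)^-1 * hnorm x ^+ 2 <= rinner (P x) x.
  rewrite Pax ler_pdivrMl ?ltr_wpDl ?sqr_ge0//.
  apply: (@le_trans _ _ ((Gm * hnorm (ax x)) ^+ 2)).
    by rewrite ler_sqr ?nnegrE ?mulr_ge0 ?hnorm_ge0.
  by rewrite exprMn ler_wpM2r ?sqr_ge0// lerDl.
have [S [S1 [bS bS1 sS [SS1 S1S S1P]]]] := inverse_sqrt bP sP c0 lowP.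
exists S, S1; split=> // n T M AT M0 hM.
have S1Sx x : S1 (S x) = x := congr1 (fun f => f x) S1S.
have SS1x x : S (S1 x) = x := congr1 (fun f => f x) SS1.
(* q is the row operator of the a_i, with q q^* = P. Then Rr = P^(-1/2) q is a coisometry with
   adjoint Rs. *)
pose q (u : hpower 'I_d H) := \sum_i a i (u i).
pose Rr (u : hpower 'I_d H) := S (q u).
pose Rs x := ax (S x).
have Radj x (u : hpower 'I_d H) : inner (Rs x) u = inner x (Rr u).
  by rewrite innerC [RHS]innerC sS inner_suml; congr conjc; apply: eq_bigr => i _; rewrite (ha' i).2.
have RRs x : Rr (Rs x) = x.
  by rewrite /Rr /q /Rs /ax -PE -S1P S1Sx SS1x.
have hRs := hnorm_isometry Radj RRs.
have hRr := hnorm_coisometry Radj RRs.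
have lRr : linear Rr.
  move=> t u w; rewrite /Rr -bS.1; congr S; rewrite /q scaler_sumr -big_split.
  by apply: eq_bigr => i _; exact: (ba i).1.
(* From U a_j = sum_i lam(U)_ij a_i one gets U q = q (lam(U) (x) 1), hence S U S^-1 = Rr (lam(U) (x)
   1) Rs. *)
have key U x : A U -> S (U (S1 x)) = Rr (mxact (lam U) (Rs x)).
  move=> AU; have lU := (Abd AU).1.
  have -> : S1 x = q (Rs x) by rewrite -[q _]S1Sx -/(Rr (Rs x)) RRs.
  rewrite /Rr; congr S; rewrite /q (linearf_sum lU).
  under eq_bigr do rewrite rel//.
  rewrite exchange_big; apply: eq_bigr => i _ /=.
  rewrite /mxact (linearf_sum (ba i).1); apply: eq_bigr => j _.
  by rewrite (linearfZ (ba i).1).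
move=> x; pose y l := Rs (x l).
have E l : mxop (map_mx (fun X : H -> H => S \o X \o S1) T) x l = Rr (\sum_r mxact (map_mx lam T l r) (y r)).
  rewrite /mxop (linearf_sum lRr); apply: eq_bigr => r _.
  by rewrite [map_mx lam T l r]mxE -key// mxE.
rewrite -ler_sqr ?nnegrE ?mulr_ge0 ?hnorm_ge0// hnorm_hpower exprMn.
apply: (@le_trans _ _ (\sum_l hnorm (\sum_r mxact (map_mx lam T l r) (y r)) ^+ 2)).
  by apply: ler_sum => l _; rewrite E ler_sqr ?nnegrE ?hnorm_ge0.
have lX l r : linear (map_mx lam T l r) by rewrite mxE; exact: (blam _ (AT l r)).1.
apply: le_trans (opbound_mxact lX hM M0 y) _.
rewrite (hnorm_hpower x) (eq_bigr (fun l => hnorm (x l) ^+ 2))// => l _.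
by rewrite hRs.
Qed.

End MatricialModel.

(** * The algebra of the operators T (+) lam T *)

Section DirectSumRepresentation.
Context {R : realType}.
Local Notation C := R[i].

Variables (H L : hilbertType R) (A : set (H -> H)) (lam : (H -> H) -> L -> L).
Hypothesis hA : unital_operator_algebra A.
Hypothesis blam : forall T, A T -> bounded_operator (lam T).
Hypothesis llam : linear_on A lam.
Hypothesis lam1 : lam id = id.
Hypothesis mlam : multiplicative_on A lam.
Hypothesis cc : forall n (T : 'M[H -> H]_n) (M : R), (forall i j, A (T i j)) -> 0 <= M ->
  opbound (mxop T) M -> opbound (mxop (map_mx lam T)) M.

Definition dsum_rep (T : H -> H) : hsum H L -> hsum H L := dsum T (lam T).

Let Abd : A `<=` bounded_operator. Proof. by case: hA.1. Qed.
Let As : subspace A := operator_algebra_subspace hA.1.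

Lemma linear_dsum_rep : linear_on A dsum_rep.
Proof. by move=> a S T AS AT; rewrite /dsum_rep llam. Qed.

Lemma multiplicative_dsum_rep : multiplicative_on A dsum_rep.
Proof. by move=> S T AS AT; rewrite /dsum_rep mlam. Qed.

Lemma bounded_dsum_rep T : A T -> bounded_operator (dsum_rep T).
Proof. by move=> AT; apply: bounded_dsum; [exact: Abd|exact: blam]. Qed.

Lemma opbound_dsum_rep T (M : R) : A T -> 0 <= M -> opbound T M -> opbound (dsum_rep T) M.
Proof.
move=> AT M0 hT; apply: opbound_dsum => //.
apply/opbound_mxop1; have := cc (n := 1) (T := \matrix_(i < 1, j < 1) T) (M := M).
rewrite [map_mx _ _](_ : _ = \matrix_(i < 1, j < 1) lam T); last by apply/matrixP => i j; rewrite !mxE.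
by apply=> //; [move=> i j; rewrite mxE|apply/opbound_mxop1].
Qed.

(** The norm of a direct sum is the larger of the two, and lam never exceeds the first summand. *)
Lemma ci_dsum_rep : completely_isometric_on A dsum_rep.
Proof.
move=> n T AT.
have E : map_mx dsum_rep T = mxdsum T (map_mx lam T) by apply/matrixP => i j; rewrite !mxE.
apply: mxopnorm_eq => [i j|i j|M M0]; first by rewrite mxE; exact: bounded_dsum_rep.
  exact: Abd.
rewrite E; split; first exact: opbound_mxdsum1.
by move=> h; apply: opbound_mxdsum => //; exact: cc.
Qed.

Lemma bij_dsum_rep : set_bij A (dsum_rep @` A) dsum_rep.
Proof.
split; [by move=> T AT; exists T| |by []].
move=> S T _ _ E; apply/funext => x.
exact: (congr1 (fun U => (U ((x, 0) : hsum H L)).1) E).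
Qed.

Lemma unital_operator_algebra_dsum_rep : unital_operator_algebra (dsum_rep @` A).
Proof.
have [_ A0 AP AM Acl] := hA.1.
split; last by exists id; [exact: hA.2|rewrite /dsum_rep lam1; apply/funext => -[]].
split.
- by move=> _ [T AT <-]; exact: bounded_dsum_rep.
- exists 0 => //; have := linear_dsum_rep 1 A0 A0.
  by rewrite !scale1r addr0 => h; apply: (addrI (dsum_rep 0)); rewrite -h addr0.
- by move=> a _ _ [S AS <-] [T AT <-]; exists (a *: S + T); [exact: AP|exact: linear_dsum_rep].
- by move=> _ _ [S AS <-] [T AT <-]; exists (S \o T); [exact: AM|exact: multiplicative_dsum_rep].
move=> T bT hT.
have [M M0 hM] := bounded_opbound bT.
(* The first corner of the limit T lies in A since A is closed. T is then T1 (+) lam T1, because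
   both are close to the same element of the image: this uses that [dsum_rep] is contractive on
   A. *)
pose T1 (h : H) : H := (T (h, 0)).1.
have bT1 : bounded_operator T1.
  split.
    move=> a x y; rewrite /T1 [(_, _)](_ : _ = a *: ((x, 0) : hsum H L) + (y, 0)); last first.
      by apply: (congr1 (pair (a *: x + y))); rewrite -[RHS]/(a *: (0 : L) + 0) scaler0 addr0.
    by rewrite bT.1.
  exists M => x; apply: le_trans (hsum_le1 _) _.
  by rewrite -(@hnorm_inl _ H L); exact: hM.
have bD U : A U -> bounded_operator (T - dsum_rep U).
  by move=> AU; apply: boundedB bT; exact: bounded_dsum_rep.
have le1 U : A U -> opnorm (T1 - U) <= opnorm (T - dsum_rep U).
  move=> AU; have b := bD U AU; apply: opnorm_le; first exact: opnorm_ge0.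
  move=> x; apply: le_trans (hsum_le1 ((T - dsum_rep U) (x, 0))) _.
  by rewrite -(@hnorm_inl _ H L x); exact: (opnorm_bound b (x, 0)).
have AT1 : A T1.
  apply: Acl => // e e0; have [_ [U AU <-] hU] := hT e e0.
  by exists U => //; apply: le_lt_trans hU; exact: le1.
exists T1 => //; apply/funext => x; apply/eqP; rewrite -subr_eq0; apply/eqP/hnorm_eq0/eqP.
rewrite eq_le hnorm_ge0 andbT; apply/ler_addgt0Pl => e e0; rewrite addr0.
have c0 : 0 < 2 * hnorm x + 1 by rewrite ltr_wpDl// mulr_ge0 ?hnorm_ge0.
have [_ [U AU <-] hU] := hT _ (divr_gt0 e0 c0).
have AD : A (-1 *: U + T1) by exact: As.2.
have D1 : opbound (-1 *: U + T1) (opnorm (T - dsum_rep U)).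
  apply: opbound_opnorm; [exact: Abd|exact/opnorm_ge0/bD|].
  by rewrite scaleN1r addrC; exact: le1.
have D2 := opbound_dsum_rep AD (opnorm_ge0 (bD U AU)) D1.
rewrite linear_dsum_rep// scaleN1r addrC in D2.
apply: le_trans (hnorm_triB _ (dsum_rep U x) _) _.
apply: (@le_trans _ _ (opnorm (T - dsum_rep U) * (2 * hnorm x))); last first.
  rewrite ltr_pdivlMr// in hU; apply: le_trans (ltW hU).
  by rewrite ler_wpM2l ?lerDl//; exact/opnorm_ge0/bD.
rewrite mulrCA mulr_natl mulr2n; apply: lerD; first exact: D2.
by rewrite hnormBC; exact: (opnorm_bound (bD U AU) x).
Qed.

End DirectSumRepresentation.

Theorem corollary3p4 (R : realType) (H : hilbertType R) (A : set (H -> H))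
    (hA : unital_operator_algebra A) :
  finite_dimensional A <->
  exists (K : hilbertType R) (F G : set (K -> K)),
    [/\ unital_operator_algebra F,
        completely_isometrically_isomorphic A F,
        unital_operator_algebra G,
        similar_algebras F G
      & finite_dimensional_cstar_envelope G].
Proof.
have As := operator_algebra_subspace hA.1.
have Ab : A `<=` bounded_operator by case: hA.1.
split; last first.
  (* Finite dimension passes from the envelope of G to G, through the similarity to F, and along the
     injective theta back to A. *)
  move=> [K [F [G [_ [theta [bij lin _ ci]] hG sim env]]]].
  apply: (finite_dimensional_ci (phi := theta)) => //.
  have -> : theta @` A = F.
    have [sub _ sur] := bij; apply/seteqP; split; [|exact: sur].
    by move=> _ [T AT <-]; exact: sub.
  apply: similar_finite_dimensional sim _; first exact: hG.1.
  exact: finite_dimensional_of_envelope hG.1 env.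
move=> fA.
have [d [a [lam [Aa aid rel [blam llam lam1 mlam] cc]]]] := regular_representation hA fA.
have [S [Sinv [bS bSi SSi SiS sim]]] := similar_to_contractive hA Aa aid rel blam.
have SSix x : S (Sinv x) = x := congr1 (fun f => f x) SSi.
have SiSx x : Sinv (S x) = x := congr1 (fun f => f x) SiS.
pose L : hilbertType R := hcn (R := R) d.
pose K : hilbertType R := hsum H L.
pose theta : (H -> H) -> K -> K := dsum_rep lam.
(* Conjugating by S (+) 1 alters the first summand only; the second must stay equal to lam T to
   dominate it. *)
pose Z : K -> K := dsum S id; pose Zinv : K -> K := dsum Sinv id.
have bZ : bounded_operator Z by apply: bounded_dsum bS _; exact: bounded_id.
have bZi : bounded_operator Zinv by apply: bounded_dsum bSi _; exact: bounded_id.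
have ZZi : Z \o Zinv = id by apply/funext => -[x y]; rewrite /Z /Zinv /dsum /= SSix.
have ZiZ : Zinv \o Z = id by apply/funext => -[x y]; rewrite /Z /Zinv /dsum /= SiSx.
pose F := theta @` A; pose G := [set Z \o X \o Zinv | X in F].
have hF : unital_operator_algebra F by exact: unital_operator_algebra_dsum_rep.
have hG : unital_operator_algebra G by exact: conjugate_algebra.
have Fs := operator_algebra_subspace hF.1.
exists K, F, G; split=> //.
- exists theta; split.
  + exact: bij_dsum_rep.
  + exact: linear_dsum_rep.
  + exact: multiplicative_dsum_rep.
  + exact: ci_dsum_rep.
- exists Z, Zinv; split=> //; apply/seteqP; split.
    move=> X FX; exists (Z \o X \o Zinv); first by exists X.
    by apply/funext => x; rewrite -[RHS](congr1 (fun f => f (X x)) ZiZ) /= -[in RHS](congr1 (fun f => f x) ZiZ).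
  move=> _ [_ [X FX <-] <-]; rewrite (_ : _ \o _ = X)//.
  apply/funext => x; rewrite -[RHS](congr1 (fun f => f (X x)) ZiZ) /= -[in RHS](congr1 (fun f => f x) ZiZ).
  by [].
have fG : finite_dimensional G.
  have lZ (t : R[i]) X Y : F X -> F Y -> Z \o (t *: X + Y) \o Zinv = t *: (Z \o X \o Zinv) + (Z \o Y \o Zinv).
    by move=> _ _; apply/funext => x; exact: (bZ.1 t (X (Zinv x)) (Y (Zinv x))).
  apply: (finite_dimensional_image Fs lZ).
  exact: (finite_dimensional_image As (linear_dsum_rep llam)).
pose eps : (K -> K) -> L -> L := @corner2 R H L.
have GE X : G X -> exists2 T, A T & X = dsum (S \o T \o Sinv) (lam T).
  by move=> [_ [T AT <-] <-]; exists T.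
apply: (matricial_envelope (eps0 := eps) hG fG); split.
- by move=> X /GE [T AT ->]; exact: blam.
- by move=> t X Y _ _; exact: corner2P.
- exact: corner2_id.
move=> n X GX.
have /choice [f hf] : forall p : 'I_n * 'I_n, exists T, A T /\ X p.1 p.2 = dsum (S \o T \o Sinv) (lam T).
  by move=> p; have [T] := GE _ (GX p.1 p.2); exists T.
pose T : 'M[H -> H]_n := \matrix_(i, j) f (i, j).
have AT i j : A (T i j) by rewrite mxE; case: (hf (i, j)).
have XE : X = mxdsum (map_mx (fun X : H -> H => S \o X \o Sinv) T) (map_mx lam T).
  by apply/matrixP => i j; rewrite !mxE; case: (hf (i, j)).
have eE : map_mx eps X = map_mx lam T.
  by apply/matrixP => i j; rewrite XE !mxE.
(* On G the first summand S T S^-1 is dominated by lam T, so discarding it does not change the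
   matrix norms. *)
rewrite eE XE; apply: mxopnorm_eq => [i j|i j|M M0].
- by rewrite mxE; exact: blam.
- by rewrite -XE; have [[Gb _ _ _ _] _] := hG; exact: Gb.
- split; last exact: opbound_mxdsum2.
  by move=> h; apply: opbound_mxdsum => //; exact: sim.
Qed.
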